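(* Let $f$, $\sigma$, $Y_0$ satisfy the assumptions (i)–(ii) of the context and let $\alpha>0$. Then for any $p>0$, the continuous-time tamed Euler approximation $Y^\alpha_N$ converges to the solution $Y$ of the SDE in $\mathbf L^p$-sense with order $\alpha\wedge1$, that is, there is a constant $K$ independent of $N$ such that for all $N\ge1$ $$\sup_{t\in[0,T]}\mathbf E|Y^\alpha_N(t)-Y(t)|^p\le K\,N^{-(\alpha\wedge1)p}.$$
   Context: Setting. $T>0$; $d,m\ge1$ are integers; $(\Omega,\mathcal F,\mathbf P)$ is a probability space with a filtration $\{\mathcal F_t\}_{t\in[0,T]}$ satisfying the usual conditions; $\mathbf W=(W_1,\ldots,W_m)^\top$ is an $m$-dimensional standard Brownian motion with respect to it; $a\wedge b=\min\{a,b\}$; $\lceil\cdot\rceil$ is the ceiling function. $f:\mathbb R^d\to\mathbb R^d$; $\sigma\in\mathbb R^{d\times m}$ is a constant matrix; $\mathcal D^2f$ is the second derivative. Assumptions. (i) $f\in\mathbf C^2(\mathbb R^d)$, $\mathcal D^2f$ has at most polynomial growth (i.e. $\|\mathcal D^2f(x)\|\le C(1+|x|^\eta)$ for some $C,\eta>0$ and all $x$), and there is $L_2>0$ with $2\langle x-y,f(x)-f(y)\rangle\le L_2|x-y|^2$ for all $x,y\in\mathbb R^d$. (ii) $Y_0$ is an $\mathcal F_0$-measurable $\mathbb R^d$-valued random variable with $\mathbf E|Y_0|^p<\infty$ for all $p\ge1$. Under (i) there exist $L_3>0$ and $l>0$ with $|f(x)-f(y)|\le L_3(1+|x|^l+|y|^l)|x-y|$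 for all $x,y$; such an $l$ is fixed. $Y$ is the unique strong solution on $[0,T]$ of $\mathrm dY(t)=f(Y(t))\,\mathrm dt+\sigma\,\mathrm d\mathbf W(t)$, $Y(0)=Y_0$. Tamed Euler method. For $\alpha>0$ and $N\in\mathbb N$, $N\ge1$, set $l_\alpha=\lceil2\alpha\rceil l$, $f^\alpha(x)=\frac{f(x)}{1+(T/N)^\alpha|x|^{l_\alpha}}$, and let $Y^\alpha_N(t)=Y_0+\int_0^tf^\alpha(Y^\alpha_N(\kappa_N(s)))\,\mathrm ds+\int_0^t\sigma\,\mathrm d\mathbf W(s)$, $t\in[0,T]$, where $\kappa_N(s)=\lfloor\frac{Ns}{T}\rfloor\frac TN$. *)

(* Defs.v *)
From mathcomp Require Export all_boot all_order all_algebra.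
From mathcomp Require Export all_classical all_reals all_analysis.

Set Implicit Arguments.
Unset Strict Implicit.
Unset Printing Implicit Defensive.

Import Order.TTheory GRing.Theory Num.Theory.
Export numFieldNormedType.Exports.

Local Open Scope classical_set_scope.
Local Open Scope ring_scope.

(* The canonical norm of ['cV[R]_d] in the library is the sup norm; the
   Euclidean structure is therefore introduced separately. *)
Section Euclidean.
Context {R : realType} {d : nat}.
Implicit Types x y : 'cV[R]_d.

Definition dot x y : R := \sum_(i < d) x i 0 * y i 0.
Definition enorm x : R := Num.sqrt (dot x x).
End Euclidean.

Section Drift.
Context {R : realType} {d : nat}.
Implicit Types (f : 'cV[R]_d -> 'cV[R]_d) (x u v : 'cV[R]_d).

(* D^2 f(x) as a bilinear map: the derivative at x, in the direction v, of
   y |-> Df(y)u. *)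
Definition second_diff f x u v : 'cV[R]_d := 'd (fun y => 'd f y u) x v.

(* In finite dimension, differentiability of Df and continuity of D^2 f as
   maps into spaces of (bi)linear maps can be tested on fixed arguments. *)
Definition C2 f : Prop :=
  [/\ forall x, differentiable f x,
      forall u x, differentiable (fun y => 'd f y u) x
    & forall u v, continuous (fun x => second_diff f x u v)].

(* Operator norm of a bilinear map, with values in [0, +oo]. *)
Definition bilin_norm (B : 'cV[R]_d -> 'cV[R]_d -> 'cV[R]_d) : \bar R :=
  ereal_sup [set (enorm (B uv.1 uv.2))%:E |
    uv in [set uv | enorm uv.1 <= 1 /\ enorm uv.2 <= 1]].

Definition second_diff_poly_growth f : Prop :=
  exists C eta : R, [/\ 0 < C, 0 < eta &
    forall x, (bilin_norm (second_diff f x) <=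
               (C * (1 + enorm x `^ eta))%:E)%E].

Definition one_sided_lipschitz f : Prop :=
  exists L : R, 0 < L /\
    forall x y, 2 * dot (x - y) (f x - f y) <= L * enorm (x - y) ^+ 2.

Definition drift_assumption f : Prop :=
  [/\ C2 f, second_diff_poly_growth f & one_sided_lipschitz f].

Definition poly_lipschitz_exponent f (l : R) : Prop :=
  exists L : R, 0 < L /\
    forall x y, enorm (f x - f y) <=
      L * (1 + enorm x `^ l + enorm y `^ l) * enorm (x - y).

End Drift.

Section Stochastics.
Context {R : realType} {disp : measure_display} {Omega : measurableType disp}.
Variables (P : probability Omega R) (T : R).

Definition borel {n} : set_system 'cV[R]_n := <<s open >>.

Definition measurable_wrt {n} (G : set_system Omega) (X : Omega -> 'cV[R]_n) :=
  forall B, borel B -> G (X @^-1` B).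

(* Filtrations and processes indexed by [0, T] are represented by functions on
   R; their values outside [0, T] are irrelevant. *)
Definition filtration (F : R -> set_system Omega) : Prop :=
  [/\ forall t, 0 <= t <= T -> sigma_algebra [set: Omega] (F t),
      forall t, 0 <= t <= T -> F t `<=` measurable
    & forall s t, 0 <= s -> s <= t -> t <= T -> F s `<=` F t].

Definition usual_conditions (F : R -> set_system Omega) : Prop :=
  [/\ filtration F,
      forall N, measurable N -> P N = 0%E -> F 0 N
    & forall t, 0 <= t < T ->
        \bigcap_(s in [set s | t < s <= T]) F s `<=` F t].

Definition adapted {n} (F : R -> set_system Omega)
    (X : R -> Omega -> 'cV[R]_n) : Prop :=
  forall t, 0 <= t <= T -> measurable_wrt (F t) (X t).

Definition as_continuous {n} (X : R -> Omega -> 'cV[R]_n) : Prop :=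
  {ae P, forall w, {within `[0, T], continuous (fun t => X t w)}}.

Definition independent_of {n} (X : Omega -> 'cV[R]_n) (G : set_system Omega) :=
  forall A B, G A -> borel B ->
    P (A `&` X @^-1` B) = (P A * P (X @^-1` B))%E.

(* X ~ N(0, h I_n), i.e. the coordinates of X are independent N(0, h); the
   second parameter of [normal_prob] is the standard deviation. *)
Definition std_gaussian {n} (h : R) (X : Omega -> 'cV[R]_n) : Prop :=
  forall B : 'I_n -> set R, (forall i, measurable (B i)) ->
    P [set w | forall i, B i (X w i 0)] =
    (\prod_(i < n) normal_prob 0%R (Num.sqrt h) (B i))%E.

Definition brownian_motion {m} (F : R -> set_system Omega)
    (W : R -> Omega -> 'cV[R]_m) : Prop :=
  [/\ adapted F W,
      {ae P, forall w, W 0 w = 0},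
      as_continuous W
    & forall s t, 0 <= s -> s < t -> t <= T ->
        independent_of (fun w => W t w - W s w) (F s) /\
        std_gaussian (t - s) (fun w => W t w - W s w)].

(* Almost surely, for all t in [0, T],
     X(t) = X0 + int_0^t b(s) ds + int_0^t sigma dW(s).
   The matrix sigma being constant, the Ito integral is that of an elementary
   integrand, namely sigma (W(t) - W(0)). *)
Definition integral_equation {d m} (b : R -> Omega -> 'cV[R]_d)
    (sigma : 'M[R]_(d, m)) (X0 : Omega -> 'cV[R]_d)
    (W : R -> Omega -> 'cV[R]_m) (X : R -> Omega -> 'cV[R]_d) : Prop :=
  {ae P, forall w, forall t, 0 <= t <= T ->
    X t w = X0 w
      + \col_i \int[lebesgue_measure]_(s in `[0, t]) (b s w i 0)
      + sigma *m (W t w - W 0 w)}.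

Definition strong_solution {d m} (F : R -> set_system Omega)
    (f : 'cV[R]_d -> 'cV[R]_d) (sigma : 'M[R]_(d, m))
    (Y0 : Omega -> 'cV[R]_d) (W : R -> Omega -> 'cV[R]_m)
    (Y : R -> Omega -> 'cV[R]_d) : Prop :=
  [/\ adapted F Y, as_continuous Y
    & integral_equation (fun s w => f (Y s w)) sigma Y0 W Y].

Definition tamed_drift {d} (f : 'cV[R]_d -> 'cV[R]_d) (l alpha : R) (N : nat)
    (x : 'cV[R]_d) : 'cV[R]_d :=
  (1 + (T / N%:R) `^ alpha * enorm x `^ ((Num.ceil (2 * alpha))%:~R * l))^-1
    *: f x.

Definition grid_floor (N : nat) (s : R) : R :=
  (Num.floor (N%:R * s / T))%:~R * (T / N%:R).

Definition tamed_euler {d m} (F : R -> set_system Omega)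
    (f : 'cV[R]_d -> 'cV[R]_d) (l alpha : R) (sigma : 'M[R]_(d, m))
    (Y0 : Omega -> 'cV[R]_d) (W : R -> Omega -> 'cV[R]_m) (N : nat)
    (YN : R -> Omega -> 'cV[R]_d) : Prop :=
  adapted F YN /\
  integral_equation
    (fun s w => tamed_drift f l alpha N (YN (grid_floor N s) w))
    sigma Y0 W YN.

End Stochastics.

(* Main.v *)
From HB Require Import structures.
Require Import Defs.
From mathcomp Require Import measurable_realfun ring lra.
Import Order.TTheory GRing.Theory Num.Theory.
Set Implicit Arguments.
Unset Strict Implicit.
Unset Printing Implicit Defensive.
Local Open Scope classical_set_scope.
Local Open Scope ring_scope.

(** The noise being additive, it disappears from the difference [Y - YN] of the
    solution and its approximation, which is almost surely a piecewise
    differentiable function of time; the whole estimate is made path by path and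
    moments are taken at the end.

    Why the order is [min alpha 1] and not one half.  On a grid cell starting at
    [tau], with [x = YN tau] and [g] the tamed drift at [x], one has
    [YN s - x = (s - tau) g + sigma (W s - W tau)].  Expanding [f] at [x], the
    drift defect [f (YN s) - g] is the sum of a taming error of size
    [N ^ - alpha], of terms of size [1/N] (the drift displacement and the
    quadratic Taylor remainder), and of [Df(x) sigma (W s - W tau)], whose size
    is only [N ^ - 1/2].  This last term is centred given the past, so that its
    time integrals over the cells are the increments of a martingale: [N]
    increments of size [N ^ - 3/2] add up to [1/N] only ([Lp_bigO_martingale],
    [mart_Lp]).  This martingale [M] is subtracted from the error.  The corrected
    error [e = Y - YN - M] is piecewise differentiable, and the one-sided Lipschitz
    condition gives [(|e|^2)' <= (C + 1) |e|^2 + rho^2] with a remainder [rho]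
    which is [O(N ^ - min alpha 1)] in every [L^p] ([drift_remainder_bound],
    [interval_error], [subcell_remainder_Lp]).  Gronwall's lemma concludes.

    The remainder involves powers of [YN], whose moments have to be bounded
    uniformly in [N].  The exponent of the taming is made for this: it gives
    [sqrt (T/N) |g| <= C (1 + |x|)] ([tamed_drift_linear_growth]).  Hence, once
    the noise [b] is subtracted, the scheme obeys a recursion
    [|z_(k+1)|^2 <= (1 + K/N) |z_k|^2 + Q(|b|)/N], with [Q] a polynomial, on each
    path ([tamed_path_sqr]), and the moments of [YN] are bounded by those of the
    noise and of the initial value ([YN_Lp]).

    Two discretisations keep all random variables elementary.  The martingale is
    a double sum over cells and over [N] nodes inside each cell, linearly
    interpolated in time; between two nodes the noise moves by [O(1/N)], which
    goes to the remainder.  And the time integral of [rho^2] in Gronwall's lemma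
    is replaced by Riemann sums, the inequality then holding from a rank that
    depends on the path ([gronwall_riemann]); Fatou's lemma recovers the moments
    of [e] ([Lp_bigO_fatou]).

    All bounds are expressed by the relation [Lp_bigO P D s X]: the variables
    [X i] with [D i] are [O(s i)] in every [L^q], uniformly in [i]. *)

(** * The Euclidean norm *)

Section EuclideanNorm.
Context {R : realType} {d : nat}.
Implicit Types x y z : 'cV[R]_d.

Lemma dotC x y : dot x y = dot y x.
Proof. by apply: eq_bigr => i _; rewrite mulrC. Qed.

Lemma dotDl x y z : dot (x + y) z = dot x z + dot y z.
Proof.
by rewrite /dot -big_split /=; apply: eq_bigr => i _; rewrite mxE mulrDl.
Qed.

Lemma dotZl a x y : dot (a *: x) y = a * dot x y.
Proof.
by rewrite /dot mulr_sumr; apply: eq_bigr => i _; rewrite mxE mulrA.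
Qed.

Lemma dotDr x y z : dot z (x + y) = dot z x + dot z y.
Proof. by rewrite dotC dotDl ![dot _ z]dotC. Qed.

Lemma dotZr a x y : dot x (a *: y) = a * dot x y.
Proof. by rewrite dotC dotZl dotC. Qed.

Lemma dotNr x y : dot x (- y) = - dot x y.
Proof. by rewrite -scaleN1r dotZr mulN1r. Qed.

Lemma dotNl x y : dot (- x) y = - dot x y.
Proof. by rewrite dotC dotNr dotC. Qed.

Lemma dotxx_ge0 x : 0 <= dot x x.
Proof. by apply: sumr_ge0 => i _; rewrite -expr2 sqr_ge0. Qed.

Lemma enorm_ge0 x : 0 <= enorm x.
Proof. exact: sqrtr_ge0. Qed.

Lemma enorm_sqr x : enorm x ^+ 2 = dot x x.
Proof. by rewrite sqr_sqrtr // dotxx_ge0. Qed.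

Lemma enormZ a x : enorm (a *: x) = `|a| * enorm x.
Proof. by rewrite /enorm dotZl dotZr mulrA -expr2 sqrtrM ?sqr_ge0// sqrtr_sqr. Qed.

Lemma enormN x : enorm (- x) = enorm x.
Proof. by rewrite /enorm dotNl dotNr opprK. Qed.

Lemma enorm0 : enorm (0 : 'cV[R]_d) = 0.
Proof. by rewrite -(scale0r (0 : 'cV[R]_d)) enormZ normr0 mul0r. Qed.

Lemma coord_le_enorm x i : `|x i 0| <= enorm x.
Proof.
rewrite -sqrtr_sqr ler_wsqrtr// /dot (bigD1 i)//= -expr2 lerDl.
by apply: sumr_ge0 => j _; rewrite -expr2 sqr_ge0.
Qed.

Lemma enorm_eq0 x : enorm x = 0 -> x = 0.
Proof.
move=> x0; apply/colP => i; rewrite mxE; apply/eqP.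
by rewrite -normr_le0 -x0 coord_le_enorm.
Qed.

(** Cauchy-Schwarz, from the nonnegativity of the square of [|y| x - |x| y]. *)
Lemma dot_le_enorm x y : dot x y <= enorm x * enorm y.
Proof.
have [x0|x0] := eqVneq (enorm x) 0.
  by rewrite x0 mul0r (enorm_eq0 x0) -(scale0r (0 : 'cV[R]_d)) dotZl mul0r.
have [y0|y0] := eqVneq (enorm y) 0.
  by rewrite y0 mulr0 (enorm_eq0 y0) -(scale0r (0 : 'cV[R]_d)) dotZr mul0r.
have xy0 : 0 < enorm x * enorm y by rewrite mulr_gt0// lt0r ?x0 ?y0 enorm_ge0.
have := dotxx_ge0 (enorm y *: x - enorm x *: y).
rewrite !(dotDl, dotDr, dotNl, dotNr, dotZl, dotZr) -!enorm_sqr (dotC y x).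
set a := enorm x in xy0 *; set b := enorm y in xy0 *; set c := dot x y.
move=> H; rewrite -(ler_pM2l xy0); nra.
Qed.

Lemma ler_enormD x y : enorm (x + y) <= enorm x + enorm y.
Proof.
rewrite -(@ler_pXn2r _ 2) ?nnegrE ?addr_ge0 ?enorm_ge0//.
rewrite enorm_sqr dotDl !dotDr (dotC y x) -!enorm_sqr.
have := dot_le_enorm x y; nra.
Qed.

Lemma ler_enormB x y : enorm (x - y) <= enorm x + enorm y.
Proof. by rewrite -[enorm y]enormN ler_enormD. Qed.

Lemma ler_enorm_sum (I : Type) (r : seq I) (Q : pred I) (F : I -> 'cV[R]_d) :
  enorm (\sum_(i <- r | Q i) F i) <= \sum_(i <- r | Q i) enorm (F i).
Proof.
elim/big_rec2 : _ => [|i a x _ IH]; first by rewrite enorm0.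
by rewrite (le_trans (ler_enormD _ _))// lerD2l.
Qed.

Lemma enorm_le_sum_coord x : enorm x <= \sum_(i < d) `|x i 0|.
Proof.
rewrite {1}(_ : x = \sum_(i < d) x i 0 *: delta_mx i 0); last first.
  apply/colP => i; rewrite summxE (bigD1 i)//= !mxE !eqxx mulr1.
  by rewrite big1 ?addr0// => j ji; rewrite !mxE (eq_sym i) (negbTE ji) mulr0.
apply: (le_trans (ler_enorm_sum _ _ _)); apply: ler_sum => i _.
rewrite enormZ ler_piMr// /enorm /dot (bigD1 i)//= !mxE !eqxx mulr1 big1.
  by rewrite addr0 sqrtr1.
by move=> j ji; rewrite !mxE (negbTE ji) mul0r.
Qed.

Lemma enorm_sqrE x : enorm x ^+ 2 = \sum_(i < d) x i 0 ^+ 2.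
Proof. by rewrite enorm_sqr; apply: eq_bigr => i _; rewrite expr2. Qed.

End EuclideanNorm.

Lemma continuous_sumr {R : realType} {T : topologicalType} {I : Type} (r : seq I) (Q : pred I)
    (F : I -> T -> R) : (forall i, Q i -> continuous (F i)) ->
  continuous (fun x => \sum_(i <- r | Q i) F i x).
Proof. by move=> cF; apply: continuous_big => //; exact: add_continuous. Qed.

Lemma continuous_enorm {R : realType} {d : nat} : continuous (@enorm R d).
Proof.
move=> x; apply: continuous_comp; last exact: sqrt_continuous.
move: x; apply: continuous_sumr => i _ x.
have cx : {for x, continuous (fun y : 'cV[R]_d => y i 0)}.
  exact: coord_continuous.
exact: (continuousM cx cx).
Qed.

Lemma continuous_coord {R : realType} {n : nat} (i : 'I_n) :
  continuous (fun x : 'cV[R]_n => x i 0).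
Proof. exact: coord_continuous. Qed.

(** * Inequalities between powers *)

Section PowerInequalities.
Context {R : realType}.
Implicit Types x y a m : R.

Lemma exprDn_le x y q : 0 <= x -> 0 <= y ->
  (x + y) ^+ q <= 2 ^+ q * (x ^+ q + y ^+ q).
Proof.
move=> x0 y0; wlog xy : x y x0 y0 / x <= y => [H|].
  have [/H|/ltW/H] := leP x y; first exact.
  by rewrite (addrC y) (addrC (y ^+ q)); exact.
apply: (@le_trans _ _ ((2 * y) ^+ q)).
  by apply: lerXn2r; rewrite ?nnegrE ?addr_ge0 ?mulr_ge0//; lra.
by rewrite exprMn ler_pM2l ?exprn_gt0// lerDr exprn_ge0.
Qed.

Lemma mul_expr_le x y q : 0 <= x -> 0 <= y ->
  (x * y) ^+ q <= x ^+ (2 * q) + y ^+ (2 * q).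
Proof.
move=> x0 y0; rewrite exprMn !(mulnC 2) !exprM.
have := exprn_ge0 q x0; have := exprn_ge0 q y0; nra.
Qed.

(** A convex function lies above its tangents; taken at a weighted mean [m],
    this is the source of Jensen's inequality below. *)
Lemma tangent_expr_le x m q : 0 <= x -> 0 <= m ->
  m ^+ q.+1 + q.+1%:R * m ^+ q * (x - m) <= x ^+ q.+1.
Proof.
move=> x0 m0; elim: q => [|q IH]; first by rewrite !expr1 expr0; lra.
rewrite (exprS x); apply: (le_trans _ (ler_wpM2l x0 IH)).
rewrite -subr_ge0 [X in 0 <= X](_ : _ = q.+1%:R * m ^+ q * (x - m) ^+ 2); last first.
  by rewrite !exprS -!natr1; ring.
by rewrite mulr_ge0 ?sqr_ge0// mulr_ge0 ?exprn_ge0.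
Qed.

(** Jensen's inequality.  The weights may add up to less than 1, since the
    missing mass can be placed at 0, where the power vanishes. *)
Lemma expr_weighted_sum_le (n : nat) (a y : 'I_n -> R) q :
  (forall r, 0 <= a r) -> (forall r, 0 <= y r) -> \sum_r a r <= 1 ->
  (\sum_r a r * y r) ^+ q.+1 <= \sum_r a r * y r ^+ q.+1.
Proof.
move=> a0 y0 a1; set m := \sum_r a r * y r.
have m0 : 0 <= m by apply: sumr_ge0 => r _; rewrite mulr_ge0.
apply: (@le_trans _ _ (\sum_r a r * (m ^+ q.+1 + q.+1%:R * m ^+ q * (y r - m)))).
  have E r : a r * (m ^+ q.+1 + q.+1%:R * m ^+ q * (y r - m)) =
      m ^+ q.+1 * a r + q.+1%:R * m ^+ q * (a r * y r) -
      q.+1%:R * m ^+ q.+1 * a r by rewrite exprS; ring.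
  under eq_bigr do rewrite E.
  rewrite sumrB big_split/= -!mulr_sumr -/m -natr1.
  set A := \sum_r _ in a1 *.
  have : 0 <= q%:R * m ^+ q.+1 * (1 - A).
    by rewrite mulr_ge0 ?subr_ge0// mulr_ge0// exprn_ge0.
  by rewrite exprS; nra.
by apply: ler_sum => r _; rewrite ler_wpM2l// tangent_expr_le.
Qed.

Lemma expr_le_1_even x q : 0 <= x -> x ^+ q <= 1 + x ^+ (2 * q.+1).
Proof.
move=> x0; have [x1|/ltW x1] := leP x 1.
  by rewrite (le_trans (exprn_ile1 _ x0 x1))// lerDl exprn_ge0.
rewrite (@le_trans _ _ (x ^+ (2 * q.+1)))// ?lerDr// ler_weXn2l//.
by rewrite (leq_trans (leqnSn q))// leq_pmull.
Qed.

End PowerInequalities.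

(** * Orders of magnitude in all Lebesgue spaces *)

Section BigOLp.
Context {R : realType} {disp : measure_display} {Omega : measurableType disp}.
Variable P : probability Omega R.

(** Uniformity over an arbitrary index set is what makes constants independent
    of the number of steps and of time.  Positivity of the scale and measurability
    are included, so that the closure properties have no side conditions, and
    natural exponents suffice, see [Lp_bigO_powR]. *)
Definition Lp_bigO {I : Type} (D : I -> Prop) (s : I -> R)
    (X : I -> Omega -> R) : Prop :=
  [/\ forall i, D i -> 0 < s i,
      forall i, D i -> measurable_fun setT (X i)
    & forall q : nat, exists C : R, forall i, D i ->
        (\int[P]_w ((`|X i w| / s i) ^+ q)%:E <= C%:E)%E].

Lemma measurable_normalized (X : Omega -> R) (s : R) q :
  measurable_fun setT X ->
  measurable_fun setT (fun w => ((`|X w| / s) ^+ q)%:E : \bar R).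
Proof.
move=> mX; apply/measurable_EFinP; apply: measurable_funX.
by apply: measurable_funM => //; exact: measurableT_comp.
Qed.

Lemma normalized_ge0 (x s : R) q : 0 < s -> 0 <= (`|x| / s) ^+ q.
Proof. by move=> s0; rewrite exprn_ge0// divr_ge0// ltW. Qed.

Section Closure.
Context {I : Type} {D : I -> Prop}.
Implicit Types (s : I -> R) (X Y : I -> Omega -> R).

Lemma Lp_bigO_le_ae s X Y : (forall i, D i -> measurable_fun setT (X i)) ->
  (forall i, D i -> {ae P, forall w, `|X i w| <= `|Y i w|}) ->
  Lp_bigO D s Y -> Lp_bigO D s X.
Proof.
move=> mX XY [s0 mY EY]; split => // q; have [C HC] := EY q; exists C => i Di.
apply: le_trans (HC i Di); have si := s0 i Di.
apply: ae_ge0_le_integral => //.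
- by move=> w _; rewrite lee_fin normalized_ge0.
- exact: measurable_normalized (mX _ Di).
- by move=> w _; rewrite lee_fin normalized_ge0.
- exact: measurable_normalized (mY _ Di).
- apply: filterS (XY i Di) => w h _; rewrite lee_fin.
  by apply: lerXn2r; rewrite ?nnegrE ?divr_ge0 ?(ltW si)// ler_pM2r// invr_gt0.
Qed.

Lemma Lp_bigO_le s X Y : (forall i, D i -> measurable_fun setT (X i)) ->
  (forall i, D i -> forall w, `|X i w| <= `|Y i w|) ->
  Lp_bigO D s Y -> Lp_bigO D s X.
Proof.
by move=> mX XY; apply: Lp_bigO_le_ae => // i Di; apply: aeW => w; exact: XY.
Qed.

Lemma Lp_bigO_eq s X Y : (forall i, D i -> X i =1 Y i) ->
  Lp_bigO D s Y -> Lp_bigO D s X.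
Proof.
move=> XY HY; have [_ mY _] := HY; apply: Lp_bigO_le HY => i Di.
  by rewrite (_ : X i = Y i); [exact: mY|apply/funext; exact: XY].
by move=> w; rewrite XY.
Qed.

Lemma Lp_bigO_abs s X : Lp_bigO D s X -> Lp_bigO D s (fun i w => `|X i w|).
Proof.
move=> HX; have [_ mX _] := HX; apply: Lp_bigO_le (HX) => i Di.
  by apply: measurableT_comp => //; exact: mX.
by move=> w; rewrite normr_id.
Qed.

Lemma Lp_bigO_scale (K : R) s s' X : (forall i, D i -> s i <= K * s' i) ->
  (forall i, D i -> 0 < s' i) -> Lp_bigO D s X -> Lp_bigO D s' X.
Proof.
move=> ss' s'0 [s0 mX EX]; split => // q; have [C HC] := EX q.
exists (`|K| ^+ q * C) => i Di.
have si := s0 i Di; have s'i := s'0 i Di.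
rewrite EFinM; apply: (@le_trans _ _
    ((`|K| ^+ q)%:E * \int[P]_w ((`|X i w| / s i) ^+ q)%:E)%E); last first.
  by rewrite lee_wpmul2l ?lee_fin ?exprn_ge0// HC.
rewrite -ge0_integralZl//; last 2 first.
- exact: measurable_normalized (mX _ Di).
- by move=> w _; rewrite lee_fin normalized_ge0.
apply: ge0_le_integral => //.
- by move=> w _; rewrite lee_fin normalized_ge0.
- exact: measurable_normalized (mX _ Di).
- by apply: measurable_funeM; exact: measurable_normalized (mX _ Di).
- move=> w _; rewrite -EFinM lee_fin -exprMn.
  apply: lerXn2r; rewrite ?nnegrE ?mulr_ge0 ?invr_ge0 ?(ltW si) ?(ltW s'i)//.
  rewrite ler_pdivrMr// [leRHS](_ : _ = `|X i w| / s i * (`|K| * s' i)); last first.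
    by rewrite [LHS]mulrC; ring.
  rewrite -{1}(divfK (lt0r_neq0 si) `|X i w|) ler_wpM2l ?divr_ge0// ?(ltW si)//.
  by rewrite (le_trans (ss' i Di))// ler_wpM2r ?ler_norm// ltW.
Qed.

Lemma Lp_bigO_det (K : R) s (c : I -> R) : (forall i, D i -> 0 < s i) ->
  (forall i, D i -> `|c i| <= K * s i) -> Lp_bigO D s (fun i _ => c i).
Proof.
move=> s0 cK; split => // q; exists (K ^+ q) => i Di; have si := s0 _ Di.
rewrite integral_cst//= [P _]probability_setT mule1 lee_fin.
have cs : `|c i| / s i <= K by rewrite ler_pdivrMr// cK.
have cs0 : 0 <= `|c i| / s i by rewrite divr_ge0// ltW.
by apply: lerXn2r; rewrite ?nnegrE// (le_trans _ cs).
Qed.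

Lemma Lp_bigOD s X Y : Lp_bigO D s X -> Lp_bigO D s Y ->
  Lp_bigO D s (fun i w => X i w + Y i w).
Proof.
move=> [s0 mX EX] [_ mY EY]; split => //.
  by move=> i Di; apply: measurable_funD; [exact: mX|exact: mY].
move=> q; have [C HC] := EX q; have [C' HC'] := EY q.
exists (2 ^+ q * (C + C')) => i Di; have si := s0 _ Di.
rewrite EFinM EFinD; apply: (@le_trans _ _ ((2 ^+ q)%:E *
   (\int[P]_w ((`|X i w| / s i) ^+ q)%:E +
    \int[P]_w ((`|Y i w| / s i) ^+ q)%:E)))%E; last first.
  by rewrite lee_wpmul2l ?lee_fin ?exprn_ge0// leeD ?HC ?HC'.
rewrite -ge0_integralD//; last 4 first.
- by move=> w _; rewrite lee_fin normalized_ge0.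
- exact: measurable_normalized (mX _ Di).
- by move=> w _; rewrite lee_fin normalized_ge0.
- exact: measurable_normalized (mY _ Di).
rewrite -ge0_integralZl//; last 2 first.
- apply: emeasurable_funD; [exact: measurable_normalized (mX _ Di)|].
  exact: measurable_normalized (mY _ Di).
- by move=> w _; rewrite adde_ge0 ?lee_fin ?normalized_ge0.
apply: ge0_le_integral => //.
- by move=> w _; rewrite lee_fin normalized_ge0.
- apply: measurable_normalized.
  by apply: measurable_funD; [exact: mX|exact: mY].
- apply: measurable_funeM.
  apply: emeasurable_funD; [exact: measurable_normalized (mX _ Di)|].
  exact: measurable_normalized (mY _ Di).
- move=> w _; rewrite -EFinD -EFinM lee_fin.
  apply: le_trans (exprDn_le _ _ _); last 2 first.
  + by rewrite divr_ge0// ltW.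
  + by rewrite divr_ge0// ltW.
  apply: lerXn2r; rewrite ?nnegrE ?addr_ge0 ?mulr_ge0 ?invr_ge0 ?(ltW si)//.
  by rewrite -mulrDl ler_pM2r ?invr_gt0// ler_normD.
Qed.

(** Since all exponents are controlled at once, the crude bound
    [(x y)^q <= x^(2q) + y^(2q)] can replace the Hoelder inequality. *)
Lemma Lp_bigOM s s' X Y : Lp_bigO D s X -> Lp_bigO D s' Y ->
  Lp_bigO D (fun i => s i * s' i) (fun i w => X i w * Y i w).
Proof.
move=> [s0 mX EX] [s'0 mY EY]; split => //.
- by move=> i Di; rewrite mulr_gt0// ?s0// s'0.
- by move=> i Di; apply: measurable_funM; [exact: mX|exact: mY].
move=> q; have [C HC] := EX (2 * q)%N; have [C' HC'] := EY (2 * q)%N.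
exists (C + C') => i Di; have si := s0 _ Di; have s'i := s'0 _ Di.
rewrite EFinD; apply: le_trans (leeD (HC i Di) (HC' i Di)).
rewrite -ge0_integralD//; last 4 first.
- by move=> w _; rewrite lee_fin normalized_ge0.
- exact: measurable_normalized (mX _ Di).
- by move=> w _; rewrite lee_fin normalized_ge0.
- exact: measurable_normalized (mY _ Di).
apply: ge0_le_integral => //.
- by move=> w _; rewrite lee_fin normalized_ge0// mulr_gt0.
- apply: measurable_normalized.
  by apply: measurable_funM; [exact: mX|exact: mY].
- apply: emeasurable_funD; [exact: measurable_normalized (mX _ Di)|].
  exact: measurable_normalized (mY _ Di).
- move=> w _; rewrite -EFinD lee_fin normrM invfM mulrACA.
  by rewrite mul_expr_le// divr_ge0// ltW.
Qed.

Lemma Lp_bigOZ (c : R) s X : Lp_bigO D s X ->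
  Lp_bigO D s (fun i w => c * X i w).
Proof.
move=> HX; have [s0 _ _] := HX.
have H1 : Lp_bigO D (fun _ => 1) (fun _ _ => c).
  by apply: (@Lp_bigO_det `|c|) => // i Di; rewrite mulr1.
exact: (@Lp_bigO_scale 1) (Lp_bigOM H1 HX).
Qed.

Lemma Lp_bigO_expr n s X : Lp_bigO D s X ->
  Lp_bigO D (fun i => s i ^+ n) (fun i w => X i w ^+ n).
Proof.
move=> HX; have [s0 mX _] := HX; elim: n => [|n IH].
  by apply: (@Lp_bigO_det 1) => // i Di; rewrite expr0 normr1 mulr1.
apply: (@Lp_bigO_scale 1 (fun i => s i * s i ^+ n)).
- by move=> i _; rewrite mul1r exprS.
- by move=> i Di; rewrite exprn_gt0// s0.
- by apply: (Lp_bigO_eq _ (Lp_bigOM HX IH)) => i _ w; rewrite exprS.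
Qed.

Lemma Lp_bigO_sum (J : finType) s (X : J -> I -> Omega -> R) :
  (forall i, D i -> 0 < s i) -> (forall j, Lp_bigO D s (X j)) ->
  Lp_bigO D s (fun i w => \sum_j X j i w).
Proof.
move=> s0 HX; elim: (index_enum J) => [|j r IH].
  apply: (@Lp_bigO_eq _ _ (fun _ _ => 0)); first by move=> i _ w; rewrite big_nil.
  by apply: (@Lp_bigO_det 0) => // i Di; rewrite normr0 mul0r.
apply: (Lp_bigO_eq _ (Lp_bigOD (HX j) IH)) => i _ w.
by rewrite big_cons.
Qed.

(** A real exponent [p] is reached from a natural one [q >= p] by
    [x^p <= 1 + x^q]. *)
Lemma Lp_bigO_powR s X : Lp_bigO D s X -> forall p : R, 0 < p ->
  exists K : R, forall i, D i ->
    (\int[P]_w (`|X i w| `^ p)%:E <= (K * s i `^ p)%:E)%E.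
Proof.
move=> [s0 mX EX] p p0; pose q := (Num.truncn p).+1.
have pq : p <= q%:R by rewrite ltW// truncnS_gt.
have [C HC] := EX q; exists (1 + C) => i Di; have si := s0 i Di.
have mXp : measurable_fun setT (fun w => (`|X i w| `^ p)%:E : \bar R).
  apply/measurable_EFinP; apply: (measurableT_comp (measurable_powR _)).
  by apply: measurableT_comp => //; exact: mX.
rewrite mulrC EFinM.
apply: (@le_trans _ _ ((s i `^ p)%:E *
   \int[P]_w (1 + ((`|X i w| / s i) ^+ q)%:E))%E); last first.
  rewrite lee_wpmul2l ?lee_fin ?powR_ge0// ge0_integralD//; last 2 first.
  - by move=> w _; rewrite lee_fin normalized_ge0.
  - exact: measurable_normalized (mX _ Di).
  rewrite EFinD leeD ?HC// integral_cst//= [P _]probability_setT mule1.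
  exact: lexx.
have m1 : measurable_fun setT (fun w => 1 + ((`|X i w| / s i) ^+ q)%:E : \bar R)%E.
  apply: emeasurable_funD; [exact: measurable_cst|].
  exact: measurable_normalized (mX _ Di).
rewrite -ge0_integralZl//; last 2 first.
- by move=> w _; rewrite adde_ge0// lee_fin normalized_ge0.
- by rewrite lee_fin powR_ge0.
apply: ge0_le_integral => //.
  exact: measurable_funeM.
move=> w _; rewrite -EFinD -EFinM lee_fin.
set x := `|X i w| / s i.
have x0 : 0 <= x by rewrite divr_ge0// ltW.
rewrite (_ : `|X i w| = s i * x); last by rewrite mulrC divfK// gt_eqF.
rewrite powRM// ?(ltW si)// ler_wpM2l ?powR_ge0//.
have [x1|x1] := leP x 1.
  rewrite (@le_trans _ _ 1)// ?lerDl ?exprn_ge0//.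
  by rewrite -[leRHS](congr1 (@^~ p) (@powR1 R)) ge0_ler_powR// ?nnegrE ?(ltW p0).
by rewrite (@le_trans _ _ (x ^+ q))// ?lerDr// -powR_mulrn// ler_powR// ltW.
Qed.

End Closure.

Lemma Lp_bigO_reindex {I J : Type} (D : I -> Prop) (E : J -> Prop) (g : J -> I)
    (s : I -> R) (X : I -> Omega -> R) : (forall j, E j -> D (g j)) ->
  Lp_bigO D s X -> Lp_bigO E (s \o g) (fun j => X (g j)).
Proof.
move=> ED [s0 mX EX]; split=> [j /ED/s0//|j /ED/mX//|q].
by have [C HC] := EX q; exists C => j /ED/HC.
Qed.

End BigOLp.

Lemma limn_einf_sup_einfs {R : realType} (u : (\bar R)^nat) :
  limn_einf u = ereal_sup (range (einfs u)).
Proof. by rewrite limn_einf_lim; apply/cvg_lim => //; exact: cvg_einfs_sup. Qed.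

Lemma limn_einf_ge {R : realType} (u : (\bar R)^nat) (x : \bar R) n0 :
  (forall n, (n0 <= n)%N -> x <= u n)%E -> (x <= limn_einf u)%E.
Proof.
move=> xu; rewrite limn_einf_sup_einfs.
apply: (@le_trans _ _ (einfs u n0)); last by apply: ereal_sup_ubound; exists n0.
by apply: le_ereal_inf_tmp => _ [n /= n0n <-]; exact: xu.
Qed.

Lemma limn_einf_le {R : realType} (u : (\bar R)^nat) (x : \bar R) :
  (forall n, u n <= x)%E -> (limn_einf u <= x)%E.
Proof.
move=> ux; rewrite limn_einf_sup_einfs; apply: ge_ereal_sup => _ [n _ <-].
by apply: (le_trans _ (ux n)); apply: ereal_inf_lbound; exists n => /=.
Qed.

Section BigOLpSums.
Context {R : realType} {disp : measure_display} {Omega : measurableType disp}.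
Variable P : probability Omega R.

(** By Jensen's inequality a weighted sum is as small as its terms, whatever
    their number; time averages and Riemann sums are estimated in this way. *)
Lemma Lp_bigO_weighted_sum {I J : Type} (D : I -> Prop) (E : J -> Prop) (K : R)
    (n : I -> nat) (g : I -> nat -> J) (a : I -> nat -> R)
    (s : I -> R) (s' : J -> R) (Y : J -> Omega -> R) :
  (forall i, D i -> 0 < s i) ->
  (forall i r, D i -> (r < n i)%N -> E (g i r) /\ s' (g i r) <= s i) ->
  (forall i r, D i -> (r < n i)%N -> 0 <= a i r) ->
  (forall i, D i -> \sum_(r < n i) a i r <= K) ->
  Lp_bigO P E s' Y ->
  Lp_bigO P D s (fun i w => \sum_(r < n i) a i r * Y (g i r) w).
Proof.
move=> s0 HE a0 aK [s'0 mY EY].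
(* Dividing by [`|K| + 1], which is positive for every [K], turns the weights into
   weights of total at most 1. *)
have K1 : 0 < `|K| + 1 by rewrite ltr_wpDl.
apply: (@Lp_bigO_scale _ _ _ _ _ _ (`|K| + 1) (fun i => (`|K| + 1) * s i)) => //.
have mX i : D i ->
    measurable_fun setT (fun w => \sum_(r < n i) a i r * Y (g i r) w).
  move=> Di; apply: measurable_sum => r; apply: measurable_funM => //.
  by apply: mY; have [] := HE i r Di (ltn_ord r).
split => //.
  by move=> i Di; rewrite mulr_gt0// s0.
case=> [|q].
  exists 1 => i Di; under eq_integral do rewrite expr0.
  by rewrite integral_cst//= [P _]probability_setT mule1.
have [C HC] := EY q.+1; exists `|C| => i Di.
have si := s0 i Di.
pose b (r : 'I_(n i)) := a i r / (`|K| + 1).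
pose y w (r : 'I_(n i)) := `|Y (g i r) w| / s' (g i r).
have b0 r : 0 <= b r by rewrite divr_ge0 ?a0// ltW.
have s'i r : (r < n i)%N -> 0 < s' (g i r) by move=> /(HE i r Di)[] /s'0.
have y0 w r : 0 <= y w r by rewrite divr_ge0// ltW// s'i.
have b1 : \sum_r b r <= 1.
  rewrite -mulr_suml ler_pdivrMr// mul1r (le_trans (aK i Di))//.
  by rewrite (le_trans (ler_norm _))// lerDl.
have my r : measurable_fun setT (fun w => (y w r ^+ q.+1)%:E).
  by apply: measurable_normalized; apply: mY; have [] := HE i r Di (ltn_ord r).
apply: (@le_trans _ _ (\int[P]_w (\sum_r (b r * y w r ^+ q.+1)%:E))%E).
  apply: ge0_le_integral => //.
  - by move=> w _; rewrite lee_fin normalized_ge0// mulr_gt0.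
  - by apply: measurable_normalized; exact: mX.
  - apply: emeasurable_sum => r; under eq_fun do rewrite EFinM.
    exact: measurable_funeM.
  move=> w _; rewrite sumEFin lee_fin; apply: le_trans (expr_weighted_sum_le q b0 (y0 w) b1).
  apply: lerXn2r; rewrite ?nnegrE ?divr_ge0 ?mulr_ge0 ?(ltW K1) ?(ltW si)//.
    by apply: sumr_ge0 => r _; rewrite mulr_ge0.
  rewrite ler_pdivrMr ?mulr_gt0// mulr_suml.
  apply: (le_trans (ler_norm_sum _ _ _)); apply: ler_sum => r _.
  rewrite normrM ger0_norm ?a0// /b /y.
  have [_ s's] := HE i r Di (ltn_ord r).
  rewrite [leRHS](_ : _ = a i r * (`|Y (g i r) w| * (s i / s' (g i r)))); last first.
    by field; rewrite ?gt_eqF// s'i.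
  rewrite ler_wpM2l ?a0// ler_peMr// ler_pdivlMr ?s'i// mul1r//.
rewrite ge0_integral_sum//; last 2 first.
- move=> r; under eq_fun do rewrite EFinM.
  exact: measurable_funeM.
- by move=> r w _; rewrite lee_fin mulr_ge0// exprn_ge0.
apply: (@le_trans _ _ (\sum_r (b r)%:E * `|C|%:E)%E).
  apply: lee_sum => r _; under eq_integral do rewrite EFinM.
  rewrite ge0_integralZl//; last 2 first.
  - by move=> w _; rewrite lee_fin exprn_ge0.
  - by rewrite lee_fin.
  rewrite lee_wpmul2l ?lee_fin//.
  have [/HC H _] := HE i r Di (ltn_ord r).
  by rewrite (le_trans H)// lee_fin ler_norm.
under eq_bigr do rewrite -EFinM.
by rewrite sumEFin lee_fin -mulr_suml ler_piMl.
Qed.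

(** The rank from which the domination holds may depend on the sample point:
    Fatou's lemma only asks for moments of [Y (i, n)] bounded uniformly in [n]. *)
Lemma Lp_bigO_fatou {I : Type} (D : I -> Prop) (s : I -> R)
    (X : I -> Omega -> R) (Y : I * nat -> Omega -> R) :
  (forall i, D i -> measurable_fun setT (X i)) ->
  Lp_bigO P (fun j => D j.1) (fun j => s j.1) Y ->
  (forall i, D i -> {ae P, forall w, exists n0, forall n, (n0 <= n)%N ->
     `|X i w| <= `|Y (i, n) w|}) ->
  Lp_bigO P D s X.
Proof.
move=> mX [s0 mY EY] XY; split => // [i Di|q]; first exact: (s0 (i, 0%N)).
have [C HC] := EY q; exists C => i Di.
have si : 0 < s i := s0 (i, 0%N) Di.
pose f n w := ((`|Y (i, n) w| / s i) ^+ q)%:E : \bar R.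
have mf n : measurable_fun setT (f n).
  by apply: measurable_normalized; exact: (mY (i, n)).
have f0 n w : setT w -> (0 <= f n w)%E by rewrite lee_fin normalized_ge0.
apply: (@le_trans _ _ (\int[P]_w limn_einf (f^~ w))%E); last first.
  apply: le_trans (fatou _ _ _ _) _ => //.
  by apply: limn_einf_le => n; exact: (HC (i, n)).
apply: ae_ge0_le_integral => //.
- by move=> w _; rewrite lee_fin normalized_ge0.
- exact: measurable_normalized (mX _ Di).
- by move=> w _; apply: (@limn_einf_ge _ _ _ 0) => n _; exact: f0.
- rewrite /limn_einf; apply: measurableT_comp => //.
  by apply: measurable_fun_limn_esup => n; exact: measurableT_comp.
- apply: filterS (XY i Di) => w [n0 h] _; apply: (@limn_einf_ge _ _ _ n0) => n n0n.
  rewrite lee_fin; apply: lerXn2r; rewrite ?nnegrE ?divr_ge0 ?(ltW si)//.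
  by rewrite ler_pM2r ?invr_gt0// h.
Qed.

End BigOLpSums.

(** * Moments of the normal law *)

Section Gaussian.
Context {R : realType}.
Local Notation mu := (@lebesgue_measure R).
Implicit Types (m s x : R).

Lemma ge0_integral_normal_prob m s (f : R -> \bar R) :
  measurable_fun setT f -> (forall x, 0 <= f x)%E ->
  (\int[normal_prob m s]_x f x = \int[mu]_x (f x * (normal_pdf m s x)%:E))%E.
Proof.
move=> mf f0; have dom := @normal_prob_dominates R m s.
rewrite -(Radon_Nikodym_SigmaFinite.change_of_variables dom f0 measurableT mf).
have intf := Radon_Nikodym_SigmaFinite.f_integrable dom.
apply: ae_eq_integral => //.
- by apply: emeasurable_funM => //; exact: measurable_int intf.
- apply: emeasurable_funM => //; apply/measurable_EFinP.
  exact: measurable_normal_pdf.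
- apply: ae_eqe_mul2l; apply: integral_ae_eq => //.
  + by apply/measurable_EFinP; exact: measurable_normal_pdf.
  + by move=> A _ mA; rewrite -Radon_Nikodym_SigmaFinite.f_integral.
Qed.

Lemma expr_le_expR q x : 0 <= x -> x ^+ q.+1 <= q.+1`!%:R * expR x.
Proof.
move=> x0; rewrite mulrC -ler_pdivrMr ?ltr0n ?fact_gt0//.
by apply: le_trans (expR_ge1Dxn q x0); rewrite lerDr.
Qed.

(** Half of the Gaussian decay, exchanged for a doubling of the variance,
    absorbs any polynomial.  The mass of the new density being 1, the moments of
    [x / s] are bounded independently of [s]. *)
Lemma normal_pdf_scaled s x : 0 < s ->
  expR ((x / s) ^+ 2 / 4) * normal_pdf 0 s x =
  Num.sqrt 2 * normal_pdf 0 (Num.sqrt 2 * s) x.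
Proof.
move=> s0; have s20 : 0 < Num.sqrt 2 * s by rewrite mulr_gt0// sqrtr_gt0.
rewrite /normal_pdf (gt_eqF s0) (gt_eqF s20) /normal_peak /normal_fun.
rewrite !subr0 (exprMn 2 (Num.sqrt 2) s) sqr_sqrtr//.
rewrite -(mulrA 2 _ pi) -(mulrnAr 2 (s ^+ 2 * pi)).
rewrite (@sqrtrM _ 2 (s ^+ 2 * pi *+ 2))// invfM.
rewrite [RHS]mulrA [Num.sqrt 2 * (_ * _)]mulrA divff ?gt_eqF ?sqrtr_gt0// mul1r.
rewrite mulrCA -expRD; congr (_ * expR _); field; lra.
Qed.

Lemma normal_moment q : exists C : R, forall s, 0 < s ->
  (\int[normal_prob 0%R s]_x ((`|x| / s) ^+ q)%:E <= C%:E)%E.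
Proof.
pose C0 : R := 1 + q.+1`!%:R * 4 ^+ q.+1.
exists (C0 * Num.sqrt 2) => s s0.
have mf : measurable_fun setT (fun x : R => ((`|x| / s) ^+ q)%:E : \bar R).
  apply/measurable_EFinP; apply: measurable_funX; apply: measurable_funM => //.
rewrite ge0_integral_normal_prob//; last first.
  by move=> x; rewrite lee_fin normalized_ge0.
apply: (@le_trans _ _ (\int[mu]_x ((C0 * Num.sqrt 2)%:E * (normal_pdf 0 (Num.sqrt 2 * s) x)%:E))%E).
  apply: ge0_le_integral => //.
  - by move=> x _; rewrite mule_ge0// lee_fin ?normalized_ge0// normal_pdf_ge0.
  - apply: emeasurable_funM => //; apply/measurable_EFinP.
    exact: measurable_normal_pdf.
  - apply: measurable_funeM; apply/measurable_EFinP.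
    exact: measurable_normal_pdf.
  move=> x _; rewrite -!EFinM lee_fin -(mulrA C0) -normal_pdf_scaled// mulrA.
  rewrite ler_wpM2r ?normal_pdf_ge0//.
  have : 0 <= `|x| / s by rewrite divr_ge0// ltW.
  have -> : (x / s) ^+ 2 = (`|x| / s) ^+ 2.
    by rewrite -(ger0_norm (ltW s0)) -normf_div real_normK ?num_real// ger0_norm ?ltW.
  move: (`|x| / s) => y y0.
  have e1 : 1 <= expR (y ^+ 2 / 4).
    by rewrite -(expR0 R) ler_expR divr_ge0// sqr_ge0.
  apply: (le_trans (expr_le_1_even q y0)); rewrite mulrDl mul1r lerD//.
  have := @expr_le_expR q (y ^+ 2 / 4); rewrite divr_ge0 ?sqr_ge0// => /(_ isT).
  rewrite exprMn -exprM exprVn ler_pdivrMr ?exprn_gt0// => /le_trans; apply.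
  by rewrite mulrAC.
rewrite ge0_integralZl//; last 3 first.
- by apply/measurable_EFinP; exact: measurable_normal_pdf.
- by move=> x _; rewrite lee_fin normal_pdf_ge0.
- by rewrite lee_fin mulr_ge0 ?sqrtr_ge0// addr_ge0// mulr_ge0 ?exprn_ge0.
by rewrite integral_normal_pdf mule1.
Qed.

Lemma integrable_id_normal_prob s : 0 < s ->
  (normal_prob 0%R s).-integrable setT (EFin \o id).
Proof.
move=> s0; apply/integrableP; split; first exact/measurable_EFinP.
have [C HC] := normal_moment 1; apply: (@le_lt_trans _ _ (s%:E * C%:E)%E); last first.
  by rewrite -EFinM ltry.
apply: le_trans (lee_wpmul2l _ (HC s s0)); last by rewrite lee_fin ltW.
rewrite -ge0_integralZl//; last 3 first.
- apply/measurable_EFinP; apply: measurable_funX; apply: measurable_funM => //.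
- by move=> x _; rewrite lee_fin normalized_ge0.
- by rewrite lee_fin ltW.
apply: ge0_le_integral => //.
- by apply: measurableT_comp => //; apply/measurable_EFinP.
- apply: measurable_funeM; apply/measurable_EFinP; apply: measurable_funX.
  exact: measurable_funM.
- by move=> x _ /=; rewrite expr1 -EFinM lee_fin mulrC divfK// gt_eqF.
Qed.

(** The positive and negative parts of [x] have the same integral because
    [|x|] times the density is even. *)
Lemma normal_prob_mean0 s : 0 < s ->
  (\int[normal_prob 0%R s]_x x%:E = 0)%E.
Proof.
move=> s0; pose g x := `|x| * normal_pdf 0 s x.
have g0 x : 0 <= g x by rewrite mulr_ge0// normal_pdf_ge0.
have mpos : measurable_fun setT ((EFin \o id : R -> \bar R)^\+)%E.
  by apply: measurable_funepos; exact/measurable_EFinP.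
have mneg : measurable_fun setT ((EFin \o id : R -> \bar R)^\-)%E.
  by apply: measurable_funeneg; exact/measurable_EFinP.
have fin := integrable_id_normal_prob s0.
have posE : (\int[normal_prob 0%R s]_x (EFin \o id)^\+ x =
    \int[mu]_(x in [set x | 0 <= x]%R) (g x)%:E)%E.
  rewrite ge0_integral_normal_prob// [RHS]integral_mkcond; apply: eq_integral => x _.
  rewrite patchE funeposE /g; case: ifPn => [|/negP x0].
    by rewrite inE/= => x0; rewrite max_l ?lee_fin// ger0_norm// EFinM.
  rewrite max_r ?mul0e// lee_fin leNgt; apply/negP => /ltW x0'.
  by apply: x0; rewrite inE.
have absE : (\int[normal_prob 0%R s]_x (EFin \o id)^\+ x +
    \int[normal_prob 0%R s]_x (EFin \o id)^\- x =
    2%:E * \int[mu]_(x in [set x | 0 <= x]%R) (g x)%:E)%E.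
  rewrite -ge0_symfun_integralT//.
  - rewrite -ge0_integralD//.
    transitivity (\int[normal_prob 0%R s]_x `|x%:E|)%E.
      apply: eq_integral => x _.
      by have := congr1 (@^~ x) (@fune_abse _ _ (EFin \o @id R)) => /= ->.
    rewrite ge0_integral_normal_prob//; last by apply: measurableT_comp.
  - move=> x; apply: continuousM; first exact: norm_continuous.
    by apply: continuous_normal_pdf; rewrite gt_eqF.
  - by move=> x; rewrite /g/= normrN /normal_pdf (gt_eqF s0) /normal_fun !subr0 sqrrN.
rewrite integralE; move: absE; rewrite -posE.
have : (\int[normal_prob 0%R s]_x (EFin \o id)^\+ x)%E \is a fin_num.
  by apply: integrable_pos_fin_num.
have : (\int[normal_prob 0%R s]_x (EFin \o id)^\- x)%E \is a fin_num.
  by apply: integrable_neg_fin_num.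
move=> /fineK <- /fineK <-; rewrite -EFinM -EFinD => -[H]; congr EFin; lra.
Qed.

End Gaussian.

(** * Independence and measurability *)

Section Independence.
Context {R : realType} {disp : measure_display} {Omega : measurableType disp}.
Variable P : probability Omega R.

(** Independence says that the joint law is the product of the marginal laws;
    Fubini's theorem then integrates the centred factor first. *)
Lemma integral_mul_indep_centered (A Z : Omega -> R) :
  measurable_fun setT A -> measurable_fun setT Z ->
  (forall B C, measurable B -> measurable C ->
     P (A @^-1` B `&` Z @^-1` C) = (P (A @^-1` B) * P (Z @^-1` C))%E) ->
  P.-integrable setT (EFin \o Z) -> (\int[P]_w (Z w)%:E = 0)%E ->
  P.-integrable setT (fun w => (A w * Z w)%:E) ->
  (\int[P]_w (A w * Z w)%:E = 0)%E.
Proof.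
move=> mA mZ indep intZ EZ intAZ.
have mAZ : measurable_fun setT (fun w => (A w, Z w)) by exact: measurable_fun_pair.
pose rA : {RV P >-> R} := HB.pack A (isMeasurableFun.Build _ _ _ _ A mA).
pose rZ : {RV P >-> R} := HB.pack Z (isMeasurableFun.Build _ _ _ _ Z mZ).
pose rAZ : {mfun Omega >-> (R * R)%type} :=
  HB.pack (fun w => (A w, Z w)) (isMeasurableFun.Build _ _ _ _ _ mAZ).
pose m1 := distribution P rA; pose m2 := distribution P rZ.
pose m' := distribution P rAZ.
have prod : forall X : set (R * R), measurable X -> (m1 \x m2)%E X = m' X.
  by apply: product_measure_unique => B C mB mC; exact: indep.
pose f (z : R * R) : \bar R := (z.1 * z.2)%:E.
have mf : measurable_fun setT f.
  by apply/measurable_EFinP; exact: measurable_funM.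
have intf' : m'.-integrable setT f by exact: integrable_pushforward.
have intf : (m1 \x m2)%E.-integrable setT f.
  apply/integrableP; split => //; case/integrableP : intf' => _.
  rewrite (@eq_measure_integral _ _ _ _ m' (m1 \x m2)%E)// => B mB _.
  exact: prod.
transitivity (\int[m']_z f z)%E; first by rewrite integral_pushforward.
transitivity (\int[m1 \x m2]_z f z)%E.
  by apply/esym/eq_measure_integral => B mB _; exact: prod.
rewrite -integral12_prod_meas1//; apply: integral0_eq => x _.
rewrite /fubini_F/f/=.
under eq_integral do rewrite EFinM.
rewrite integralZl//; last first.
  by apply: (@integrable_pushforward _ _ _ _ _ Z) => //; exact/measurable_EFinP.
rewrite (_ : \int[m2]_y y%:E = 0)%E ?mule0//.
by rewrite integral_pushforward//; exact/measurable_EFinP.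
Qed.

End Independence.

Section Borel.
Context {R : realType} {disp : measure_display} {Omega : measurableType disp}.

Lemma borel_preimage {n : nat} (g : 'cV[R]_n -> R) (B : set R) :
  continuous g -> measurable B -> borel (g @^-1` B).
Proof.
move=> cg mB.
have mg : measurable_fun (setT : set (g_sigma_algebraType (@open 'cV[R]_n))) g.
  apply: (@measurability _ _ (g_sigma_algebraType (@open 'cV[R]_n)) _ _ _ _ (RGenOpens.measurableE R)).
  move=> _ [_ [a [b ->]] <-]; rewrite setTI; apply: sub_sigma_algebra.
  by move/continuousP : cg; apply; exact: itv_open.
by have := mg measurableT B mB; rewrite setTI.
Qed.

Variable G : set_system Omega.
Hypothesis sG : sigma_algebra [set: Omega] G.

(** Measurability with respect to [G], read on the copy of [Omega] whose
    measurable sets are generated by [G]: the closure properties of measurable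
    functions then apply as they stand. *)
Definition measurable_for (X : Omega -> R) :=
  measurable_fun (setT : set (g_sigma_algebraType G)) X.

Lemma measurable_forP X : measurable_for X -> forall B, measurable B -> G (X @^-1` B).
Proof.
move=> mX B mB; have : <<s G >> (X @^-1` B).
  by rewrite -[X in <<s G >> X]setTI; exact: (mX measurableT).
by rewrite sigma_algebra_id.
Qed.

Lemma measurable_for_sub X : G `<=` measurable -> measurable_for X ->
  measurable_fun setT X.
Proof.
by move=> Gm mX _ B mB; rewrite setTI; apply: Gm; exact: measurable_forP.
Qed.

Lemma measurable_for_comp {n : nat} (X : Omega -> 'cV[R]_n) (g : 'cV[R]_n -> R) :
  measurable_wrt G X -> continuous g -> measurable_for (g \o X).
Proof.
move=> mX cg _ B mB; rewrite setTI; apply: sub_sigma_algebra.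
by apply: (mX (g @^-1` B)); exact: borel_preimage.
Qed.

End Borel.

(** * Discrete martingales with all moments *)

Section MartingaleIneq.
Context {R : realType}.

(** The first-order term is kept apart because it is the one that vanishes in
    mean for a martingale increment [e * y].  With [e^2 = 1/N], the other terms
    remain bounded after [N] steps. *)
Lemma exprD_taylor2 (n : nat) (s y e : R) : 0 <= e <= 1 ->
  (s + e * y) ^+ n.+2 <= s ^+ n.+2 + n.+2%:R * (s ^+ n.+1 * (e * y)) +
    2 ^+ n.+2 * e ^+ 2 * (`|s| ^+ n.+2 + `|y| ^+ n.+2).
Proof.
move=> /andP[e0 e1]; rewrite exprDn big_ord_recl big_ord_recl.
rewrite -[nat_of_ord (lift _ _)]/1%N -[nat_of_ord ord0]/0%N.
rewrite bin0 subn0 expr0 mulr1 mulr1n bin1 expr1 subSS subn0.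
rewrite addrA lerD//; first by rewrite lerD2l -[leLHS]mulr_natl.
pose M := Num.max `|s| `|y|.
have sM : `|s| <= M by rewrite le_max lexx.
have yM : `|y| <= M by rewrite le_max lexx orbT.
have M0 : 0 <= M by rewrite (le_trans _ sM).
apply: (@le_trans _ _ (\sum_(i < n.+1) (e ^+ 2 * M ^+ n.+2) *+ 'C(n.+2, i.+2))).
  apply: ler_sum => i _; rewrite -[nat_of_ord (lift _ _)]/i.+2 lerMn2r.
  apply/orP; right.
  rewrite (le_trans (ler_norm _))// normrM !normrX normrM (ger0_norm e0).
  rewrite exprMn mulrCA; have i2 : (i.+2 <= n.+2)%N by rewrite ltnS ltn_ord.
  apply: ler_pM; [exact: exprn_ge0|by apply: mulr_ge0; exact: exprn_ge0| |].
    exact: ler_wiXn2l.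
  rewrite -{2}(subnK i2) exprD.
  by apply: ler_pM; rewrite ?exprn_ge0//; apply: lerXn2r; rewrite ?nnegrE.
rewrite sumrMnr.
have cM : (\sum_(i < n.+1) 'C(n.+2, i.+2))%:R <= 2 ^+ n.+2 :> R.
  rewrite -natrX ler_nat -[(2 ^ _)%N]/((1 + 1) ^ n.+2)%N expnDn.
  rewrite [leqRHS]big_ord_recl [X in (_ + X)%N]big_ord_recl (leq_trans _ (leq_addl _ _))//.
  rewrite (leq_trans _ (leq_addl _ _))//; apply: leq_sum => i _.
  by rewrite -[nat_of_ord (lift _ _)]/i.+2 !exp1n !muln1.
rewrite -[leLHS]mulr_natl -[leRHS]mulrA; apply: ler_pM => //.
  by rewrite mulr_ge0 ?exprn_ge0.
rewrite ler_wpM2l ?exprn_ge0// /M; case: (leP `|s| `|y|) => _.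
  by rewrite lerDr exprn_ge0.
by rewrite lerDl exprn_ge0.
Qed.

Lemma one_add_expr_le (x : R) k n : 0 <= x -> (k <= n)%N ->
  (1 + x / n%:R) ^+ k <= expR x.
Proof.
move=> x0 kn; case: n kn => [|n] kn.
  by move: kn; rewrite leqn0 => /eqP ->; rewrite expr0 -(expR0 R) ler_expR.
apply: (@le_trans _ _ (expR (x / n.+1%:R) ^+ k)).
  by apply: lerXn2r; rewrite ?nnegrE ?expR_ge0 ?addr_ge0 ?divr_ge0// expR_ge1Dx.
rewrite -expRM_natl ler_expR mulrCA ler_piMr// ler_pdivrMr// mul1r ler_nat//.
Qed.

End MartingaleIneq.

Section LpMartingale.
Context {R : realType} {disp : measure_display} {Omega : measurableType disp}.
Variable P : probability Omega R.

Lemma Lp_bigO_integrable {I : Type} (D : I -> Prop) (s : I -> R) (X : I -> Omega -> R) i :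
  Lp_bigO P D s X -> D i -> P.-integrable setT (EFin \o X i).
Proof.
move=> [s0 mX EX] Di; apply/integrableP; split; first exact/measurable_EFinP/mX.
have [C HC] := EX 1%N; have si := s0 i Di.
apply: (@le_lt_trans _ _ ((s i)%:E * C%:E)%E); last by rewrite -EFinM ltry.
apply: le_trans (lee_wpmul2l _ (HC i Di)); last by rewrite lee_fin ltW.
rewrite -ge0_integralZl//; last 3 first.
- exact: measurable_normalized (mX _ Di).
- by move=> x _; rewrite lee_fin normalized_ge0.
- by rewrite lee_fin ltW.
apply: ge0_le_integral => //.
- by apply: measurableT_comp => //; exact/measurable_EFinP/mX.
- by apply: measurable_funeM; exact: measurable_normalized (mX _ Di).
- by move=> x _ /=; rewrite expr1 -EFinM lee_fin mulrC divfK// gt_eqF.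
Qed.

(** Even powers control all powers; for them the absolute value disappears and
    the binomial expansion applies. *)
Lemma Lp_bigO_even {I : Type} (D : I -> Prop) (s : I -> R) (X : I -> Omega -> R) :
  (forall i, D i -> 0 < s i) -> (forall i, D i -> measurable_fun setT (X i)) ->
  (forall q : nat, exists C : R, forall i, D i ->
        (\int[P]_w ((`|X i w| / s i) ^+ (2 * q.+1))%:E <= C%:E)%E) ->
  Lp_bigO P D s X.
Proof.
move=> s0 mX EX; split => // q; have [C HC] := EX q; exists (1 + C) => i Di.
have si := s0 i Di.
apply: (@le_trans _ _ (\int[P]_w (1 + ((`|X i w| / s i) ^+ (2 * q.+1))%:E))%E).
  apply: ge0_le_integral => //.
  - by move=> x _; rewrite lee_fin normalized_ge0.
  - exact: measurable_normalized (mX _ Di).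
  - apply: emeasurable_funD; [exact: measurable_cst|].
    exact: measurable_normalized (mX _ Di).
  - by move=> w _; rewrite -EFinD lee_fin expr_le_1_even// divr_ge0// ltW.
rewrite ge0_integralD//; last 2 first.
- by move=> w _; rewrite lee_fin normalized_ge0.
- exact: measurable_normalized (mX _ Di).
by rewrite EFinD leeD ?HC// integral_cst//= [P _]probability_setT mule1.
Qed.

Definition all_moments (X : Omega -> R) : Prop :=
  Lp_bigO P (fun _ : unit => True) (fun _ => 1) (fun _ => X).

Lemma all_moments_of {I : Type} (D : I -> Prop) (s : I -> R) (X : I -> Omega -> R) i : D i ->
  Lp_bigO P D s X -> all_moments (X i).
Proof.
move=> Di HX; have := @Lp_bigO_reindex _ _ _ P _ _ _ (fun _ : unit => True)
  (fun _ => i) _ _ (fun _ _ => Di) HX.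
by move=> H; apply: (@Lp_bigO_scale _ _ _ _ _ _ (s i)) H => // j _; rewrite mulr1.
Qed.

(** With [nu = 1/N], the increments are of size [nu^(3/2)], and adding [N] of
    them would only give [nu^(1/2)].  Orthogonality to the powers of the past sum
    removes the first-order term of [(S + xi)^(2q)]; the even moments [a_k] of
    [S / nu] after [k] steps then satisfy [a_(k+1) <= (1 + c nu) a_k + c nu C] and
    remain bounded over [N] steps. *)
Lemma Lp_bigO_martingale {I : Type} (D : I -> Prop) (N : I -> nat)
    (S xi : I -> nat -> Omega -> R) :
  (forall i, D i -> (0 < N i)%N) ->
  (forall i w, D i -> S i 0%N w = 0) ->
  (forall i k w, D i -> (k < N i)%N -> S i k.+1 w = S i k w + xi i k w) ->
  Lp_bigO P (fun j : I * nat => D j.1 /\ (j.2 < N j.1)%N)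
    (fun j => (N j.1)%:R^-1 * Num.sqrt (N j.1)%:R^-1) (fun j => xi j.1 j.2) ->
  (forall i k q, D i -> (k < N i)%N -> all_moments (S i k) ->
     (\int[P]_w (S i k w ^+ q * xi i k w)%:E = 0)%E) ->
  Lp_bigO P (fun j : I * nat => D j.1 /\ (j.2 <= N j.1)%N)
    (fun j => (N j.1)%:R^-1) (fun j => S j.1 j.2).
Proof.
move=> N0 S0 SS Hxi orth.
have nu0 i : D i -> 0 < (N i)%:R^-1 :> R by move=> /N0 ?; rewrite invr_gt0 ltr0n.
have xiLp i k : D i -> (k < N i)%N -> all_moments (xi i k).
  by move=> Di kN; apply: (@all_moments_of _ _ _ _ (i, k) _ Hxi); split.
have SLp i k : D i -> (k <= N i)%N -> all_moments (S i k).
  move=> Di; elim: k => [_|k IH kN].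
    apply: (@Lp_bigO_eq _ _ _ _ _ _ _ _ (fun _ _ => 0)).
      by move=> _ _ w; exact: S0.
    by apply: (@Lp_bigO_det _ _ _ _ _ _ 0) => // _ _; rewrite normr0 mul0r.
  have := Lp_bigOD (IH (ltnW kN)) (xiLp i k Di kN).
  by move=> H; apply: Lp_bigO_eq H => _ _ w; exact: SS.
apply: Lp_bigO_even => [[i k] [Di _]|[i k] [Di kN]|q].
- exact: nu0.
- by have [_ + _] := SLp i k Di kN; apply.
(* The even exponent [2 * q.+1] has to display as [n.+2] for [exprD_taylor2]. *)
rewrite mulnS add2n; set n := (2 * q)%N.
have [_ _ /(_ n.+2)[C HC]] := Hxi.
pose c : R := 2 ^+ n.+2.
have c0 : 0 <= c by rewrite exprn_ge0.
exists (`|C| * expR c).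
case=> i k [/= Di kN]; set nu : R := (N i)%:R^-1.
have nui : 0 < nu := nu0 i Di.
have nu1 : nu <= 1 by rewrite invf_le1 ?ltr0n ?N0// ler1n N0.
apply: (@le_trans _ _ (`|C| * ((1 + c / (N i)%:R) ^+ k - 1))%:E); last first.
  rewrite lee_fin ler_wpM2l// (le_trans _ (one_add_expr_le c0 kN))//.
  by rewrite gerBl.
elim: k kN => [_|k IH kN].
  rewrite expr0 subrr mulr0 (eq_integral (fun=> 0%E)) ?integral0// => w _.
  by rewrite S0// normr0 mul0r expr0n.
have := IH (ltnW kN) => {}IH.
have [_ mSk _] := SLp i k.+1 Di kN.
have HCk := HC (i, k) (conj Di kN).
(* [m] is the cross term, the only one in which the sign of the increment matters. *)
pose a w := (`|S i k w| / nu) ^+ n.+2.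
pose b w := (`|xi i k w| / (nu * Num.sqrt nu)) ^+ n.+2.
pose m w := S i k w ^+ n.+1 * xi i k w.
have inta : P.-integrable setT (EFin \o a).
  have H1 := Lp_bigO_expr n.+2 (Lp_bigO_abs (Lp_bigOZ nu^-1 (SLp i k Di (ltnW kN)))).
  rewrite (_ : a = fun w => `|nu^-1 * S i k w| ^+ n.+2).
    exact: (@Lp_bigO_integrable _ _ _ _ tt H1 Logic.I).
  have nV : `|nu^-1| = nu^-1 by rewrite ger0_norm// invr_ge0 ltW.
  by apply/funext => w; rewrite normrM nV /a [X in X ^+ _ = _]mulrC.
have intb : P.-integrable setT (EFin \o b).
  have H1 := Lp_bigO_expr n.+2 (Lp_bigO_abs (Lp_bigOZ (nu * Num.sqrt nu)^-1 (xiLp i k Di kN))).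
  rewrite (_ : b = fun w => `|(nu * Num.sqrt nu)^-1 * xi i k w| ^+ n.+2).
    exact: (@Lp_bigO_integrable _ _ _ _ tt H1 Logic.I).
  have nV : `|(nu * Num.sqrt nu)^-1| = (nu * Num.sqrt nu)^-1.
    by rewrite ger0_norm// invr_ge0 mulr_ge0 ?sqrtr_ge0 ?ltW.
  by apply/funext => w; rewrite normrM nV /b [X in X ^+ _ = _]mulrC.
have intm : P.-integrable setT (EFin \o m).
  have H1 := Lp_bigOM (Lp_bigO_expr n.+1 (SLp i k Di (ltnW kN))) (xiLp i k Di kN).
  exact: (@Lp_bigO_integrable _ _ _ _ tt H1 Logic.I).
have Em : (\int[P]_w (m w)%:E = 0)%E by apply: orth => //; apply: SLp => //; exact: ltnW.
apply: (@le_trans _ _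
  (\int[P]_w ((1 + c * nu)%:E * (a w)%:E + ((n.+2%:R / nu ^+ n.+2)%:E * (m w)%:E +
     (c * nu)%:E * (b w)%:E)))%E).
  have intR : P.-integrable setT (fun w => ((1 + c * nu)%:E * (a w)%:E +
      ((n.+2%:R / nu ^+ n.+2)%:E * (m w)%:E + (c * nu)%:E * (b w)%:E))%E).
    apply: integrableD => //; first exact: integrableZl.
    by apply: integrableD => //; exact: integrableZl.
  have ineq w : (`|S i k.+1 w| / nu) ^+ n.+2 <=
      (1 + c * nu) * a w + (n.+2%:R / nu ^+ n.+2 * m w + c * nu * b w).
    have sn0 : 0 < Num.sqrt nu by rewrite sqrtr_gt0.
    have e1 : 0 <= Num.sqrt nu <= 1.
      by rewrite sqrtr_ge0/= -[leRHS]sqrtr1 ler_wsqrtr.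
    have := exprD_taylor2 n (S i k w / nu) (xi i k w / (nu * Num.sqrt nu)) e1.
    rewrite sqr_sqrtr ?(ltW nui)//.
    have even x : `|x| ^+ n.+2 = x ^+ n.+2 :> R.
      by rewrite -[n.+2]/(2 + 2 * q)%N -mulnS !exprM real_normK ?num_real.
    rewrite -[in X in X -> _]even.
    have -> : S i k w / nu + Num.sqrt nu * (xi i k w / (nu * Num.sqrt nu)) =
        S i k.+1 w / nu.
      by rewrite SS//; field; rewrite !gt_eqF.
    have nn x : `|x / nu| = `|x| / nu by rewrite normrM [`|nu^-1|]gtr0_norm// invr_gt0.
    have nnx : `|xi i k w / (nu * Num.sqrt nu)| = `|xi i k w| / (nu * Num.sqrt nu).
      by rewrite normrM [`|_^-1|]gtr0_norm// invr_gt0 mulr_gt0.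
    have -> : (S i k w / nu) ^+ n.+1 * (Num.sqrt nu * (xi i k w / (nu * Num.sqrt nu))) =
        (nu ^+ n.+2)^-1 * m w.
      have nn1 : 0 < nu ^+ n.+1 by rewrite exprn_gt0.
      rewrite /m expr_div_n (exprS nu n.+1).
      by move: (nu ^+ n.+1) nn1 => z z0; field; rewrite !gt_eqF.
    rewrite -(even (S i k w / nu)) !nn nnx -/(a w) -/(b w) -/c => /le_trans; apply.
    rewrite le_eqVlt; apply/orP; left; apply/eqP.
    by move: (nu ^+ n.+2)^-1 n.+2%:R => z p; ring.
  apply: ge0_le_integral => //.
  - by move=> w _; rewrite lee_fin normalized_ge0.
  - exact: measurable_normalized (mSk tt Logic.I).
  - exact: measurable_int intR.
  - by move=> w _; rewrite -!EFinM -!EFinD lee_fin.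
rewrite integralD//; last 2 first.
- exact: integrableZl.
- by apply: integrableD => //; exact: integrableZl.
rewrite integralZl// integralD//; [|exact: integrableZl|exact: integrableZl].
rewrite !integralZl// Em mule0 add0e.
apply: (@le_trans _ _ ((1 + c * nu)%:E * (`|C| * ((1 + c / (N i)%:R) ^+ k - 1))%:E +
  (c * nu)%:E * `|C|%:E)%E).
  apply: leeD; apply: lee_wpmul2l => //.
  - by rewrite lee_fin addr_ge0// mulr_ge0// ltW.
  - by rewrite lee_fin mulr_ge0// ltW.
  - by rewrite (le_trans HCk)// lee_fin ler_norm.
by rewrite -!EFinM -EFinD lee_fin exprS -/nu le_eqVlt; apply/orP; left; apply/eqP; ring.
Qed.

End LpMartingale.

(** * Brownian increments *)

Section Brownian.
Context {R : realType} {disp : measure_display} {Omega : measurableType disp}.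
Variables (P : probability Omega R) (T : R) (F : R -> set_system Omega).
Hypothesis hF : filtration T F.
Context {m : nat}.
Variable W : R -> Omega -> 'cV[R]_m.
Hypothesis hW : brownian_motion P T F W.

Lemma filtration_sigma_algebra t : 0 <= t <= T -> sigma_algebra [set: Omega] (F t).
Proof. by case: hF => + _ _; apply. Qed.

Lemma filtration_sub_measurable t : 0 <= t <= T -> F t `<=` measurable.
Proof. by case: hF => _ + _; apply. Qed.

Lemma measurable_for_mono s t (X : Omega -> R) : 0 <= s -> s <= t -> t <= T ->
  measurable_for (F s) X -> measurable_for (F t) X.
Proof.
move=> s0 st tT mX _ B mB; rewrite setTI; apply: sub_sigma_algebra.
have [_ _ mono] := hF; apply: (mono s t) => //.
apply: measurable_forP mX _ mB; apply: filtration_sigma_algebra.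
by rewrite s0 (le_trans st).
Qed.

Lemma measurable_for_measurable t (X : Omega -> R) : 0 <= t <= T ->
  measurable_for (F t) X -> measurable_fun setT X.
Proof.
move=> t0T; apply: measurable_for_sub; first exact: filtration_sigma_algebra.
exact: filtration_sub_measurable.
Qed.

Lemma adapted_measurable_for {n : nat} (X : R -> Omega -> 'cV[R]_n)
    (g : 'cV[R]_n -> R) t : adapted T F X -> continuous g -> 0 <= t <= T ->
  measurable_for (F t) (fun w => g (X t w)).
Proof. by move=> aX cg tT; apply: (measurable_for_comp (aX t tT) cg). Qed.

Lemma adapted_measurable {n : nat} (X : R -> Omega -> 'cV[R]_n)
    (g : 'cV[R]_n -> R) t : adapted T F X -> continuous g -> 0 <= t <= T ->
  measurable_fun setT (fun w => g (X t w)).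
Proof.
move=> aX cg tT.
exact: (measurable_for_measurable tT (adapted_measurable_for aX cg tT)).
Qed.

Lemma adapted_coord {n : nat} (X : R -> Omega -> 'cV[R]_n) t i :
  adapted T F X -> 0 <= t <= T -> measurable_fun setT (fun w => X t w i 0).
Proof.
by move=> aX tT; apply: (adapted_measurable (g := fun x => x i 0)) => //; exact: continuous_coord.
Qed.

Lemma measurable_enorm {n : nat} (X : Omega -> 'cV[R]_n) :
  (forall i, measurable_fun setT (fun w => X w i 0)) ->
  measurable_fun setT (fun w => enorm (X w)).
Proof.
move=> mX; apply: measurableT_comp.
  by apply: continuous_measurable_fun; exact: sqrt_continuous.
by apply: measurable_sum => i; apply: measurable_funM.
Qed.

Lemma bm_increment_measurable_for s t u j : 0 <= s -> s <= u -> 0 <= t -> t <= u -> u <= T ->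
  measurable_for (F u) (fun w => (W t w - W s w) j 0).
Proof.
move=> s0 su t0 tu uT; have [aW _ _ _] := hW.
have cj : continuous (fun x : 'cV[R]_m => x j 0) by exact: continuous_coord.
rewrite (_ : (fun w => _) = (fun w => W t w j 0 - W s w j 0)); last first.
  by apply/funext => w; rewrite !mxE.
apply: measurable_funB.
  apply: (measurable_for_mono t0 tu uT); apply: (adapted_measurable_for aW cj).
  by rewrite t0 (le_trans tu).
apply: (measurable_for_mono s0 su uT); apply: (adapted_measurable_for aW cj).
by rewrite s0 (le_trans su).
Qed.

Lemma bm_increment_measurable s t j : 0 <= s <= T -> 0 <= t <= T ->
  measurable_fun setT (fun w => (W t w - W s w) j 0).
Proof.
move=> sT tT; have [aW _ _ _] := hW.
rewrite (_ : (fun w => _) = (fun w => W t w j 0 - W s w j 0)); last first.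
  by apply/funext => w; rewrite !mxE.
by apply: measurable_funB; apply: adapted_coord.
Qed.

Lemma gaussian_coord h (X : Omega -> 'cV[R]_m) j (B : set R) :
  std_gaussian P h X -> measurable B ->
  P ((fun w => X w j 0) @^-1` B) = normal_prob 0%R (Num.sqrt h) B.
Proof.
move=> gX mB; pose C i : set R := if i == j then B else setT.
have mC i : measurable (C i) by rewrite /C; case: ifP.
have := gX C mC; rewrite (bigD1 j)//= {2}/C eqxx big1 ?mule1; last first.
  by move=> i ij; rewrite /C (negbTE ij) probability_setT.
move=> <-; congr (P _); apply/seteqP; split => w /=.
  by move=> Bw i; rewrite /C; case: eqP => // ->.
by move/(_ j); rewrite /C eqxx.
Qed.

Lemma gaussian_integral h (X : Omega -> 'cV[R]_m) j (f : R -> \bar R) :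
  std_gaussian P h X -> measurable_fun setT (fun w => X w j 0) ->
  measurable_fun setT f -> (forall x, 0 <= f x)%E ->
  (\int[P]_w f (X w j 0%R) = \int[normal_prob 0%R (Num.sqrt h)]_x f x)%E.
Proof.
move=> gX mX mf f0.
pose Z : {RV P >-> measurableTypeR R} :=
  HB.pack (fun w => X w j 0 : measurableTypeR R)
    (isMeasurableFun.Build _ _ Omega (measurableTypeR R) _ mX).
transitivity (\int[distribution P Z]_x f x)%E.
  by rewrite ge0_integral_distribution.
apply: (@eq_measure_integral _ _ _ setT (normal_prob 0%R (Num.sqrt h)) (distribution P Z)) => B mB _.
exact: gaussian_coord.
Qed.

(** The scale is an upper bound [H] of the length of the interval rather than
    the length itself, so that intervals reduced to a point are allowed. *)
Lemma bm_increment_Lp {I : Type} (D : I -> Prop) (s t H : I -> R) j :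
  (forall i, D i -> [/\ 0 <= s i, s i <= t i, t i <= T, 0 < H i & t i - s i <= H i]) ->
  Lp_bigO P D (fun i => Num.sqrt (H i)) (fun i w => (W (t i) w - W (s i) w) j 0).
Proof.
move=> HD; split.
- by move=> i /HD[_ _ _ h _]; rewrite sqrtr_gt0.
- move=> i /HD[s0 st tT _ _]; apply: bm_increment_measurable.
    by rewrite s0 (le_trans st).
  by rewrite (le_trans s0).
move=> q; have [C HC] := @normal_moment R q; exists (Num.max 1 C) => i Di.
have [s0 st tT H0 sH] := HD i Di.
have mZ : measurable_fun setT (fun w => (W (t i) w - W (s i) w) j 0).
  by apply: bm_increment_measurable; [rewrite s0 (le_trans st)|rewrite (le_trans s0)].
move: st; rewrite le_eqVlt => /predU1P[st|st].
  apply: (@le_trans _ _ (\int[P]_w 1)%E); last first.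
    by rewrite integral_cst//= [P _]probability_setT mule1 lee_fin le_max lexx.
  apply: ge0_le_integral => //.
  - exact: measurable_normalized.
  move=> w _; rewrite st subrr mxE normr0 mul0r lee_fin expr0n.
  by case: (q == 0)%N.
have [_ _ _ /(_ _ _ s0 st tT)[_ gW]] := hW.
have sts : 0 < Num.sqrt (t i - s i) by rewrite sqrtr_gt0 subr_gt0.
apply: (@le_trans _ _ C%:E); last by rewrite lee_fin le_max lexx orbT.
apply: le_trans (HC _ sts).
rewrite -(@gaussian_integral _ _ j (fun x => ((`|x| / Num.sqrt (t i - s i)) ^+ q)%:E) gW)//; last first.
  by apply/measurable_EFinP; apply: measurable_funX; exact: measurable_funM.
apply: ge0_le_integral => //.
- exact: measurable_normalized.
- exact: (@measurable_normalized _ _ _ (fun w => (W (t i) w - W (s i) w) j 0)).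
move=> w _; rewrite lee_fin; apply: lerXn2r; rewrite ?nnegrE ?divr_ge0 ?sqrtr_ge0//.
rewrite ler_wpM2l// lef_pV2 ?posrE ?sqrtr_gt0// ?ler_wsqrtr// subr_gt0//.
Qed.

Lemma bm_increment_orthogonal (A : Omega -> R) s u j :
  0 <= s -> s <= u -> u <= T -> measurable_for (F s) A -> all_moments P A ->
  (\int[P]_w (A w * (W u w - W s w) j 0%R)%:E = 0)%E.
Proof.
move=> s0; rewrite le_eqVlt => /predU1P[<- sT _ _|su uT mA LA].
  by rewrite (eq_integral (fun=> 0%E)) ?integral0// => w _; rewrite subrr mxE mulr0.
have sT : s <= T by rewrite (le_trans (ltW su)).
have u0 : 0 <= u by rewrite (le_trans s0)// ltW.
have mZ : measurable_fun setT (fun w => (W u w - W s w) j 0).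
  by apply: bm_increment_measurable; rewrite ?s0 ?u0.
have LZ : Lp_bigO P (fun _ : unit => True) (fun _ => Num.sqrt (u - s))
    (fun _ w => (W u w - W s w) j 0).
  apply: (@bm_increment_Lp _ _ (fun=> s) (fun=> u) (fun=> u - s)) => _ _.
  by split=> //; rewrite ?subr_gt0// ltW.
have [_ _ _ /(_ _ _ s0 su uT)[indep gW]] := hW.
apply: integral_mul_indep_centered => //.
- by apply: (measurable_for_measurable (t := s)) mA; rewrite s0.
- move=> B C mB mC.
  have GA : F s (A @^-1` B).
    by apply: measurable_forP mA _ mB; apply: filtration_sigma_algebra; rewrite s0.
  have H := indep _ _ GA (borel_preimage (@continuous_coord R m j) mC).
  exact: H.
- exact: (@Lp_bigO_integrable _ _ _ _ _ _ _ _ tt LZ Logic.I).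
- have sts : 0 < Num.sqrt (u - s) by rewrite sqrtr_gt0 subr_gt0.
  rewrite integralE -(normal_prob_mean0 sts) [RHS]integralE; congr (_ - _)%E.
    rewrite -(gaussian_integral gW mZ (f := fun x => ((EFin \o id)^\+ x)%E))//.
      by apply: eq_integral => w _; rewrite !funeposE.
    by apply: measurable_funepos; exact/measurable_EFinP.
  rewrite -(gaussian_integral gW mZ (f := fun x => ((EFin \o id)^\- x)%E))//.
    by apply: eq_integral => w _; rewrite !funenegE.
  by apply: measurable_funeneg; exact/measurable_EFinP.
- exact: (@Lp_bigO_integrable _ _ _ _ _ _ _ _ tt (Lp_bigOM LA LZ) Logic.I).
Qed.

End Brownian.

(** * Polynomial bounds on the drift *)

Section LineDerivative.
Context {R : realType} {d : nat}.
Implicit Types (G : 'cV[R]_d -> 'cV[R]_d) (x v : 'cV[R]_d).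

Lemma is_derive_line_coord G x v (i : 'I_d) (s : R) :
  differentiable G (x + s *: v) ->
  is_derive s (1 : R) (fun s : R => G (x + s *: v) i 0) ('d G (x + s *: v) v i 0).
Proof.
move=> dG.
have lim : h^-1 *: ((fun s : R => G (x + s *: v) i 0) (h *: 1 + s) -
    G (x + s *: v) i 0) @[h --> 0^'] --> 'd G (x + s *: v) v i 0.
  have := @diff_derivable _ _ _ _ _ v dG; rewrite /derivable => /cvg_ex[/= L HL].
  have EL : 'd G (x + s *: v) v = L by rewrite -deriveE//; exact/cvg_lim.
  have := cvg_comp _ _ HL (@continuous_coord R d i L); rewrite EL.
  apply: cvg_trans; apply: near_eq_cvg; near=> h => /=.
  rewrite !mxE /= [_%:A]mulr1 scalerDl; congr (_ * (_ - _)).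
  by rewrite addrCA.
by apply: DeriveDef; [apply/cvg_ex; exists ('d G (x + s *: v) v i 0)|exact/cvg_lim].
Unshelve. all: by end_near. Qed.

End LineDerivative.

Lemma diff_scale {R : realType} {d : nat} (G : 'cV[R]_d -> 'cV[R]_d) x (a : R) v :
  'd G x (a *: v) = a *: 'd G x v.
Proof. exact: linearZZ. Qed.

Section PolynomialWeights.
Context {R : realType}.
Implicit Types (a b C r l : R).

Lemma poly_weight_mono (C C' r : R) (n n' : nat) : 0 <= C -> C <= C' -> 0 <= r -> (n <= n')%N ->
  C * (1 + r) ^+ n <= C' * (1 + r) ^+ n'.
Proof.
move=> C0 CC r0 nn; apply: ler_pM => //; first by rewrite exprn_ge0// addr_ge0.
by rewrite ler_weXn2l// lerDl.
Qed.

Lemma powR_le_weight r l : 0 <= r -> 0 <= l ->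
  r `^ l <= (1 + r) ^+ (Num.truncn l).+1.
Proof.
move=> r0 l0; apply: (@le_trans _ _ ((1 + r) `^ l)).
  by apply: ge0_ler_powR; rewrite ?nnegrE ?addr_ge0// lerDr.
rewrite -powR_mulrn ?addr_ge0//; apply: ler_powR; first by rewrite lerDl.
by rewrite ltW// truncnS_gt.
Qed.

End PolynomialWeights.

Section DriftBounds.
Context {R : realType} {d : nat}.
Variable f : 'cV[R]_d -> 'cV[R]_d.
Implicit Types (x y u v : 'cV[R]_d).

(** Natural exponents and the weights [(1 + r) ^+ n] make it possible to give
    all the bounds on the drift one exponent and one constant. *)
Definition poly_lipschitz_bound (n : nat) (C : R) := forall x y,
  enorm (f x - f y) <= C * (1 + (enorm x + enorm y)) ^+ n * enorm (x - y).

Definition growth_bound (n : nat) (C : R) := forall x, enorm (f x) <= C * (1 + enorm x) ^+ n.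

Definition diff_bound (n : nat) (C : R) := forall x v,
  enorm ('d f x v) <= C * (1 + enorm x) ^+ n * enorm v.

Definition taylor_bound (n : nat) (C : R) := forall x v,
  enorm (f (x + v) - f x - 'd f x v) <= C * (1 + (enorm x + enorm v)) ^+ n * enorm v ^+ 2.

Lemma poly_lipschitz_bound_exists l : 0 < l -> poly_lipschitz_exponent f l ->
  exists n C, 0 < C /\ poly_lipschitz_bound n C.
Proof.
move=> l0 [L [L0 HL]]; exists (Num.truncn l).+1, (L * 3).
split => [|x y]; first by rewrite mulr_gt0.
apply: (le_trans (HL x y)); rewrite ler_wpM2r ?enorm_ge0// -mulrA ler_wpM2l ?(ltW L0)//.
set a := enorm x; set b := enorm y; have a0 : 0 <= a := enorm_ge0 x; have b0 : 0 <= b := enorm_ge0 y.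
set z := 1 + (a + b); have z1 : 1 <= z by rewrite /z; lra.
have h1 : 1 <= z ^+ (Num.truncn l).+1 by rewrite exprn_ege1.
have ha : a `^ l <= z ^+ (Num.truncn l).+1.
  apply: (le_trans (powR_le_weight a0 (ltW l0))).
  by apply: lerXn2r; rewrite ?nnegrE ?addr_ge0//; rewrite /z; lra.
have hb : b `^ l <= z ^+ (Num.truncn l).+1.
  apply: (le_trans (powR_le_weight b0 (ltW l0))).
  by apply: lerXn2r; rewrite ?nnegrE ?addr_ge0//; rewrite /z; lra.
lra.
Qed.

Lemma growth_bound_exists n C : 0 < C -> poly_lipschitz_bound n C ->
  exists n' C', 0 < C' /\ growth_bound n' C'.
Proof.
move=> C0 H; exists n.+1, (enorm (f 0) + C); split => [|x].
  by rewrite ltr_wpDl ?enorm_ge0.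
have := H x 0; rewrite enorm0 addr0 subr0 => Hx.
have -> : f x = f 0 + (f x - f 0) by rewrite addrC subrK.
apply: (le_trans (ler_enormD _ _)); rewrite mulrDl lerD//.
  by rewrite ler_peMr ?enorm_ge0// exprn_ege1// lerDl enorm_ge0.
apply: (le_trans Hx); rewrite exprSr mulrA.
by rewrite ler_wpM2l ?lerDr// mulr_ge0 ?(ltW C0)// exprn_ge0// addr_ge0 ?enorm_ge0.
Qed.

Lemma second_diff_scale (a : R) x v : (forall u x, differentiable (fun y => 'd f y u) x) ->
  second_diff f x (a *: v) (a *: v) = a ^+ 2 *: second_diff f x v v.
Proof.
move=> d2.
transitivity (a *: second_diff f x (a *: v) v).
  exact: (diff_scale (fun y => 'd f y (a *: v)) x a v).
rewrite expr2 -scalerA; congr (_ *: _); rewrite /second_diff.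
have -> : (fun y => 'd f y (a *: v)) = a *: (fun y => 'd f y v).
  by apply/funext => y; exact: (diff_scale f y a v).
exact: (congr1 (@^~ v) (diffZ a (d2 v x))).
Qed.

(** By homogeneity it suffices to consider unit vectors, at which the operator
    norm bounds the second derivative. *)
Lemma second_diff_bound : C2 f -> second_diff_poly_growth f ->
  exists n C, 0 < C /\ forall x v,
    enorm (second_diff f x v v) <= C * (1 + enorm x) ^+ n * enorm v ^+ 2.
Proof.
move=> [_ d2 _] [C [eta [C0 eta0 HC]]].
exists (Num.truncn eta).+1, (C * 2); split => [|x v]; first by rewrite mulr_gt0.
have [v0|v0] := eqVneq (enorm v) 0.
  have := second_diff_scale 0 x v d2; rewrite (enorm_eq0 v0) scaler0 expr0n scale0r => ->.
  by rewrite enorm0 expr0n mulr0.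
have vp : 0 < enorm v by rewrite lt0r v0 enorm_ge0.
pose u := (enorm v)^-1 *: v.
have u1 : enorm u = 1 by rewrite enormZ gtr0_norm ?invr_gt0// mulVf.
have -> : v = enorm v *: u by rewrite scalerA divff// scale1r.
rewrite second_diff_scale// enormZ (ger0_norm (sqr_ge0 _)) enormZ u1 mulr1.
rewrite (ger0_norm (enorm_ge0 v)) [leLHS]mulrC; apply: ler_wpM2r; rewrite ?sqr_ge0//.
have Hu : ((enorm (second_diff f x u u))%:E <= (C * (1 + enorm x `^ eta))%:E)%E.
  apply: le_trans (HC x); apply: ereal_sup_ubound; exists (u, u) => //=.
  by rewrite u1.
rewrite lee_fin in Hu.
have := powR_le_weight (enorm_ge0 x) (ltW eta0).
have : 1 <= (1 + enorm x) ^+ (Num.truncn eta).+1 by rewrite exprn_ege1// lerDl enorm_ge0.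
by move=> h1 h2; apply: (le_trans Hu); rewrite -mulrA ler_wpM2l ?(ltW C0)//; lra.
Qed.

(** Each coordinate is treated by two uses of the mean value theorem along the
    segment from [x] to [x + v].  The intermediate points differ from one
    coordinate to the next, whence a factor depending on the dimension. *)
Lemma taylor_bound_exists : C2 f -> second_diff_poly_growth f ->
  exists n C, 0 < C /\ taylor_bound n C.
Proof.
move=> C2f gf; have [d1 d2 _] := C2f; have [n [C [C0 HC]]] := second_diff_bound C2f gf.
(* [d.+1] instead of [d] keeps the constant positive in dimension 0. *)
exists n, (d.+1%:R * C); split => [|x v]; first by rewrite mulr_gt0.
apply: (le_trans (enorm_le_sum_coord _)).
pose B := C * (1 + (enorm x + enorm v)) ^+ n * enorm v ^+ 2.
have B0 : 0 <= B.
  by rewrite mulr_ge0 ?sqr_ge0// mulr_ge0 ?(ltW C0)// exprn_ge0// !addr_ge0 ?enorm_ge0.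
apply: (@le_trans _ _ (\sum_(i < d) B)); last first.
  rewrite sumr_const card_ord -[leLHS]mulr_natl.
  have -> : d.+1%:R * C * (1 + (enorm x + enorm v)) ^+ n * enorm v ^+ 2 = d.+1%:R * B.
    by rewrite /B !mulrA.
  by rewrite ler_wpM2r// ler_nat.
apply: ler_sum => i _.
pose g s := f (x + s *: v) i 0; pose g' s := 'd f (x + s *: v) v i 0.
pose g'' s := second_diff f (x + s *: v) v v i 0.
have dg s : is_derive s (1 : R) g (g' s) by exact: is_derive_line_coord.
have dg' s : is_derive s (1 : R) g' (g'' s).
  exact: (@is_derive_line_coord _ _ (fun y => 'd f y v)).
have cont (p p' : R -> R) : (forall s, is_derive s (1 : R) p (p' s)) ->
    forall a b, {within `[a, b], continuous p}.
  move=> dp a b; apply: continuous_subspaceT => s; apply: differentiable_continuous.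
  by apply/derivable1_diffP; exact: (@ex_derive _ _ _ _ _ _ _ (dp s)).
have [z z01 Hz] := @MVT R g g' 0 1 ltr01 (fun s _ => dg s) (cont _ _ dg 0 1).
have /andP[z0 z1] : 0 < z < 1 by rewrite in_itv in z01.
have [y y0z Hy] := @MVT R g' g'' 0 z z0 (fun s _ => dg' s) (cont _ _ dg' 0 z).
have /andP[y0 yz] : 0 < y < z by rewrite in_itv in y0z.
have -> : (f (x + v) - f x - 'd f x v) i 0 = g'' y * z.
  have colB (a b c : 'cV[R]_d) : (a - b - c) i 0 = a i 0 - b i 0 - c i 0.
    by rewrite !mxE.
  have g1 : g 1 = f (x + v) i 0 by rewrite /g scale1r.
  have g0 : g 0 = f x i 0 by rewrite /g scale0r addr0.
  have g'0 : g' 0 = 'd f x v i 0 by rewrite /g' scale0r addr0.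
  transitivity (g 1 - g 0 - g' 0).
    by rewrite g1 g0 g'0; exact: colB.
  by clear - Hz Hy; clearbody g g' g''; rewrite Hz subr0 mulr1 Hy subr0.
rewrite normrM (gtr0_norm z0) (@le_trans _ _ `|g'' y|)//.
  by rewrite ler_piMr// ltW.
apply: (le_trans (coord_le_enorm _ _)); apply: (le_trans (HC _ _)).
rewrite /B ler_wpM2r ?sqr_ge0// ler_wpM2l ?(ltW C0)//.
apply: lerXn2r; rewrite ?nnegrE ?addr_ge0 ?enorm_ge0// lerD2l.
apply: (le_trans (ler_enormD _ _)); rewrite lerD2l enormZ (gtr0_norm y0).
by rewrite ler_piMl ?enorm_ge0// ltW// (lt_trans yz).
Qed.

(** For a unit vector [u], [Df(x) u] is [f (x + u) - f x] up to the Taylor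
    remainder, and both are of polynomial growth. *)
Lemma diff_bound_exists n C n' C' : 0 < C -> 0 < C' ->
  poly_lipschitz_bound n C -> taylor_bound n' C' ->
  exists n'' C'', 0 < C'' /\ diff_bound n'' C''.
Proof.
move=> C0 C'0 HL HT.
exists (n + n')%N, (C * 3 ^+ n + C' * 2 ^+ n'); split => [|x v].
  by rewrite addr_gt0// mulr_gt0// exprn_gt0.
have [v0|v0] := eqVneq (enorm v) 0.
  rewrite (enorm_eq0 v0) -[X in 'd f x X](scale0r (0 : 'cV[R]_d)).
  by rewrite (diff_scale f x 0 0) scale0r enorm0 mulr0.
have vp : 0 < enorm v by rewrite lt0r v0 enorm_ge0.
pose u := (enorm v)^-1 *: v.
have u1 : enorm u = 1 by rewrite enormZ gtr0_norm ?invr_gt0// mulVf.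
have {1}-> : v = enorm v *: u by rewrite scalerA divff// scale1r.
rewrite (diff_scale f x (enorm v) u) enormZ (gtr0_norm vp) mulrC ler_wpM2r ?enorm_ge0//.
have -> : 'd f x u = (f (x + u) - f x) - (f (x + u) - f x - 'd f x u).
  by rewrite opprB addrC subrK.
apply: (le_trans (ler_enormB _ _)).
have x0 := enorm_ge0 x; have xu := ler_enormD x u; rewrite u1 in xu.
have w1 : 1 <= 1 + enorm x by rewrite lerDl.
have w0 : 0 <= 1 + enorm x by rewrite addr_ge0.
rewrite mulrDl; apply: lerD.
  apply: (le_trans (HL _ _)); rewrite addrAC subrr add0r u1 mulr1 -mulrA ler_wpM2l ?(ltW C0)//.
  apply: (@le_trans _ _ (3 ^+ n * (1 + enorm x) ^+ n)).
    rewrite -exprMn; apply: lerXn2r; rewrite ?nnegrE ?addr_ge0 ?mulr_ge0 ?enorm_ge0//.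
    by lra.
  by rewrite ler_wpM2l ?exprn_ge0// ler_weXn2l// leq_addr.
apply: (le_trans (HT _ _)); rewrite u1 expr1n mulr1 -mulrA ler_wpM2l ?(ltW C'0)//.
apply: (@le_trans _ _ (2 ^+ n' * (1 + enorm x) ^+ n')).
  rewrite -exprMn; apply: lerXn2r; rewrite ?nnegrE ?addr_ge0 ?mulr_ge0 ?enorm_ge0//.
  by lra.
by rewrite ler_wpM2l ?exprn_ge0// ler_weXn2l// leq_addl.
Qed.

End DriftBounds.

(** * The tamed drift *)

Section Taming.
Context {R : realType} {d : nat}.
Variables (f : 'cV[R]_d -> 'cV[R]_d) (T l alpha : R).
Hypotheses (T0 : 0 < T) (l0 : 0 < l) (alpha0 : 0 < alpha).

Definition taming_factor (N : nat) (x : 'cV[R]_d) : R :=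
  (1 + (T / N%:R) `^ alpha * enorm x `^ ((Num.ceil (2 * alpha))%:~R * l))^-1.

Lemma tamed_driftE N (x : 'cV[R]_d) : tamed_drift T f l alpha N x = taming_factor N x *: f x.
Proof. by []. Qed.

Lemma taming_factor_denom N (x : 'cV[R]_d) :
  1 <= 1 + (T / N%:R) `^ alpha * enorm x `^ ((Num.ceil (2 * alpha))%:~R * l).
Proof. by rewrite lerDl mulr_ge0// powR_ge0. Qed.

Lemma taming_factor_ge0 N (x : 'cV[R]_d) : 0 <= taming_factor N x.
Proof. by rewrite invr_ge0 (le_trans _ (taming_factor_denom N x)). Qed.

Lemma taming_factor_le1 N (x : 'cV[R]_d) : taming_factor N x <= 1.
Proof. by rewrite invf_le1 ?taming_factor_denom// (lt_le_trans _ (taming_factor_denom N x)). Qed.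

Lemma ceil_natr (a : R) : 0 < a ->
  exists n : nat, [/\ (0 < n)%N, a <= n%:R & (Num.ceil a)%:~R = n%:R :> R].
Proof.
move=> a0; have c0 : 0 < Num.ceil a by rewrite ceil_gt0.
exists `|Num.ceil a|%N; rewrite absz_gt0 gt_eqF//; split => //.
  by rewrite natr_absz ger0_norm ?ceil_ge// ltW.
by rewrite natr_absz ger0_norm// ltW.
Qed.

(** The relative error of the taming is [1 - 1/(1 + u) <= u], where [u] is the
    taming term, of order [N ^ - alpha]. *)
Lemma tamed_drift_error n C : 0 < C -> growth_bound f n C ->
  exists n' C', 0 < C' /\ forall (N : nat) (x : 'cV[R]_d), (0 < N)%N ->
    enorm (f x - tamed_drift T f l alpha N x) <=
      N%:R `^ (- alpha) * (C' * (1 + enorm x) ^+ n').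
Proof.
move=> C0 gf; have [k [k0 _ kE]] := @ceil_natr (2 * alpha) (mulr_gt0 (ltr0n _ 2) alpha0).
exists ((Num.truncn (k%:R * l)).+1 + n)%N, (T `^ alpha * C).
split=> [|N x N0]; first by rewrite mulr_gt0// powR_gt0.
rewrite tamed_driftE -{1}(scale1r (f x)) -scalerBl enormZ.
have := taming_factor_denom N x; have := gf x.
rewrite /taming_factor kE; set u := _ `^ alpha * _ => gx u1.
have u0 : 0 <= u by rewrite lerDl in u1.
have -> : 1 - (1 + u)^-1 = u / (1 + u) by field; rewrite gt_eqF// (lt_le_trans _ u1).
rewrite ger0_norm ?divr_ge0 ?(le_trans _ u1)//.
apply: (@le_trans _ _ (u * (C * (1 + enorm x) ^+ n))).
  apply: ler_pM => //; rewrite ?enorm_ge0 ?divr_ge0 ?(le_trans _ u1)//.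
  by rewrite ler_pdivrMr ?(lt_le_trans _ u1)// ler_peMr.
have -> : u = N%:R `^ (- alpha) * (T `^ alpha * enorm x `^ (k%:R * l)).
  rewrite /u powRM ?(ltW T0)// ?invr_ge0// -(powR_inv1 (ler0n _ N)) -powRrM mulN1r.
  by rewrite mulrA [X in X * _]mulrC.
rewrite exprD -!mulrA ler_wpM2l ?powR_ge0// ler_wpM2l ?powR_ge0//.
rewrite mulrCA ler_wpM2l ?(ltW C0)// ler_wpM2r ?exprn_ge0 ?addr_ge0 ?enorm_ge0//.
by apply: powR_le_weight; rewrite ?enorm_ge0// mulr_ge0// ltW.
Qed.

(** Here lies the reason for the exponent of the taming.  Let [h = T/N],
    [k] the ceiling of [2 alpha] and [z = h^(alpha/k) |x|^l]: the denominator of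
    the tamed drift is [1 + z^k], which dominates [z], whereas [sqrt h |x|^l] is
    [h^(1/2 - alpha/k) z], with a nonnegative exponent because [2 alpha <= k].
    So the denominator absorbs the superlinear factor [|x|^l] of the drift. *)
Lemma tamed_drift_linear_growth : poly_lipschitz_exponent f l ->
  exists K, 0 < K /\ forall (N : nat) (x : 'cV[R]_d), (0 < N)%N ->
    Num.sqrt (T / N%:R) * enorm (tamed_drift T f l alpha N x) <= K * (1 + enorm x).
Proof.
move=> [L [L0 HL]]; have [k [k0 ak kE]] := @ceil_natr (2 * alpha) (mulr_gt0 (ltr0n _ 2) alpha0).
have kp : 0 < k%:R :> R by rewrite ltr0n.
pose e := 2^-1 - alpha / k%:R.
have e0 : 0 <= e by rewrite subr_ge0 ler_pdivrMr//; lra.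
pose K := Num.sqrt T + T `^ e.
have K0 : 0 < K by rewrite ltr_pwDl ?sqrtr_gt0// powR_ge0.
exists (K * (enorm (f 0) + L)); split => [|N x N0].
  by rewrite mulr_gt0// ltr_wpDl ?enorm_ge0.
rewrite tamed_driftE enormZ ger0_norm ?taming_factor_ge0//.
pose h := T / N%:R; have h0 : 0 < h by rewrite divr_gt0// ltr0n.
have hT : h <= T by rewrite ler_pdivrMr ?ltr0n// ler_peMr ?(ltW T0)// ler1n.
set B := enorm x `^ l; have B0 : 0 <= B by rewrite powR_ge0.
have gx : enorm (f x) <= (enorm (f 0) + L) * ((1 + B) * (1 + enorm x)).
  have -> : f x = f 0 + (f x - f 0) by rewrite addrC subrK.
  apply: (le_trans (ler_enormD _ _)); rewrite mulrDl; apply: lerD.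
    rewrite ler_peMr ?enorm_ge0// mulr_ege1// lerDl ?enorm_ge0//.
  have := HL x 0; rewrite enorm0 subr0 powR0 ?gt_eqF// addr0 -/B => /le_trans; apply.
  rewrite -mulrA ler_wpM2l ?(ltW L0)// ler_wpM2l ?addr_ge0// lerDr//.
have key : Num.sqrt h * (taming_factor N x * (1 + B)) <= K.
  rewrite mulrCA ler_pdivrMl ?(lt_le_trans _ (taming_factor_denom N x))// kE -/h.
  pose z := h `^ (alpha / k%:R) * B; have z0 : 0 <= z by rewrite mulr_ge0// powR_ge0.
  have -> : h `^ alpha * enorm x `^ (k%:R * l) = z ^+ k.
    rewrite exprMn -!powR_mulrn ?powR_ge0// -!powRrM.
    by rewrite divfK ?gt_eqF// (mulrC l).
  rewrite mulrDr mulr1.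
  have -> : Num.sqrt h * B = h `^ e * z.
    rewrite /z mulrA -powRD ?(gt_eqF h0) ?implybT// /e subrK.
    by rewrite -powR12_sqrt ?(ltW h0).
  have zk : z <= 1 + z ^+ k.
    have [z1|/ltW z1] := leP z 1; first by rewrite (le_trans z1)// lerDl exprn_ge0.
    by rewrite (@le_trans _ _ (z ^+ k))// ?lerDr// ler_eXnr.
  have zk1 : 1 <= 1 + z ^+ k by rewrite lerDl exprn_ge0.
  rewrite mulrDr; apply: lerD.
    apply: (@le_trans _ _ (Num.sqrt T)); first by rewrite ler_wsqrtr.
    by rewrite ler_peMl ?sqrtr_ge0.
  rewrite mulrC; apply: ler_pM => //; first by rewrite powR_ge0.
  by apply: ge0_ler_powR; rewrite ?nnegrE ?(ltW h0) ?(ltW T0).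
apply: (@le_trans _ _ (Num.sqrt h * (taming_factor N x * ((enorm (f 0) + L) * ((1 + B) * (1 + enorm x)))))).
  by rewrite ler_wpM2l ?sqrtr_ge0// ler_wpM2l ?taming_factor_ge0.
have -> : Num.sqrt h * (taming_factor N x * ((enorm (f 0) + L) * ((1 + B) * (1 + enorm x)))) =
   (Num.sqrt h * (taming_factor N x * (1 + B))) * ((enorm (f 0) + L) * (1 + enorm x)) by ring.
rewrite -[leRHS]mulrA ler_wpM2r// mulr_ge0 ?addr_ge0 ?enorm_ge0 ?(ltW L0)//.
Qed.

End Taming.

Lemma tamed_drift_growth {R : realType} {d : nat} (f : 'cV[R]_d -> 'cV[R]_d)
    (T l alpha : R) (n : nat) (C : R) (N : nat) (x : 'cV[R]_d) :
  growth_bound f n C -> enorm (tamed_drift T f l alpha N x) <= C * (1 + enorm x) ^+ n.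
Proof.
move=> gf; rewrite tamed_driftE enormZ ger0_norm ?taming_factor_ge0//.
by apply: le_trans (gf x); rewrite ler_piMl ?enorm_ge0// taming_factor_le1.
Qed.

(** One exponent and one constant for all that is used of the drift and of its
    taming. *)
Record drift_bounds {R : realType} {d : nat} (f : 'cV[R]_d -> 'cV[R]_d)
    (T l alpha : R) (n : nat) (C : R) : Prop := DriftBounds {
  db_pos : 0 < C;
  db_lip : poly_lipschitz_bound f n C;
  db_growth : growth_bound f n C;
  db_diff : diff_bound f n C;
  db_taylor : taylor_bound f n C;
  db_onesided : forall x y, 2 * dot (x - y) (f x - f y) <= C * enorm (x - y) ^+ 2;
  db_tame : forall (N : nat) (x : 'cV[R]_d), (0 < N)%N ->
    enorm (f x - tamed_drift T f l alpha N x) <=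
      N%:R `^ (- alpha) * (C * (1 + enorm x) ^+ n);
  db_linear : forall (N : nat) (x : 'cV[R]_d), (0 < N)%N ->
    Num.sqrt (T / N%:R) * enorm (tamed_drift T f l alpha N x) <= C * (1 + enorm x) }.

Lemma drift_bounds_exist {R : realType} {d : nat} (f : 'cV[R]_d -> 'cV[R]_d)
    (T l alpha : R) : 0 < T -> 0 < l -> 0 < alpha ->
  drift_assumption f -> poly_lipschitz_exponent f l ->
  exists n C, drift_bounds f T l alpha n C.
Proof.
move=> T0 l0 alpha0 [C2f gf [L [L0 HL]]] pf.
have [n1 [C1 [C10 H1]]] := poly_lipschitz_bound_exists l0 pf.
have [n2 [C2 [C20 H2]]] := growth_bound_exists C10 H1.
have [n3 [C3 [C30 H3]]] := taylor_bound_exists C2f gf.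
have [n4 [C4 [C40 H4]]] := diff_bound_exists C10 C30 H1 H3.
have [n5 [C5 [C50 H5]]] := tamed_drift_error T0 l0 alpha0 C20 H2.
have [C6 [C60 H6]] := tamed_drift_linear_growth T0 l0 alpha0 pf.
pose n := (n1 + n2 + n3 + n4 + n5)%N; pose C := C1 + C2 + C3 + C4 + C5 + C6 + L.
have w (c r : R) (k : nat) : 0 < c -> c <= C -> 0 <= r -> (k <= n)%N ->
    c * (1 + r) ^+ k <= C * (1 + r) ^+ n.
  by move=> c0 cC r0 kn; apply: poly_weight_mono => //; exact: ltW.
have e0 (x : 'cV[R]_d) := enorm_ge0 x.
have e1 (x y : 'cV[R]_d) : 0 <= enorm x + enorm y by rewrite addr_ge0.
exists n, C; split.
- by rewrite /C; lra.
- move=> x y; apply: (le_trans (H1 x y)); rewrite ler_wpM2r//; apply: w => //.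
    by rewrite /C; lra.
  by rewrite /n -!addnA leq_addr.
- move=> x; apply: (le_trans (H2 x)); apply: w => //; first by rewrite /C; lra.
  by rewrite /n (addnC n1) -!addnA leq_addr.
- move=> x v; apply: (le_trans (H4 x v)); rewrite ler_wpM2r//; apply: w => //.
    by rewrite /C; lra.
  by rewrite /n -addnA addnCA leq_addr.
- move=> x v; apply: (le_trans (H3 x v)); rewrite ler_wpM2r ?sqr_ge0//; apply: w => //.
    by rewrite /C; lra.
  by rewrite /n (addnC _ n3) -!addnA leq_addr.
- move=> x y; apply: (le_trans (HL x y)); rewrite ler_wpM2r ?sqr_ge0//.
  by rewrite /C; lra.
- move=> N x N0; apply: (le_trans (H5 N x N0)); rewrite ler_wpM2l ?powR_ge0//.
  apply: w => //; first by rewrite /C; lra.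
  by rewrite /n leq_addl.
- move=> N x N0; apply: (le_trans (H6 N x N0)); rewrite ler_wpM2r ?addr_ge0//.
  by rewrite /C; lra.
Qed.

(** * The scheme along a path *)

Section Grid.
Context {R : realType}.
Variables (T : R) (N : nat).
Hypotheses (T0 : 0 < T) (N0 : (0 < N)%N).
Local Notation mu := (@lebesgue_measure R).

Definition grid (k : nat) : R := k%:R * (T / N%:R).

Lemma grid_step_gt0 : 0 < T / N%:R.
Proof. by rewrite divr_gt0// ltr0n. Qed.

Lemma grid0 : grid 0 = 0.
Proof. by rewrite /grid mul0r. Qed.

Lemma gridS k : grid k.+1 = grid k + T / N%:R.
Proof. by rewrite /grid -natr1 mulrDl mul1r. Qed.

Lemma gridN : grid N = T.
Proof. by rewrite /grid mulrCA divff ?mulr1// pnatr_eq0 gt_eqF. Qed.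

Lemma grid_ge0 k : 0 <= grid k.
Proof. by rewrite mulr_ge0// ltW// grid_step_gt0. Qed.

Lemma grid_le k k' : (grid k <= grid k') = (k <= k')%N.
Proof. by rewrite ler_pM2r ?grid_step_gt0// ler_nat. Qed.

Lemma grid_floorE k u : grid k <= u < grid k.+1 -> grid_floor T N u = grid k.
Proof.
move=> /andP[ku uk]; rewrite /grid_floor /grid; congr (_ * _).
rewrite (_ : k%:R = k%:Z%:~R)//; congr (_%:~R); apply: floor_def.
have NT : 0 < N%:R / T by rewrite divr_gt0// ltr0n.
rewrite mulrAC mulrC; apply/andP; split.
  by rewrite -ler_pdivrMr// invf_div.
rewrite -ltr_pdivlMr// invf_div (_ : (_ + 1)%:~R = k.+1%:R)//.
by rewrite intrD -natr1.
Qed.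

Lemma grid_floor_exists u : 0 <= u <= T -> exists2 k, (k <= N)%N & grid k <= u < grid k.+1.
Proof.
move=> /andP[u0 uT]; pose k := Num.truncn (u / (T / N%:R)).
have u0' : 0 <= u / (T / N%:R) by rewrite divr_ge0// ltW// grid_step_gt0.
have /andP[ku uk] := truncn_itv u0'.
have gk : grid k <= u by rewrite /grid -ler_pdivlMr ?grid_step_gt0.
exists k; last by rewrite gk /grid -ltr_pdivrMr ?grid_step_gt0.
by rewrite -grid_le gridN (le_trans gk).
Qed.

Lemma integrable_grid_step (c : R -> R) :
  mu.-integrable `[0, T] (EFin \o (fun u => c (grid_floor T N u))).
Proof.
(* The cell starting at [grid N] serves only to cover the point [T]. *)
pose I k := `[grid k, grid k.+1[%classic.
pose h u := \sum_(k < N.+1) c (grid k) * \1_(I k) u.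
have inth : mu.-integrable setT (EFin \o h).
  rewrite (_ : EFin \o h = fun u => (\sum_(k < N.+1) (c (grid k))%:E * (\1_(I k) u)%:E)%E).
    apply: integrable_sum => // k _; apply: integrableZl => //.
    exact: integrable_indic_itv.
  by apply/funext => u; rewrite /h/= -sumEFin; apply: eq_bigr => k _; rewrite EFinM.
apply: eq_integrable (integrableS _ _ _ inth) => //.
move=> u; rewrite inE/= in_itv/= => /grid_floor_exists[k kN ku].
rewrite /h (grid_floorE ku) (bigD1 (Ordinal (kN : (k < N.+1)%N)))//=.
rewrite indicE mem_set ?mulr1; last by rewrite /I/= in_itv/= ku.
rewrite big1 ?addr0// => j jk; rewrite indicE memNset ?mulr0//.
rewrite /I/= in_itv/= => /andP[ju uj].
have : (j < k.+1)%N.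
  by rewrite ltnNge -grid_le -ltNge (le_lt_trans ju)//; case/andP: ku.
have : (k < j.+1)%N.
  by rewrite ltnNge -grid_le -ltNge (le_lt_trans _ uj)//; case/andP: ku.
rewrite !ltnS => kj jk'; move/eqP: jk; apply; apply/val_inj => /=.
by apply/eqP; rewrite eqn_leq kj jk'.
Qed.

Lemma Rintegral_grid_step (c : R -> R) k s : grid k <= s <= grid k.+1 -> s <= T ->
  \int[mu]_(u in `[0, s]) c (grid_floor T N u) =
  \int[mu]_(u in `[0, grid k]) c (grid_floor T N u) + (s - grid k) * c (grid k).
Proof.
move=> /andP[ks sk] sT; apply/eqP; rewrite [X in _ == X]addrC -subr_eq; apply/eqP.
have ints : mu.-integrable `[0, s] (EFin \o (fun u => c (grid_floor T N u))).
  apply: integrableS (integrable_grid_step c) => //.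
  by apply: subset_itvl; rewrite bnd_simp.
rewrite Rintegral_itvB//; last by rewrite bnd_simp; exact: grid_ge0.
rewrite -Rintegral_itv_bndo_bndc; last first.
  apply: integrableS ints => // u /=; rewrite !in_itv/= => /andP[ku us].
  by rewrite (ltW us) andbT (le_trans (grid_ge0 k))// ltW.
rewrite (@eq_Rintegral _ _ _ _ _ (cst (c (grid k)))); last first.
  move=> u; rewrite inE/= in_itv/= => /andP[ku us]; rewrite (@grid_floorE k)//.
  by rewrite (ltW ku) (lt_le_trans us).
rewrite Rintegral_cst//= mulrC; congr (_ * _).
rewrite lebesgue_measure_itv/= lte_fin; case: ltP => // sk'.
by apply/eqP; rewrite eq_sym subr_eq0 eq_le ks sk'.
Qed.

Lemma euler_path_step {d m : nat} (g : 'cV[R]_d -> 'cV[R]_d) (sigma : 'M[R]_(d, m))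
    (x0 : 'cV[R]_d) (x : R -> 'cV[R]_d) (w : R -> 'cV[R]_m) :
  (forall t, 0 <= t <= T -> x t = x0
     + \col_i \int[mu]_(s in `[0, t]) (g (x (grid_floor T N s)) i 0)
     + sigma *m (w t - w 0)) ->
  forall k s, (k < N)%N -> grid k <= s <= grid k.+1 -> s <= T ->
  x s = x (grid k) + (s - grid k) *: g (x (grid k)) + sigma *m (w s - w (grid k)).
Proof.
move=> Hx k s kN ks sT; have /andP[ks1 ks2] := ks.
have s0T : 0 <= s <= T by rewrite sT (le_trans (grid_ge0 k)).
have k0T : 0 <= grid k <= T by rewrite grid_ge0 (le_trans ks1).
rewrite (Hx _ s0T) {1}(Hx _ k0T).
have -> : (\col_i \int[mu]_(u in `[0, s]) (g (x (grid_floor T N u)) i 0)) =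
  (\col_i \int[mu]_(u in `[0, grid k]) (g (x (grid_floor T N u)) i 0)) +
  (s - grid k) *: g (x (grid k)).
  apply/colP => i; rewrite !mxE.
  exact: (@Rintegral_grid_step (fun u => g (x u) i 0)).
have -> : sigma *m (w s - w 0) = sigma *m (w (grid k) - w 0) + sigma *m (w s - w (grid k)).
  by rewrite -mulmxDr; congr (_ *m _); rewrite [RHS]addrC addrA subrK.
rewrite !addrA; congr (_ + _); rewrite -!addrA; congr (_ + (_ + _)).
exact: addrC.
Qed.

Lemma euler_path0 {d m : nat} (g : 'cV[R]_d -> 'cV[R]_d) (sigma : 'M[R]_(d, m))
    (x0 : 'cV[R]_d) (x : R -> 'cV[R]_d) (w : R -> 'cV[R]_m) :
  (forall t, 0 <= t <= T -> x t = x0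
     + \col_i \int[mu]_(s in `[0, t]) (g (x (grid_floor T N s)) i 0)
     + sigma *m (w t - w 0)) -> x 0 = x0.
Proof.
move=> /(_ 0); rewrite lexx (ltW T0) => /(_ isT) ->.
rewrite subrr mulmx0 addr0 set_itv1; apply/colP => i.
by rewrite !mxE Rintegral_set1 addr0.
Qed.

End Grid.

(** * Differential inequalities with Riemann sums *)

Section RiemannComparison.
Context {R : realType}.
Implicit Types (a b e K : R) (r p : R -> R).

Definition node a b (n i : nat) : R := a + (b - a) * (i%:R / n%:R).

Definition riemann_sum a b r (n : nat) : R :=
  \sum_(i < n) (b - a) / n%:R * r (node a b n i).

Lemma node0 a b n : node a b n 0 = a.
Proof. by rewrite /node mul0r mulr0 addr0. Qed.

Lemma node_last a b n : (0 < n)%N -> node a b n n = b.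
Proof.
move=> n0; rewrite /node divff ?pnatr_eq0 -?lt0n// mulr1.
by rewrite addrC subrK.
Qed.

Lemma nodeS a b n i : node a b n i.+1 = node a b n i + (b - a) / n%:R.
Proof. by rewrite /node -natr1; ring. Qed.

Lemma node_itv a b n i : a <= b -> (i <= n)%N -> a <= node a b n i <= b.
Proof.
move=> ab; rewrite leq_eqVlt => /predU1P[->|lt_in].
  case: n => [|n]; first by rewrite node0 lexx.
  by rewrite node_last// lexx ab.
have n0 : (0 < n)%N by exact: leq_ltn_trans lt_in.
rewrite /node lerDl mulr_ge0 ?subr_ge0// ?divr_ge0//=.
rewrite -lerBrDl ler_piMr ?subr_ge0// ler_pdivrMr ?ltr0n// mul1r ler_nat.
exact: ltnW.
Qed.

Lemma heine_cantor_itv r a b e : continuous r -> 0 < e -> exists2 del, 0 < del &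
  forall x y, x \in `[a, b]%R -> `|x - y| < del -> `|r x - r y| <= e.
Proof.
move=> cr e0.
have cov := (@compact_near_coveringP _ `[a, b]%classic).1 (@segment_compact R a b).
have := cov R (0%R^'+) (fun del x => forall y, `|x - y| < del -> `|r x - r y| <= e) _.
case.
  move=> x _.
  have /cvgrPdist_lt/(_ _ (divr_gt0 e0 (ltr0n _ 2)))/nbhs_ballP[del /= del0 Hd] := cr x.
  have d20 : 0 < del / 2 by rewrite divr_gt0.
  exists (ball x (del / 2), [set d' | 0 < d' < del / 2]).
    split => /=; first exact: nbhsx_ballx.
    near=> d'; apply/andP; split; near: d'; [exact: nbhs_right_gt|exact: nbhs_right_lt].
  move=> [x' d'] [/= bx' /andP[_ dd]] y xy.
  have h1 : `|r x - r x'| < e / 2.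
    apply: Hd; apply: le_ball bx'; rewrite ler_pdivrMr//; lra.
  have h2 : `|r x - r y| < e / 2.
    apply: Hd; rewrite /ball/= in bx' *.
    rewrite -(subrK x' x) -addrA (le_lt_trans (ler_normD _ _))//.
    by rewrite [ltRHS](splitr del) ltrD// (lt_trans xy).
  rewrite (_ : r x' - r y = (r x' - r x) + (r x - r y)); last by ring.
  rewrite (le_trans (ler_normD _ _))// [leRHS](splitr e) lerD//; last exact: ltW.
  by rewrite distrC ltW.
move=> del /= del0 Hdel; exists (del / 2); first by rewrite divr_gt0.
move=> x y xab xy; apply: (Hdel (del / 2)) => //=; last by rewrite divr_gt0.
by rewrite sub0r normrN gtr0_norm ?divr_gt0// ltr_pdivrMr// ltr_pMr// ltr1n.
Unshelve. all: by end_near. Qed.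

(** The mean value theorem bounds the increment of [p] over a small interval by
    the value of [r] at some inner point, and uniform continuity lets [e] pay for
    moving that point to a node.  When [r] depends on a sample point, a Riemann
    sum is a finite sum of random variables, whose moments follow from those of
    [r]. *)
Lemma riemann_comparison p p' r a b e : a <= b -> 0 < e ->
  {within `[a, b], continuous p} -> continuous r ->
  (forall x, x \in `]a, b[%R -> is_derive x (1 : R) p (p' x)) ->
  (forall x, x \in `]a, b[%R -> p' x <= r x) ->
  \forall n \near \oo, p b <= p a + riemann_sum a b (fun x => r x + e) n.
Proof.
move=> ab e0 cp cr dp pr; move: ab; rewrite le_eqVlt => /predU1P[ab|ab].
  near=> n; rewrite -ab lerDl /riemann_sum subrr sumr_ge0// => i _.
  by rewrite !mul0r.
have [del del0 Hdel] := heine_cantor_itv a b cr e0.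
near=> n.
have n0 : (0 < n)%N by near: n; exact: nbhs_infty_gt.
have nd : (b - a) / n%:R < del.
  rewrite ltr_pdivrMr ?ltr0n// mulrC -ltr_pdivrMr//; near: n.
  exact: nbhs_infty_gtr.
have h0 : 0 < (b - a) / n%:R by rewrite divr_gt0 ?subr_gt0 ?ltr0n.
suff H i : (i <= n)%N -> p (node a b n i) <=
    p a + \sum_(j < i) (b - a) / n%:R * (r (node a b n j) + e).
  by have := H n (leqnn n); rewrite node_last.
elim: i => [_|i IH lt_in]; first by rewrite node0 big_ord0 addr0.
have := IH (ltnW lt_in) => {}IH.
set v := node a b n i; set u := node a b n i.+1.
have uE : u = v + (b - a) / n%:R by exact: nodeS.
have vu : v < u by rewrite uE ltrDl.
have /andP[av _] : a <= v <= b by exact: node_itv (ltW ab) (ltnW lt_in).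
have /andP[_ ub] : a <= u <= b by exact: node_itv (ltW ab) lt_in.
have sub x : x \in `]v, u[%R -> x \in `]a, b[%R.
  by rewrite !in_itv/= => /andP[vx xu]; rewrite (le_lt_trans av)//= (lt_le_trans xu).
have cvu : {within `[v, u], continuous p}.
  apply: continuous_subspaceW cp => x /=; rewrite !in_itv/= => /andP[vx xu].
  by rewrite (le_trans av)//= (le_trans xu).
have [c cvu' Hc] := MVT vu (fun x xvu => dp x (sub x xvu)) cvu.
have /andP[vc cu] : v < c < u by rewrite in_itv in cvu'.
have pc : p' c <= r v + e.
  rewrite (le_trans (pr c (sub c cvu')))// -lerBlDl (le_trans (ler_norm _))//.
  rewrite distrC; apply: Hdel.
    by rewrite in_itv/= av (le_trans (ltW vu)).
  rewrite distrC gtr0_norm ?subr_gt0// (le_lt_trans _ nd)//.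
  by rewrite lerBlDl -uE ltW.
rewrite big_ord_recr/= -/v.
have uv : u - v = (b - a) / n%:R by rewrite uE addrC addKr.
have : (b - a) / n%:R * p' c <= (b - a) / n%:R * (r v + e) by rewrite ler_wpM2l ?(ltW h0).
move: Hc IH; rewrite uv -/v; set h := (b - a) / n%:R; set S := \sum_(_ < i) _; lra.
Unshelve. all: by end_near. Qed.

(** The previous comparison, applied to [expR (- K (x - a)) * p x]. *)
Lemma gronwall_riemann p p' r a b K e : a <= b -> 0 < e -> 0 <= K ->
  {within `[a, b], continuous p} -> continuous r -> (forall x, 0 <= r x) ->
  (forall x, x \in `]a, b[%R -> is_derive x (1 : R) p (p' x)) ->
  (forall x, x \in `]a, b[%R -> p' x <= K * p x + r x) ->
  \forall n \near \oo, p b <= expR (K * (b - a)) * (p a + riemann_sum a b (fun x => r x + e) n).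
Proof.
move=> ab e0 K0 cp cr r0 dp pr.
pose E (x : R) := expR (- (K * (x - a))).
have dE (x : R) : is_derive x (1 : R) E (- K * E x).
  by rewrite /E; apply: is_derive_eq; rewrite /GRing.scale/=; ring.
have cE : continuous E.
  by move=> x; apply/differentiable_continuous/derivable1_diffP.
pose q x := E x * p x; pose q' x := E x * (p' x - K * p x).
have dq x : x \in `]a, b[%R -> is_derive x (1 : R) q (q' x).
  move=> xab; have dpx := dp x xab; have dEx := dE x.
  rewrite /q; apply: is_derive_eq; rewrite /q' /GRing.scale/=; ring.
have cq : {within `[a, b], continuous q}.
  move=> x; apply: continuousM; last exact: cp.
  by apply: continuous_subspaceT.
have qr x : x \in `]a, b[%R -> q' x <= r x.
  move=> xab; have ax : a < x by move: xab; rewrite in_itv/= => /andP[].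
  have Ex1 : E x <= 1.
    by rewrite -expR0 ler_expR oppr_le0 mulr_ge0// subr_ge0 ltW.
  rewrite (@le_trans _ _ (E x * r x))//.
    by rewrite ler_wpM2l ?expR_ge0// lerBlDl pr.
  by rewrite ler_piMl.
have := riemann_comparison ab e0 cq cr dq qr; apply: filterS => n.
rewrite /q /E subrr mulr0 oppr0 expR0 mul1r expRN => Hn.
by rewrite -ler_pdivrMl ?expR_gt0.
Qed.

Lemma gronwall_chain (Q len : nat -> R) (S : nat -> nat -> R) (K : R) (m : nat) :
  0 <= K -> (forall i, 0 <= len i) -> (forall i n, 0 <= S i n) ->
  (forall i, (i < m)%N -> \forall n \near \oo,
     Q i.+1 <= expR (K * len i) * (Q i + S i n)) ->
  \forall n \near \oo,
     Q m <= expR (K * \sum_(i < m) len i) * (Q 0%N + \sum_(i < m) S i n).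
Proof.
move=> K0 l0 S0; elim: m => [|m IH] HQ.
  by near=> n; rewrite !big_ord0 mulr0 expR0 mul1r addr0.
have {}IH := IH (fun i im => HQ i (ltn_trans im (ltnSn m))).
have Hm := HQ m (ltnSn m).
apply: filterS2 IH Hm => n IHn Hmn.
rewrite !big_ord_recr/= (mulrDr K) expRD; apply: (le_trans Hmn).
set c := expR _ in IHn *; set c' := expR (K * len m).
have c1 : 1 <= c by rewrite -expR0 ler_expR mulr_ge0// sumr_ge0.
have c'0 : 0 <= c' by rewrite expR_ge0.
rewrite (mulrC c) -mulrA ler_wpM2l// addrA mulrDr lerD//.
by rewrite ler_peMl.
Unshelve. all: by end_near. Qed.

End RiemannComparison.

(** * The error on one interval *)

Section RemainderBound.
Context {R : realType}.

(** A bound for [|f (xs + M) - g0 - Df(x0) wv|] in terms of norms.  The four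
    terms stand for: the removal of the martingale [M] by the Lipschitz bound, the
    Taylor remainder at [x0], [Df(x0)] applied to the drift displacement and to
    the latest noise, and the taming error. *)
Definition remainder_bound (n : nat) (C del X M x0 dx h ws : R) : R :=
  C * (1 + (2 * X + M)) ^+ n * M + C * (1 + (x0 + dx)) ^+ n * dx ^+ 2 +
  C * (1 + x0) ^+ n * (h * (C * (1 + x0) ^+ n) + ws) + del * (C * (1 + x0) ^+ n).

Lemma continuous_remainder_bound (n : nat) (C del x0 : R) (X M dx h ws : R -> R) :
  continuous X -> continuous M -> continuous dx -> continuous h -> continuous ws ->
  continuous (fun s => remainder_bound n C del (X s) (M s) x0 (dx s) (h s) (ws s)).
Proof.
move=> cX cM cdx ch cws.
have cc (c : R) : continuous (fun _ : R => c) by move=> s; exact: cvg_cst.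
have cD (u v : R -> R) : continuous u -> continuous v -> continuous (fun s => u s + v s).
  by move=> cu cv s; apply: cvgD; [exact: cu|exact: cv].
have cMul (u v : R -> R) : continuous u -> continuous v -> continuous (fun s => u s * v s).
  by move=> cu cv s; apply: cvgM; [exact: cu|exact: cv].
have cX' k (u : R -> R) : continuous u -> continuous (fun s => u s ^+ k).
  move=> cu; elim: k => [|k IH]; first exact: cc.
  by under eq_fun do rewrite exprS; exact: cMul.
have cP (u : R -> R) : continuous u -> continuous (fun s => C * (1 + u s) ^+ n).
  by move=> cu; apply: (cMul _ _ (cc C)); apply: cX'; exact: (cD _ _ (cc 1) cu).
have c1 := cMul _ _ (cP _ (cD _ _ (cMul _ _ (cc 2) cX) cM)) cM.
have c2 := cMul _ _ (cP _ (cD _ _ (cc x0) cdx)) (cX' 2 _ cdx).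
have c3 := cMul _ _ (cc (C * (1 + x0) ^+ n))
  (cD _ _ (cMul _ _ ch (cc (C * (1 + x0) ^+ n))) cws).
exact: (cD _ _ (cD _ _ (cD _ _ c1 c2) c3) (cc (del * (C * (1 + x0) ^+ n)))).
Qed.

End RemainderBound.

Section IntegralDerivative.
Context {R : realType}.
Local Notation mu := (@lebesgue_measure R).

Lemma continuous_integrable_itv (g : R -> R) a b : continuous g ->
  mu.-integrable `[a, b] (EFin \o g).
Proof.
move=> cg; apply: continuous_compact_integrable; first exact: segment_compact.
exact: continuous_subspaceT.
Qed.

Lemma is_derive_Rintegral (g : R -> R) (s : R) : continuous g -> 0 < s ->
  is_derive s (1 : R) (fun s => \int[mu]_(u in `[0, s]) g u) (g s).
Proof.
move=> cg s0; have ss : s < s + 1 by rewrite ltrDl.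
have [D E] := continuous_FTC1_closed ss (continuous_integrable_itv 0 (s + 1) cg) s0 (cg s).
by apply: DeriveDef; [exact: D|rewrite -derive1E; exact: E].
Qed.

Lemma continuous_Rintegral (g : R -> R) a b : continuous g -> 0 <= a -> a <= b ->
  {within `[a, b], continuous (fun s => \int[mu]_(u in `[0, s]) g u)}.
Proof.
move=> cg a0 ab; have b0 : 0 <= b := le_trans a0 ab.
apply: (@continuous_subspaceW _ _ _ `[0, b]).
  move=> x /=; rewrite !in_itv/= => /andP[ax xb].
  by rewrite xb andbT (le_trans a0).
exact: parameterized_integral_continuous (continuous_integrable_itv 0 b cg).
Qed.

End IntegralDerivative.

Section CoordinatewiseContinuity.
Context {R : realType}.

(** Continuity of the coordinates is all that Euclidean norms and integrals
    ask for, and it is stable under the operations used to build the paths. *)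
Definition coord_continuous_path {d : nat} (v : R -> 'cV[R]_d) :=
  forall i, continuous (fun s => v s i 0).

Lemma continuous_path {d : nat} (v : R -> 'cV[R]_d) : continuous v -> coord_continuous_path v.
Proof.
move=> cv i s.
apply: (@continuous_comp _ _ _ v (fun z : 'cV[R]_d => z i 0)); first exact: cv.
exact: continuous_coord.
Qed.

Lemma coord_continuous_cst {d : nat} (c : 'cV[R]_d) : coord_continuous_path (fun=> c).
Proof. by move=> i s; exact: cvg_cst. Qed.

Lemma coord_continuousD {d : nat} (u v : R -> 'cV[R]_d) : coord_continuous_path u ->
  coord_continuous_path v -> coord_continuous_path (fun s => u s + v s).
Proof.
move=> cu cv i; rewrite (_ : (fun s => _) = fun s => u s i 0 + v s i 0).
  by move=> s; apply: cvgD; [exact: cu|exact: cv].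
by apply/funext => s; rewrite mxE.
Qed.

Lemma coord_continuousZ {d : nat} (a : R -> R) (c : 'cV[R]_d) : continuous a ->
  coord_continuous_path (fun s => a s *: c).
Proof.
move=> ca i; rewrite (_ : (fun s => _) = fun s => a s * c i 0).
  by move=> s; apply: cvgMl; exact: ca.
by apply/funext => s; rewrite mxE.
Qed.

Lemma coord_continuous_mulmx {d m : nat} (A : 'M[R]_(d, m)) (u : R -> 'cV[R]_m) :
  coord_continuous_path u -> coord_continuous_path (fun s => A *m u s).
Proof.
move=> cu i; rewrite (_ : (fun s => _) = fun s => \sum_j A i j * u s j 0).
  by apply: continuous_sumr => j _ s; apply: cvgMr; exact: cu.
by apply/funext => s; rewrite mxE.
Qed.

Lemma continuous_enorm_path {d : nat} (u : R -> 'cV[R]_d) :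
  coord_continuous_path u -> continuous (fun s => enorm (u s)).
Proof.
move=> cu s.
apply: (@continuous_comp _ _ _ (fun s => dot (u s) (u s)) Num.sqrt).
  2: exact: sqrt_continuous.
move: s; apply: continuous_sumr => i _ s; have cs := cu i s.
exact: (continuousM cs cs).
Qed.

End CoordinatewiseContinuity.

Section IntervalError.
Context {R : realType} {d m : nat}.
Local Notation mu := (@lebesgue_measure R).
Variables (f : 'cV[R]_d -> 'cV[R]_d) (sigma : 'M[R]_(d, m)) (n : nat) (C : R).
Hypotheses (C0 : 0 < C) (f_lip : poly_lipschitz_bound f n C)
  (f_diff : diff_bound f n C) (f_taylor : taylor_bound f n C)
  (f_onesided : forall x y, 2 * dot (x - y) (f x - f y) <= C * enorm (x - y) ^+ 2)
  (f_cont : continuous f).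

(** [h] is the time elapsed since the beginning of the cell, [wv] the noise
    whose effect is already in the martingale, [ws] the noise since then. *)
Lemma drift_remainder_bound x0 xs M g0 wv ws del (h : R) : 0 <= h -> 0 <= del ->
  xs - x0 = h *: g0 + (wv + ws) ->
  enorm g0 <= C * (1 + enorm x0) ^+ n ->
  enorm (f x0 - g0) <= del * (C * (1 + enorm x0) ^+ n) ->
  enorm (f (xs + M) - g0 - 'd f x0 wv) <=
    remainder_bound n C del (enorm xs) (enorm M) (enorm x0) (enorm (xs - x0)) h (enorm ws).
Proof.
move=> h0 del0 dxE g0le tame.
have dD u v : 'd f x0 (u + v) = 'd f x0 u + 'd f x0 v by exact: linearD.
have dZ a u : 'd f x0 (a *: u) = a *: 'd f x0 u by exact: diff_scale.
have w0 : 0 <= C * (1 + enorm x0) ^+ n.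
  by rewrite mulr_ge0 ?(ltW C0)// exprn_ge0// addr_ge0 ?enorm_ge0.
have -> : f (xs + M) - g0 - 'd f x0 wv = (f (xs + M) - f xs) +
    (f (x0 + (xs - x0)) - f x0 - 'd f x0 (xs - x0)) +
    (h *: 'd f x0 g0 + 'd f x0 ws) + (f x0 - g0).
  rewrite {2}dxE !dD dZ (addrC x0) subrK.
  move: (f (xs + M)) (f xs) (f x0) ('d f x0 wv) ('d f x0 ws) (h *: _) => p q r s t u.
  by apply/colP => i; rewrite !mxE; ring.
rewrite /remainder_bound.
apply: (le_trans (ler_enormD _ _)); apply: lerD; last exact: tame.
apply: (le_trans (ler_enormD _ _)); apply: lerD; last first.
  apply: (le_trans (ler_enormD _ _)); rewrite mulrDr; apply: lerD; last exact: f_diff.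
  rewrite enormZ ger0_norm// mulrCA ler_wpM2l//.
  by apply: (le_trans (f_diff _ _)); rewrite ler_wpM2l.
apply: (le_trans (ler_enormD _ _)); apply: lerD; last exact: f_taylor.
apply: (le_trans (f_lip _ _)); rewrite addrAC subrr add0r ler_wpM2r ?enorm_ge0//.
rewrite ler_wpM2l ?(ltW C0)//.
apply: lerXn2r; rewrite ?nnegrE ?addr_ge0 ?mulr_ge0 ?enorm_ge0//.
by rewrite lerD2l mulr_natl mulr2n addrAC lerD2r ler_enormD.
Qed.

Variables (y : R -> 'cV[R]_d) (w : R -> 'cV[R]_m) (y0 : 'cV[R]_d).
Hypotheses (cy : continuous y) (cw : continuous w).

(** The noise of [y] and that of the scheme cancel, so the coordinates of the
    corrected error are integrals of continuous functions plus affine functions of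
    time.  The derivative of [err] is twice the scalar product of the corrected
    error with [f (y s) - g0 - B]; inserting [f (xs s + Ms s)] splits it into a
    part controlled by the one-sided Lipschitz condition and a part bounded by the
    remainder, to which Young's inequality applies. *)
Lemma interval_error a b tau (x0 g0 M0 : 'cV[R]_d) (del e : R) :
  0 <= a -> a <= b -> tau <= a -> 0 < e -> 0 <= del ->
  (forall s, a <= s <= b -> y s = y0
     + \col_i \int[mu]_(u in `[0, s]) (f (y u) i 0) + sigma *m (w s - w 0)) ->
  enorm g0 <= C * (1 + enorm x0) ^+ n ->
  enorm (f x0 - g0) <= del * (C * (1 + enorm x0) ^+ n) ->
  let wv := sigma *m (w a - w tau) in
  let xs s := x0 + (s - tau) *: g0 + sigma *m (w s - w tau) in
  let Ms s := M0 + (s - a) *: 'd f x0 wv in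
  let err s := enorm (y s - xs s - Ms s) ^+ 2 in
  \forall k \near \oo, err b <= expR ((C + 1) * (b - a)) * (err a +
    riemann_sum a b (fun s => remainder_bound n C del (enorm (xs s)) (enorm (Ms s))
      (enorm x0) (enorm (xs s - x0)) `|s - tau| (enorm (sigma *m (w s - w a))) ^+ 2 + e) k).
Proof.
move=> a0 ab ta e0 del0 Hy g0le tame wv xs Ms err.
set B := 'd f x0 wv.
have cfy i : continuous (fun s => f (y s) i 0).
  move=> s; apply: (@continuous_comp _ _ _ (f \o y) (fun z : 'cV[R]_d => z i 0)).
    by apply: continuous_comp; [exact: cy|exact: f_cont].
  exact: continuous_coord.
pose J i s := \int[mu]_(u in `[0, s]) (f (y u) i 0).
pose k0 (i : 'I_d) : R := (y0 + sigma *m (w tau - w 0) - x0 + tau *: g0 - M0 + a *: B) i 0.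
pose k1 (i : 'I_d) : R := (g0 + B) i 0.
pose E i s := J i s + (k0 i - k1 i * s).
have errE s : a <= s <= b -> forall i, (y s - xs s - Ms s) i 0 = E i s.
  move=> sab i; rewrite (Hy s sab) /E /k0 /k1 /xs /Ms -/B /J.
  have -> : sigma *m (w s - w tau) = sigma *m (w s - w 0) - sigma *m (w tau - w 0).
    by rewrite -mulmxBr; congr (_ *m _); rewrite opprB addrA subrK.
  by move: (sigma *m _) (sigma *m _) => p q; rewrite !mxE; ring.
pose p s := \sum_(i < d) E i s ^+ 2.
have pE s : a <= s <= b -> p s = err s.
  move=> sab; rewrite /err enorm_sqrE; apply: eq_bigr => i _.
  by rewrite errE.
pose p' s := \sum_(i < d) 2 * (E i s * (f (y s) i 0 - k1 i)).
have dE (i : 'I_d) (s : R) : 0 < s -> is_derive s (1 : R) (E i) (f (y s) i 0 - k1 i).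
  move=> s0; have dJ := is_derive_Rintegral (cfy i) s0.
  rewrite /E; apply: is_derive_eq; rewrite /GRing.scale/=; ring.
have dp (s : R) : s \in `]a, b[%R -> is_derive s (1 : R) p (p' s).
  rewrite in_itv/= => /andP[sa sb]; have s0 := le_lt_trans a0 sa.
  have -> : p = \sum_(i < d) (fun s => E i s ^+ 2).
    by apply/funext => z; rewrite fct_sumE.
  apply: is_derive_sum => i; have dEi := dE i s s0.
  by apply: is_derive_eq; rewrite /GRing.scale/=; ring.
have cp : {within `[a, b], continuous p}.
  apply: continuous_sumr => i _; rewrite (_ : (fun s => _) = fun s => E i s * E i s).
    have cE : {within `[a, b], continuous (E i)}.
      move=> s; apply: continuousD; first exact: continuous_Rintegral.
      apply: continuous_subspaceT => {}s; apply: cvgB; first exact: cvg_cst.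
      by apply: cvgMr; exact: cvg_id.
    by move=> s; exact: (continuousM (cE s) (cE s)).
  by apply/funext => s; rewrite expr2.
pose rho s := remainder_bound n C del (enorm (xs s)) (enorm (Ms s))
      (enorm x0) (enorm (xs s - x0)) `|s - tau| (enorm (sigma *m (w s - w a))).
have cxs : coord_continuous_path xs.
  apply: coord_continuousD; last first.
    by apply: coord_continuous_mulmx; apply: coord_continuousD;
      [exact: continuous_path|exact: coord_continuous_cst].
  apply: coord_continuousD; first exact: coord_continuous_cst.
  by apply: coord_continuousZ => s; apply: cvgB; [exact: cvg_id|exact: cvg_cst].
have cMs : coord_continuous_path Ms.
  apply: coord_continuousD; first exact: coord_continuous_cst.
  by apply: coord_continuousZ => s; apply: cvgB; [exact: cvg_id|exact: cvg_cst].
have crho : continuous rho.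
  apply: continuous_remainder_bound.
  - exact: continuous_enorm_path.
  - exact: continuous_enorm_path.
  - apply: continuous_enorm_path; apply: coord_continuousD => //.
    exact: coord_continuous_cst.
  - move=> s; apply: cvg_norm; apply: cvgB; [exact: cvg_id|exact: cvg_cst].
  - apply: continuous_enorm_path; apply: coord_continuous_mulmx.
    apply: coord_continuousD; first exact: continuous_path.
    exact: coord_continuous_cst.
have := @gronwall_riemann R p p' (fun s => rho s ^+ 2) a b (C + 1) e ab e0 _ cp.
move=> /(_ _ _ _ dp); rewrite !pE ?lexx ?ab//; apply.
- by rewrite addr_ge0// ltW.
- by move=> s; exact: (continuousM (crho s) (crho s)).
- by move=> s; exact: sqr_ge0.
move=> s sab; have sab' : a <= s <= b.
  by move: sab; rewrite in_itv/= => /andP[? ?]; apply/andP; split; exact: ltW.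
have /andP[sa sb] := sab'.
rewrite pE// /err; set er := y s - xs s - Ms s.
have -> : p' s = 2 * dot er (f (y s) - f (xs s + Ms s)) +
    2 * dot er (f (xs s + Ms s) - g0 - B).
  rewrite -mulrDr -dotDr /p' /dot mulr_sumr; apply: eq_bigr => i _.
  rewrite -(errE s sab' i) /k1 -/er; congr (2 * (_ * _)).
  by move: (f (y s)) (f _) => u v; rewrite !mxE; ring.
have h1 := f_onesided (y s) (xs s + Ms s).
have h2 := dot_le_enorm er (f (xs s + Ms s) - g0 - B).
have rem : enorm (f (xs s + Ms s) - g0 - B) <= rho s.
  rewrite /B /rho (ger0_norm (x := s - tau)) ?subr_ge0 ?(le_trans ta)//.
  apply: drift_remainder_bound => //; first by rewrite subr_ge0 (le_trans ta).
  rewrite /xs /wv addrAC (addrC x0) addrK; congr (_ + _).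
  by rewrite -mulmxDr; congr (_ *m _); rewrite [RHS]addrC addrA subrK.
rewrite opprD addrA -/er in h1.
have h3 : 2 * (enorm er * rho s) <= enorm er ^+ 2 + rho s ^+ 2.
  by have := sqr_ge0 (enorm er - rho s); rewrite sqrrB; lra.
have h4 : dot er (f (xs s + Ms s) - g0 - B) <= enorm er * rho s.
  by rewrite (le_trans h2)// ler_wpM2l ?enorm_ge0.
lra.
Qed.

End IntervalError.

(** * Moments of the scheme: the pathwise bound *)

Lemma discrete_gronwall {R : realType} (u G : nat -> R) (K h : R) (m : nat) :
  0 <= K -> 0 <= h -> (forall k, 0 <= G k) ->
  (forall k, (k < m)%N -> u k.+1 <= (1 + K * h) * u k + h * G k) ->
  (forall k, 0 <= u k) ->
  u m <= expR (K * (h *+ m)) * (u 0%N + \sum_(j < m) h * G j).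
Proof.
move=> K0 h0 G0 + u0; elim: m => [|m IH] Hu.
  by rewrite mulr0n mulr0 expR0 mul1r big_ord0 addr0.
have {}IH := IH (fun k km => Hu k (ltn_trans km (ltnSn m))).
apply: (le_trans (Hu m (ltnSn m))); rewrite big_ord_recr/= mulrSr (mulrDr K) expRD.
have Kh : 0 <= K * h by rewrite mulr_ge0.
have e1 : 1 + K * h <= expR (K * h) by exact: expR_ge1Dx.
set S := \sum_(j < m) _ in IH *; set c := expR (K * (h *+ m)) in IH *.
have c1 : 1 <= c by rewrite -expR0 ler_expR mulr_ge0// mulrn_wge0.
have hG : 0 <= h * G m by rewrite mulr_ge0.
have E1 : 1 <= expR (K * h) by rewrite (le_trans _ e1)// lerDl.
rewrite (mulrC c) -mulrA addrA mulrDr mulrDr; apply: lerD.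
  by apply: ler_pM => //; rewrite addr_ge0.
by rewrite mulrA ler_peMl// mulr_ege1.
Qed.

Lemma enorm_sqrDZ {R : realType} {d : nat} (z g : 'cV[R]_d) (h : R) :
  enorm (z + h *: g) ^+ 2 = enorm z ^+ 2 + h * (2 * dot z g) + h * (h * enorm g ^+ 2).
Proof.
by rewrite !enorm_sqr !(dotDl, dotDr, dotZl, dotZr) (dotC g z); ring.
Qed.

Section TamedEulerMoments.
Context {R : realType} {d : nat}.
Variables (f : 'cV[R]_d -> 'cV[R]_d) (T l alpha : R) (n : nat) (C : R).
Hypotheses (T0 : 0 < T) (fB : drift_bounds f T l alpha n C).

(** Source term of the recursion for the scheme deprived of its noise [b]: the
    first summand bounds [|f b|^2], the second is the contribution of [b] to
    [h |g|^2], with [g] the tamed drift. *)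
Definition noise_growth (b : R) : R :=
  C ^+ 2 * (1 + b) ^+ (2 * n) + C ^+ 2 * 3 * (1 + b ^+ 2).

Lemma noise_growth_ge0 b : 0 <= b -> 0 <= noise_growth b.
Proof.
move=> b0; rewrite /noise_growth addr_ge0// mulr_ge0 ?sqr_ge0//.
- by rewrite exprn_ge0// addr_ge0.
- by rewrite mulr_ge0 ?sqr_ge0.
- by rewrite addr_ge0 ?sqr_ge0.
Qed.

(** Expanding the square gives two terms besides [|z|^2].  In [2 h <z, g>] the
    point [z + b] is compared with [b] by the one-sided Lipschitz condition; the
    taming factor, which lies in [0, 1], multiplies a nonnegative bound and can be
    dropped.  The term [h^2 |g|^2] is [h (sqrt h |g|)^2], where [sqrt h |g|] grows linearly. *)
Lemma tamed_step_sqr (N : nat) (z b : 'cV[R]_d) : (0 < N)%N ->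
  enorm (z + (T / N%:R) *: tamed_drift T f l alpha N (z + b)) ^+ 2 <=
  (1 + (C + 1 + 3 * C ^+ 2) * (T / N%:R)) * enorm z ^+ 2 +
  T / N%:R * noise_growth (enorm b).
Proof.
move=> N0; set h := T / N%:R; have h0 : 0 <= h by rewrite divr_ge0// ltW.
have C0 := db_pos fB.
set g := tamed_drift _ _ _ _ _ _.
have gE : g = taming_factor T l alpha N (z + b) *: f (z + b) by [].
have th0 := taming_factor_ge0 T l alpha N (z + b).
have th1 := taming_factor_le1 T l alpha N (z + b).
have := db_linear fB (z + b) N0; rewrite -/h -/g => lin.
clearbody g.
have z0 := enorm_ge0 z; have b0 := enorm_ge0 b.
rewrite enorm_sqrDZ.
have hg : h * enorm g ^+ 2 <= 3 * C ^+ 2 * (1 + enorm z ^+ 2 + enorm b ^+ 2).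
  have -> : h * enorm g ^+ 2 = (Num.sqrt h * enorm g) ^+ 2.
    by rewrite -{1}(sqr_sqrtr h0) !expr2; ring.
  have zb : C * (1 + enorm (z + b)) <= C * (1 + enorm z + enorm b).
    by rewrite ler_wpM2l ?(ltW C0)// -addrA lerD2l ler_enormD.
  apply: (@le_trans _ _ ((C * (1 + enorm z + enorm b)) ^+ 2)).
    apply: lerXn2r; rewrite ?nnegrE ?mulr_ge0 ?sqrtr_ge0 ?enorm_ge0 ?(ltW C0) ?addr_ge0//.
    exact: le_trans lin zb.
  have s2 : (1 + enorm z + enorm b) ^+ 2 <= 3 * (1 + enorm z ^+ 2 + enorm b ^+ 2).
    have := sqr_ge0 (1 - enorm z); have := sqr_ge0 (1 - enorm b).
    by have := sqr_ge0 (enorm z - enorm b); rewrite !expr2; lra.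
  by have := ler_wpM2l (sqr_ge0 C) s2; rewrite !expr2; lra.
have zf : 2 * dot z (f (z + b)) <= (C + 1) * enorm z ^+ 2 + enorm (f b) ^+ 2.
  have -> : dot z (f (z + b)) = dot z (f (z + b) - f b) + dot z (f b).
    by rewrite -dotDr subrK.
  have := db_onesided fB (z + b) b; rewrite addrK.
  have := dot_le_enorm z (f b); have := sqr_ge0 (enorm z - enorm (f b)).
  by rewrite !expr2; lra.
have zg : 2 * dot z g <= (C + 1) * enorm z ^+ 2 + enorm (f b) ^+ 2.
  rewrite gE dotZr mulrCA.
  have r0 : 0 <= (C + 1) * enorm z ^+ 2 + enorm (f b) ^+ 2.
    by rewrite addr_ge0 ?sqr_ge0// mulr_ge0 ?sqr_ge0// addr_ge0// ltW.
  apply: (@le_trans _ _ (taming_factor T l alpha N (z + b) * ((C + 1) * enorm z ^+ 2 + enorm (f b) ^+ 2))).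
    by rewrite ler_wpM2l.
  by rewrite ler_piMl.
have fb : enorm (f b) ^+ 2 <= C ^+ 2 * (1 + enorm b) ^+ (2 * n).
  rewrite mulnC exprM -exprMn; apply: lerXn2r; rewrite ?nnegrE ?enorm_ge0//.
    by rewrite mulr_ge0 ?(ltW C0)// exprn_ge0// addr_ge0.
  exact: db_growth fB b.
have {}zg := ler_wpM2l h0 zg; have {}hg := ler_wpM2l h0 hg; have {}fb := ler_wpM2l h0 fb.
rewrite /noise_growth.
move: zg hg fb; move: (enorm (f b)) (dot z g) ((1 + enorm b) ^+ _) (enorm g) => p q r s.
rewrite !expr2; set zz := enorm z; set bb := enorm b.
lra.
Qed.

(** [x k - b k] obeys the recursion of [tamed_step_sqr], so that the scheme is
    bounded, on each path, by a polynomial of its noise and its initial value. *)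
Lemma tamed_path_sqr (N : nat) (x b : nat -> 'cV[R]_d) : (0 < N)%N ->
  b 0%N = 0 ->
  (forall k, (k < N)%N -> x k.+1 = x k +
    (T / N%:R) *: tamed_drift T f l alpha N (x k) + (b k.+1 - b k)) ->
  forall k, (k <= N)%N -> enorm (x k) <=
    1 + expR ((C + 1 + 3 * C ^+ 2) * T) *
      (enorm (x 0%N) ^+ 2 + \sum_(j < k) T / N%:R * noise_growth (enorm (b j))) + enorm (b k).
Proof.
move=> N0 b0 Hx k kN; pose z j := x j - b j.
have C0 := db_pos fB; have h0 : 0 <= T / N%:R by rewrite divr_ge0// ltW.
have K0 : 0 <= C + 1 + 3 * C ^+ 2 by rewrite !addr_ge0 ?mulr_ge0 ?sqr_ge0// ltW.
have zz : enorm (z k) ^+ 2 <= expR ((C + 1 + 3 * C ^+ 2) * ((T / N%:R) *+ k)) *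
    (enorm (z 0%N) ^+ 2 + \sum_(j < k) T / N%:R * noise_growth (enorm (b j))).
  apply: (@discrete_gronwall _ (fun j => enorm (z j) ^+ 2)
    (fun j => noise_growth (enorm (b j)))) => //.
  - by move=> j; rewrite noise_growth_ge0 ?enorm_ge0.
  - move=> j jk; have xj : x j = z j + b j by rewrite subrK.
    have -> : z j.+1 = z j + (T / N%:R) *: tamed_drift T f l alpha N (z j + b j).
      rewrite /z Hx ?(leq_trans jk)// -xj; move: (_ *: _) => g.
      by apply/colP => i; rewrite !mxE; ring.
    exact: tamed_step_sqr.
  - by move=> j; exact: sqr_ge0.
have z0 : z 0%N = x 0%N by rewrite /z b0 subr0.
rewrite z0 in zz.
have S0 : 0 <= \sum_(j < k) T / N%:R * noise_growth (enorm (b j)).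
  by apply: sumr_ge0 => j _; rewrite mulr_ge0// noise_growth_ge0// enorm_ge0.
have {}zz : enorm (z k) ^+ 2 <= expR ((C + 1 + 3 * C ^+ 2) * T) *
    (enorm (x 0%N) ^+ 2 + \sum_(j < k) T / N%:R * noise_growth (enorm (b j))).
  apply: (le_trans zz); rewrite ler_wpM2r ?addr_ge0 ?sqr_ge0// ler_expR ler_wpM2l//.
  rewrite -mulr_natr -mulrA ler_piMr ?(ltW T0)// mulrC ler_pdivrMr ?ltr0n// mul1r.
  by rewrite ler_nat.
have -> : x k = z k + b k by rewrite subrK.
apply: (le_trans (ler_enormD _ _)); rewrite lerD2r.
have := enorm_ge0 (z k); have := sqr_ge0 (enorm (z k) - 1); rewrite !expr2 in zz *; lra.
Qed.

End TamedEulerMoments.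

(** * Moments of the scheme along the Brownian paths *)

Section LpPolynomials.
Context {R : realType} {disp : measure_display} {Omega : measurableType disp}.
Variable P : probability Omega R.

Lemma Lp_bigO_poly_weight {I : Type} (D : I -> Prop) (X : I -> Omega -> R) (n : nat) (C : R) :
  Lp_bigO P D (fun=> 1) X ->
  Lp_bigO P D (fun=> 1) (fun i w => C * (1 + X i w) ^+ n).
Proof.
move=> HX; apply: Lp_bigOZ.
have H1 : Lp_bigO P D (fun=> 1) (fun i w => 1 + X i w).
  by apply: Lp_bigOD => //; apply: (@Lp_bigO_det _ _ _ _ _ _ 1) => // i _; rewrite normr1 mulr1.
have := Lp_bigO_expr n H1.
by apply: (@Lp_bigO_scale _ _ _ _ _ _ 1) => // i _; rewrite expr1n mulr1.
Qed.

Lemma Lp_bigOM1 {I : Type} (D : I -> Prop) (s : I -> R) (X Y : I -> Omega -> R) :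
  Lp_bigO P D (fun=> 1) X -> Lp_bigO P D s Y ->
  Lp_bigO P D s (fun i w => X i w * Y i w).
Proof.
move=> HX HY; have [s0 _ _] := HY.
by apply: (@Lp_bigO_scale _ _ _ _ _ _ 1) (Lp_bigOM HX HY) => // i _; rewrite !mul1r.
Qed.

Lemma Lp_bigO_cst {I : Type} (D : I -> Prop) (c : R) :
  Lp_bigO P D (fun=> 1) (fun _ _ => c).
Proof. by apply: (@Lp_bigO_det _ _ _ _ _ _ `|c|) => // i _; rewrite mulr1. Qed.

Lemma Lp_bigO_sqrt {I : Type} (D : I -> Prop) (s : I -> R) (X : I -> Omega -> R) :
  (forall i, D i -> 0 < s i) -> (forall i, D i -> measurable_fun setT (X i)) ->
  Lp_bigO P D (fun i => s i ^+ 2) (fun i w => X i w ^+ 2) -> Lp_bigO P D s X.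
Proof.
move=> s0 mX [_ _ EX]; apply: Lp_bigO_even => // q; have [C HC] := EX q.+1.
exists C => i Di; apply: le_trans (HC i Di).
rewrite le_eqVlt; apply/orP; left; apply/eqP; apply: eq_integral => w _.
by rewrite exprM normrX expr_div_n.
Qed.

End LpPolynomials.

Section GridIndex.
Context {R : realType}.
Variables (T : R) (N : nat).
Hypotheses (T0 : 0 < T) (N0 : (0 < N)%N).

(** The minimum puts the end point [T] in the last cell. *)
Definition grid_index (s : R) : nat := minn (Num.truncn (s / (T / N%:R))) N.-1.

Lemma grid_indexP s : 0 <= s <= T ->
  (grid_index s < N)%N /\ grid T N (grid_index s) <= s <= grid T N (grid_index s).+1.
Proof.
move=> /andP[s0 sT]; have h0 := @grid_step_gt0 R T N T0 N0.
have s0' : 0 <= s / (T / N%:R) by rewrite divr_ge0// ltW.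
have /andP[ks sk] := truncn_itv s0'.
have gk : grid T N (Num.truncn (s / (T / N%:R))) <= s by rewrite /grid -ler_pdivlMr.
have NN : N.-1.+1 = N by rewrite prednK.
rewrite /grid_index; have [kN|Nk] := leqP (Num.truncn (s / (T / N%:R))) N.-1.
  split; first by rewrite -[X in (_ < X)%N]NN ltnS.
  by rewrite gk/= /grid -ler_pdivrMr// ltW.
split; first by rewrite -[X in (_ < X)%N]NN ltnS.
rewrite NN gridN// sT andbT (le_trans _ gk)// grid_le//; exact: ltnW.
Qed.

End GridIndex.

Section EulerScheme.
Context {R : realType} (T : R) (T0 : 0 < T) {d m : nat}
  {disp : measure_display} {Omega : measurableType disp}.
Variables (P : probability Omega R) (F : R -> set_system Omega).
Hypothesis hF : filtration T F.
Variable W : R -> Omega -> 'cV[R]_m.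
Hypothesis hW : brownian_motion P T F W.
Variables (f : 'cV[R]_d -> 'cV[R]_d) (l alpha : R) (n : nat) (C : R).
Hypothesis fB : drift_bounds f T l alpha n C.
Variables (sigma : 'M[R]_(d, m)) (Y0 : Omega -> 'cV[R]_d).
Hypothesis hY0 : measurable_wrt (F 0) Y0.
Hypothesis hY0p : forall p : R, 1 <= p ->
     ('E_P[fun w => (enorm (Y0 w) `^ p)%R] < +oo)%E.
Variable YN : nat -> R -> Omega -> 'cV[R]_d.
Hypothesis hYN : forall N, (1 <= N)%N -> tamed_euler P T F f l alpha sigma Y0 W N (YN N).

Lemma measurable_mulmx (v : Omega -> 'cV[R]_m) i :
  (forall j, measurable_fun setT (fun w => v w j 0)) ->
  measurable_fun setT (fun w => (sigma *m v w) i 0).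
Proof.
move=> mv; rewrite (_ : (fun w => _) = fun w => \sum_j sigma i j * v w j 0).
  by apply: measurable_sum => j; exact: measurable_funM.
by apply/funext => w; rewrite mxE.
Qed.

Lemma noise_Lp {I : Type} (D : I -> Prop) (s t H : I -> R) :
  (forall i, D i -> [/\ 0 <= s i, s i <= t i, t i <= T, 0 < H i & t i - s i <= H i]) ->
  Lp_bigO P D (fun i => Num.sqrt (H i)) (fun i w => enorm (sigma *m (W (t i) w - W (s i) w))).
Proof.
move=> HD.
have H0 i : D i -> 0 < Num.sqrt (H i) by move=> /HD[_ _ _ h _]; rewrite sqrtr_gt0.
have L j := Lp_bigO_abs (bm_increment_Lp hF hW j HD).
have := Lp_bigO_sum H0 (fun i => Lp_bigO_sum H0 (fun j => Lp_bigOZ `|sigma i j| (L j))).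
apply: Lp_bigO_le => [i Di|i Di w].
  have [s0 st tT _ _] := HD i Di.
  apply: measurable_enorm => k; apply: measurable_mulmx => j.
  by apply: (bm_increment_measurable hF hW); [rewrite s0 (le_trans st)|rewrite (le_trans s0)].
rewrite ger0_norm ?enorm_ge0// (le_trans (enorm_le_sum_coord _))//.
rewrite ger0_norm; last by do 2 (apply: sumr_ge0 => ? _); rewrite mulr_ge0.
apply: ler_sum => k _; rewrite mxE (le_trans (ler_norm_sum _ _ _))//.
by apply: ler_sum => j _; rewrite normrM.
Qed.

Lemma initial_Lp {I : Type} (D : I -> Prop) :
  Lp_bigO P D (fun=> 1) (fun _ w => enorm (Y0 w)).
Proof.
have m0 : measurable_fun setT (fun w => enorm (Y0 w)).
  have TT : 0 <= (0 : R) <= T by rewrite lexx ltW.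
  have := measurable_for_comp hY0 (@continuous_enorm R d).
  exact: (measurable_for_measurable hF TT).
split => // q; case: q => [|q].
  exists 1 => i _; under eq_integral do rewrite expr0.
  by rewrite integral_cst//= [P _]probability_setT mule1.
have := @hY0p q.+1%:R; rewrite ler1n => /(_ isT); rewrite unlock => lty.
exists (fine (\int[P]_w (enorm (Y0 w) `^ q.+1%:R)%:E)) => i _.
rewrite fineK; last first.
  by rewrite ge0_fin_numE// integral_ge0// => w _; rewrite lee_fin powR_ge0.
rewrite le_eqVlt; apply/orP; left; apply/eqP; apply: eq_integral => w _.
by rewrite divr1 ger0_norm ?enorm_ge0// powR_mulrn// enorm_ge0.
Qed.

Lemma euler_step_ae N : (1 <= N)%N ->
  {ae P, forall w, YN N 0 w = Y0 w /\ forall k s, (k < N)%N ->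
    grid T N k <= s <= grid T N k.+1 -> s <= T ->
    YN N s w = YN N (grid T N k) w +
      (s - grid T N k) *: tamed_drift T f l alpha N (YN N (grid T N k) w) +
      sigma *m (W s w - W (grid T N k) w)}.
Proof.
move=> N0; have [_ H] := hYN N0; apply: filterS H => w Hw; split.
  exact: (euler_path0 T0 (x := fun s => YN N s w) (w := fun s => W s w) Hw).
exact: (euler_path_step T0 N0 (x := fun s => YN N s w) (w := fun s => W s w) Hw).
Qed.

Lemma YN_enorm_measurable N s : (0 < N)%N -> 0 <= s <= T ->
  measurable_fun setT (fun w => enorm (YN N s w)).
Proof.
move=> N0 sT; have [aY _] := hYN N0.
exact: (adapted_measurable hF aY (@continuous_enorm R d)).
Qed.

(** The pathwise bound is a sum of [N] terms of weight [T/N], each a polynomial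
    of the noise at a grid point. *)
Lemma YN_grid_Lp : Lp_bigO P (fun j : nat * nat => (0 < j.1)%N /\ (j.2 <= j.1)%N)
  (fun=> 1) (fun j w => enorm (YN j.1 (grid T j.1 j.2) w)).
Proof.
set D := fun j : nat * nat => _.
have gT N k : (0 < N)%N -> (k <= N)%N -> 0 <= grid T N k <= T.
  by move=> N0 kN; rewrite grid_ge0//= -{2}(gridN T N0) grid_le.
have b1 : Lp_bigO P D (fun=> 1)
    (fun j w => enorm (sigma *m (W (grid T j.1 j.2) w - W 0 w))).
  apply: (@Lp_bigO_scale _ _ _ _ _ _ (Num.sqrt T) (fun=> Num.sqrt T)) => //.
    by move=> i _; rewrite mulr1.
  apply: (@noise_Lp _ _ (fun=> 0) (fun j => grid T j.1 j.2)) => -[N k] [/= N0 kN].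
  by have /andP[g0 g1] := gT N k N0 kN; split => //; rewrite subr0.
have K0 : Lp_bigO P D (fun=> 1) (fun j w => noise_growth n C (enorm (sigma *m (W (grid T j.1 j.2) w - W 0 w)))).
  rewrite /noise_growth; apply: Lp_bigOD.
    exact: Lp_bigO_poly_weight.
  apply: Lp_bigOZ; apply: Lp_bigOD; first exact: Lp_bigO_cst.
  have := Lp_bigO_expr 2 b1.
  by apply: (@Lp_bigO_scale _ _ _ _ _ _ 1) => // i _; rewrite expr1n mulr1.
have K1 : Lp_bigO P D (fun=> 1) (fun j w => \sum_(i < j.2) T / j.1%:R *
    noise_growth n C (enorm (sigma *m (W (grid T j.1 i) w - W 0 w)))).
  apply: (@Lp_bigO_weighted_sum _ _ _ P _ _ D D T (fun j => j.2) (fun j i => (j.1, i))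
    (fun j _ => T / j.1%:R) (fun=> 1) (fun=> 1)) K0 => //.
  - by move=> [N k] i [/= N0 kN] ik; split => //; split => //=; exact: leq_trans (ltnW ik) kN.
  - by move=> [N k] i [/= N0 kN] ik; rewrite divr_ge0// ltW.
  - move=> [N k] [/= N0 kN]; rewrite sumr_const card_ord -[leLHS]mulr_natr -mulrA.
    by rewrite ler_piMr ?(ltW T0)// mulrC ler_pdivrMr ?ltr0n// mul1r ler_nat.
have K2 : Lp_bigO P D (fun=> 1) (fun j w => 1 + expR ((C + 1 + 3 * C ^+ 2) * T) *
      (enorm (Y0 w) ^+ 2 + \sum_(i < j.2) T / j.1%:R *
       noise_growth n C (enorm (sigma *m (W (grid T j.1 i) w - W 0 w)))) +
      enorm (sigma *m (W (grid T j.1 j.2) w - W 0 w))).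
  apply: Lp_bigOD => //; apply: Lp_bigOD; first exact: Lp_bigO_cst.
  apply: Lp_bigOZ; apply: Lp_bigOD => //.
  have := Lp_bigO_expr 2 (initial_Lp D).
  by apply: (@Lp_bigO_scale _ _ _ _ _ _ 1) => // i _; rewrite expr1n mulr1.
apply: Lp_bigO_le_ae K2 => -[N k] [/= N0 kN].
  by apply: YN_enorm_measurable => //; exact: gT.
apply: filterS (euler_step_ae N0) => w [Y0w stepw].
rewrite ger0_norm ?enorm_ge0// (le_trans _ (ler_norm _))//.
have H := @tamed_path_sqr R d f T l alpha n C T0 fB N (fun j => YN N (grid T N j) w)
  (fun j => sigma *m (W (grid T N j) w - W 0 w)) N0.
have b0 : sigma *m (W (grid T N 0) w - W 0 w) = 0 by rewrite grid0 subrr mulmx0.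
have := H b0 _ k kN; rewrite grid0 Y0w; apply.
move=> j jN; rewrite (stepw j (grid T N j.+1) jN); last 2 first.
- by rewrite lexx grid_le// leqnSn.
- by have /andP[] := gT N j.+1 N0 jN.
have -> : grid T N j.+1 - grid T N j = T / N%:R by rewrite gridS addrC addKr.
by rewrite -mulmxBr opprB addrA subrK.
Qed.

Lemma YN_Lp : Lp_bigO P (fun j : nat * R => (0 < j.1)%N /\ 0 <= j.2 <= T)
  (fun=> 1) (fun j w => enorm (YN j.1 j.2 w)).
Proof.
set D := fun j : nat * R => _.
have gi N s : (0 < N)%N -> 0 <= s <= T -> (grid_index T N s < N)%N /\
    grid T N (grid_index T N s) <= s <= grid T N (grid_index T N s).+1.
  by move=> N0 sT; exact: grid_indexP.
have gX : Lp_bigO P D (fun=> 1)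
    (fun j w => enorm (YN j.1 (grid T j.1 (grid_index T j.1 j.2)) w)).
  apply: (Lp_bigO_reindex (g := fun j => (j.1, grid_index T j.1 j.2)) _ (YN_grid_Lp)).
  by move=> [N s] [/= N0 sT]; have [k1 _] := gi N s N0 sT; split => //=; exact: ltnW.
have gN : Lp_bigO P D (fun=> 1)
    (fun j w => enorm (sigma *m (W j.2 w - W (grid T j.1 (grid_index T j.1 j.2)) w))).
  apply: (@Lp_bigO_scale _ _ _ _ _ _ (Num.sqrt T) (fun=> Num.sqrt T)) => //.
    by move=> i _; rewrite mulr1.
  apply: (noise_Lp (s := fun j => grid T j.1 (grid_index T j.1 j.2))
    (t := fun j => j.2) (H := fun=> T)) => -[N s] [/= N0 sT].
  have [_ /andP[g1 g2]] := gi N s N0 sT; have /andP[s0 s1] := sT.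
  by split; rewrite ?grid_ge0// lerBlDr (le_trans s1)// lerDl grid_ge0.
have C0 := db_pos fB.
have := Lp_bigOD (Lp_bigOD gX (Lp_bigOZ T (Lp_bigO_poly_weight n C gX))) gN.
apply: Lp_bigO_le_ae => -[N s] [/= N0 sT]; first exact: (YN_enorm_measurable).
apply: filterS (euler_step_ae N0) => w [_ stepw].
have [kN ks] := gi N s N0 sT; have /andP[ks1 ks2] := ks; have /andP[s0 s1] := sT.
rewrite ger0_norm ?enorm_ge0// (le_trans _ (ler_norm _))// (stepw _ _ kN ks s1).
apply: (le_trans (ler_enormD _ _)); rewrite lerD2r; apply: (le_trans (ler_enormD _ _)).
rewrite lerD2l enormZ ger0_norm ?subr_ge0//; apply: ler_pM; rewrite ?subr_ge0 ?enorm_ge0//.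
  by rewrite lerBlDr (le_trans s1)// lerDl grid_ge0.
exact: tamed_drift_growth (db_growth fB).
Qed.

(** The grid stopped at the time [t]: whatever [t], it is reached at the end of
    the last cell, so that a single argument treats grid points and other times.
    The cells beyond [t] are reduced to a point. *)
Definition tau (N : nat) (t : R) (k : nat) : R := Num.min (grid T N k) t.

Definition cell_node (N : nat) (t : R) (k r : nat) : R :=
  node (tau N t k) (tau N t k.+1) N r.

Lemma tau0 N t : 0 <= t -> tau N t 0 = 0.
Proof. by move=> t0; rewrite /tau grid0 min_l. Qed.

Lemma tauN N t : (0 < N)%N -> t <= T -> tau N t N = t.
Proof. by move=> N0 tT; rewrite /tau gridN// min_r. Qed.

Lemma tau_le N t k : (0 < N)%N -> tau N t k <= tau N t k.+1.
Proof.
move=> N0; rewrite /tau le_min !ge_min lexx orbT andbT.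
by rewrite grid_le// leqnSn.
Qed.

Lemma tau_itv N t k : (0 < N)%N -> 0 <= t <= T -> 0 <= tau N t k <= T.
Proof.
move=> N0 /andP[t0 tT]; rewrite /tau le_min t0 grid_ge0//=.
by rewrite ge_min tT orbT.
Qed.

Lemma tau_length N t k : (0 < N)%N -> tau N t k.+1 - tau N t k <= T / N%:R.
Proof.
move=> N0; have h0 := grid_step_gt0 T0 N0.
rewrite lerBlDr /tau gridS; have [gt|tg] := leP (grid T N k) t.
  by rewrite ge_min addrC lexx.
by rewrite ge_min lerDr (ltW h0) orbT.
Qed.

Lemma cell_step N t k s (x : R -> 'cV[R]_d) (w : R -> 'cV[R]_m)
    (g : 'cV[R]_d -> 'cV[R]_d) : (0 < N)%N -> 0 <= t <= T -> (k < N)%N ->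
  (forall k s, (k < N)%N -> grid T N k <= s <= grid T N k.+1 -> s <= T ->
    x s = x (grid T N k) + (s - grid T N k) *: g (x (grid T N k)) +
      sigma *m (w s - w (grid T N k))) ->
  tau N t k <= s <= tau N t k.+1 ->
  x s = x (tau N t k) + (s - tau N t k) *: g (x (tau N t k)) +
    sigma *m (w s - w (tau N t k)).
Proof.
move=> N0 /andP[t0 tT] kN Hx; rewrite /tau; have [gt|tg] := leP (grid T N k) t.
  rewrite le_min => /and3P[gs sg st].
  by apply: Hx => //; [rewrite gs sg|exact: le_trans st tT].
rewrite min_r; last by rewrite (le_trans (ltW tg))// grid_le.
rewrite -eq_le => /eqP <-.
by rewrite !subrr scale0r mulmx0 !addr0.
Qed.

(** Families of random variables are indexed by tuples made of some of the
    components [(N, t, k, r, s)]: number of steps, final time, cell, node in the cell, and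
    time. *)
Definition cell_dom (j : nat * R * nat) : Prop :=
  [/\ (0 < j.1.1)%N, 0 <= j.1.2 <= T & (j.2 < j.1.1)%N].

Definition cell_time_dom (j : nat * R * nat * R) : Prop :=
  cell_dom j.1 /\ tau j.1.1.1 j.1.1.2 j.1.2 <= j.2 <= tau j.1.1.1 j.1.1.2 j.1.2.+1.

Lemma cell_time_itv N t k s : cell_time_dom (N, t, k, s) -> 0 <= s <= T.
Proof.
move=> [[/= N0 t0T kN] /= /andP[ts st]].
have /andP[a0 _] := tau_itv k N0 t0T; have /andP[_ b0] := tau_itv k.+1 N0 t0T.
by rewrite (le_trans a0)//= (le_trans st).
Qed.

Lemma YN_tau_Lp : Lp_bigO P cell_dom (fun=> 1)
  (fun j w => enorm (YN j.1.1 (tau j.1.1 j.1.2 j.2) w)).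
Proof.
apply: (Lp_bigO_reindex (g := fun j : nat * R * nat => (j.1.1, tau j.1.1 j.1.2 j.2)) _
  (YN_Lp)).
by move=> [[N t] k] [/= N0 tT kN]; split => //; exact: tau_itv.
Qed.

Lemma YN_time_Lp : Lp_bigO P cell_time_dom (fun=> 1)
  (fun j w => enorm (YN j.1.1.1 j.2 w)).
Proof.
apply: (Lp_bigO_reindex (g := fun j : nat * R * nat * R => (j.1.1.1, j.2)) _
  (YN_Lp)).
move=> [[[N t] k] s] H; have := cell_time_itv H.
by case: H => [[/= N0 tT kN] _].
Qed.

Lemma YN_tau_time_Lp : Lp_bigO P cell_time_dom (fun=> 1)
  (fun j w => enorm (YN j.1.1.1 (tau j.1.1.1 j.1.1.2 j.1.2) w)).
Proof.
by apply: (Lp_bigO_reindex (g := fun j : nat * R * nat * R => j.1) _ YN_tau_Lp) => -[j s] [].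
Qed.

Lemma sqrt_step N : Num.sqrt (T / N%:R) = Num.sqrt T * Num.sqrt N%:R^-1.
Proof. by rewrite sqrtrM// ltW. Qed.

Lemma inv_nat_le_sqrt N : (0 < N)%N -> N%:R^-1 <= Num.sqrt N%:R^-1 :> R.
Proof.
move=> N0; have n0 : 0 < N%:R^-1 :> R by rewrite invr_gt0 ltr0n.
have s1 : Num.sqrt N%:R^-1 <= 1 :> R.
  by rewrite -[leRHS]sqrtr1 ler_wsqrtr// invf_le1 ?ltr0n// ler1n.
by rewrite -{1}(sqr_sqrtr (ltW n0)) expr2 ler_piMl ?sqrtr_ge0.
Qed.

Lemma sqrt_inv_nat_gt0 N : (0 < N)%N -> 0 < Num.sqrt N%:R^-1 :> R.
Proof. by move=> N0; rewrite sqrtr_gt0 invr_gt0 ltr0n. Qed.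

Lemma YN_increment_measurable N s u : (0 < N)%N -> 0 <= s <= T -> 0 <= u <= T ->
  measurable_fun setT (fun w => enorm (YN N s w - YN N u w)).
Proof.
move=> N0 sT uT; have [aY _] := hYN N0.
apply: measurable_enorm => i.
rewrite (_ : (fun w => _) = fun w => YN N s w i 0 - YN N u w i 0); last first.
  by apply/funext => w; rewrite !mxE.
by apply: measurable_funB; exact: (adapted_coord hF).
Qed.

Lemma noise_cell_Lp : Lp_bigO P cell_time_dom (fun j => Num.sqrt (j.1.1.1)%:R^-1)
  (fun j w => enorm (sigma *m (W j.2 w - W (tau j.1.1.1 j.1.1.2 j.1.2) w))).
Proof.
apply: (@Lp_bigO_scale _ _ _ _ _ _ (Num.sqrt T) (fun j => Num.sqrt (T / (j.1.1.1)%:R))).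
- by move=> j _; rewrite sqrt_step.
- by move=> j [[N0 _ _] _]; exact: sqrt_inv_nat_gt0.
apply: (noise_Lp (s := fun j => tau j.1.1.1 j.1.1.2 j.1.2)
  (t := fun j => j.2) (H := fun j => T / (j.1.1.1)%:R)) => -[[[N t] k] s] H.
have /andP[s0 sT] := cell_time_itv H.
case: H => [[/= N0 tT kN] /= /andP[ts st]].
split => //; first by have /andP[] := tau_itv k N0 tT.
  exact: grid_step_gt0.
by apply: le_trans (tau_length t k N0); rewrite lerD2r.
Qed.

Lemma YN_increment_Lp : Lp_bigO P cell_time_dom (fun j => Num.sqrt (j.1.1.1)%:R^-1)
  (fun j w => enorm (YN j.1.1.1 j.2 w - YN j.1.1.1 (tau j.1.1.1 j.1.1.2 j.1.2) w)).
Proof.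
have C0 := db_pos fB.
have H1 : Lp_bigO P cell_time_dom (fun j => Num.sqrt (j.1.1.1)%:R^-1)
    (fun j w => (C * (1 + enorm (YN j.1.1.1 (tau j.1.1.1 j.1.1.2 j.1.2) w)) ^+ n) *
       (T / (j.1.1.1)%:R)).
  apply: Lp_bigOM1; first exact: Lp_bigO_poly_weight YN_tau_time_Lp.
  apply: (@Lp_bigO_det _ _ _ _ _ _ T) => [[[[N t] k] s] [[/= N0 _ _] _]|[[[N t] k] s] [[/= N0 _ _] _]].
    exact: sqrt_inv_nat_gt0.
  by rewrite ger0_norm ?divr_ge0 ?(ltW T0)// ler_wpM2l ?(ltW T0)// inv_nat_le_sqrt.
have := Lp_bigOD H1 noise_cell_Lp.
apply: Lp_bigO_le_ae => -[[[N t] k] s] H.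
  have sT := cell_time_itv H; case: H => [[/= N0 tT kN] /= ts].
  by apply: YN_increment_measurable => //; exact: tau_itv.
case: H => [[/= N0 tT kN] /= ts].
apply: filterS (euler_step_ae N0) => w [_ stepw].
rewrite ger0_norm ?enorm_ge0// (le_trans _ (ler_norm _))//.
rewrite {1}(cell_step (x := fun s => YN N s w) (w := fun s => W s w) N0 tT kN stepw ts).
rewrite addrAC (addrAC (YN N (tau N t k) w)) subrr add0r.
rewrite (le_trans (ler_enormD _ _))// lerD2r.
have /andP[ts1 ts2] := ts.
rewrite enormZ ger0_norm ?subr_ge0// mulrC; apply: ler_pM; rewrite ?subr_ge0 ?enorm_ge0//.
  exact: tamed_drift_growth (db_growth fB).
by apply: le_trans (tau_length t k N0); rewrite lerD2r.
Qed.

(** * The martingale part of the error *)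

Hypothesis C2f : C2 f.

Lemma continuous_drift : continuous f.
Proof.
by move=> x; apply: differentiable_continuous; case: C2f => + _ _; apply.
Qed.

(** The coordinates of [Df(x) sigma], which separate the factor known at the
    beginning of a cell from the Brownian increments. *)
Definition noise_coef (i : 'I_d) (j : 'I_m) (x : 'cV[R]_d) : R := 'd f x (col j sigma) i 0.

Lemma continuous_noise_coef i j : continuous (noise_coef i j).
Proof.
move=> x; apply: (@continuous_comp _ _ _ (fun y => 'd f y (col j sigma)) (fun z : 'cV[R]_d => z i 0)).
  by apply: differentiable_continuous; case: C2f => _ + _; apply.
exact: continuous_coord.
Qed.

Lemma diff_mulmx_coord (x : 'cV[R]_d) (u : 'cV[R]_m) i :
  'd f x (sigma *m u) i 0 = \sum_j noise_coef i j x * u j 0.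
Proof.
have -> : sigma *m u = \sum_j u j 0 *: col j sigma.
  apply/colP => k; rewrite !mxE summxE; apply: eq_bigr => j _.
  by rewrite !mxE mulrC.
have -> : 'd f x (\sum_j u j 0 *: col j sigma) = \sum_j u j 0 *: 'd f x (col j sigma).
  elim: (index_enum 'I_m) => [|j r IH].
    by rewrite !big_nil -(scale0r (0 : 'cV[R]_d)) (diff_scale f x 0 0) !scale0r.
  rewrite !big_cons -IH -(diff_scale f x); exact: linearD.
by rewrite summxE; apply: eq_bigr => j _; rewrite mxE mulrC.
Qed.

Definition node_dom (j : nat * R * nat * nat) : Prop :=
  cell_dom j.1 /\ (j.2 <= j.1.1.1)%N.

Lemma cell_node_itv N t k r : node_dom (N, t, k, r) ->
  tau N t k <= cell_node N t k r <= tau N t k.+1.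
Proof.
move=> [[/= N0 tT kN] /= rN]; apply: node_itv => //; exact: tau_le.
Qed.

Lemma node_time_dom N t k r : node_dom (N, t, k, r) ->
  cell_time_dom (N, t, k, cell_node N t k r).
Proof. by move=> H; split; [case: H|exact: cell_node_itv]. Qed.

Definition cell_len (N : nat) (t : R) (k : nat) : R := tau N t k.+1 - tau N t k.

Lemma cell_len_ge0 N t k : (0 < N)%N -> 0 <= cell_len N t k.
Proof. by move=> N0; rewrite subr_ge0 tau_le. Qed.

Lemma cell_nodeS N t k r :
  cell_node N t k r.+1 = cell_node N t k r + cell_len N t k / N%:R.
Proof. exact: nodeS. Qed.

Lemma cell_len_Lp {I : Type} (D : I -> Prop) (g : I -> nat * R * nat) :
  (forall i, D i -> cell_dom (g i)) ->
  Lp_bigO P D (fun i => (g i).1.1%:R^-1) (fun i _ => cell_len (g i).1.1 (g i).1.2 (g i).2).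
Proof.
move=> Dg; apply: (@Lp_bigO_det _ _ _ _ _ _ T) => i /Dg[N0 tT kN].
  by rewrite invr_gt0 ltr0n.
by rewrite ger0_norm ?cell_len_ge0// tau_length.
Qed.

Definition noise_term i j (p : nat * R * nat * nat) (w : Omega) : R :=
  let: (N, t, k, r) := p in
  cell_len N t k * (noise_coef i j (YN N (tau N t k) w) *
    (W (cell_node N t k r) w - W (tau N t k) w) j 0).

Lemma noise_coef_Lp i j : Lp_bigO P cell_dom (fun=> 1)
  (fun p w => noise_coef i j (YN p.1.1 (tau p.1.1 p.1.2 p.2) w)).
Proof.
have H := Lp_bigOZ (enorm (col j sigma))
  (Lp_bigO_poly_weight n C (YN_tau_Lp)).
apply: Lp_bigO_le H => -[[N t] k] [/= N0 tT kN].
  have [aY _] := hYN N0.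
  apply: (adapted_measurable hF aY (@continuous_noise_coef i j)); exact: tau_itv.
move=> w; apply: (le_trans (coord_le_enorm _ _)); apply: le_trans (ler_norm _).
by rewrite mulrC; exact: db_diff fB _ _.
Qed.

Lemma noise_term_Lp i j : Lp_bigO P node_dom
  (fun p => p.1.1.1%:R^-1 * Num.sqrt p.1.1.1%:R^-1) (noise_term i j).
Proof.
have D1 (p : nat * R * nat * nat) : node_dom p -> cell_dom p.1 by case.
have H1 := cell_len_Lp D1.
have H2 := Lp_bigO_reindex (E := node_dom) D1 (noise_coef_Lp i j).
have H3 : Lp_bigO P node_dom (fun p => Num.sqrt p.1.1.1%:R^-1)
  (fun p w => (W (cell_node p.1.1.1 p.1.1.2 p.1.2 p.2) w - W (tau p.1.1.1 p.1.1.2 p.1.2) w) j 0).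
  apply: (@Lp_bigO_scale _ _ _ _ _ _ (Num.sqrt T) (fun p => Num.sqrt (T / p.1.1.1%:R))).
  - by move=> p _; rewrite sqrt_step.
  - by move=> p [[N0 _ _] _]; exact: sqrt_inv_nat_gt0.
  apply: (bm_increment_Lp hF hW j (H := fun p => T / (p.1.1.1)%:R)) => -[[[N t] k] r] H.
  have /andP[v0 vT] := cell_time_itv (node_time_dom H).
  have /andP[v1 v2] := cell_node_itv H.
  case: H => [[/= N0 tT kN] /= rN].
  split => //; first by have /andP[] := tau_itv k N0 tT.
    exact: grid_step_gt0.
  by apply: le_trans (tau_length t k N0); rewrite lerD2r.
by apply: (Lp_bigO_eq _ (Lp_bigOM H1 (Lp_bigOM1 H2 H3))) => -[[[N t] k] r] _ w.
Qed.

Definition noise_increment i j (p : nat * R) (k : nat) (w : Omega) : R :=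
  \sum_(r < p.1) p.1%:R^-1 * noise_term i j (p, k, val r) w.

Definition noise_sum i j (p : nat * R) (k : nat) (w : Omega) : R :=
  \sum_(k' < k) noise_increment i j p k' w.

Definition path_dom (p : nat * R) : Prop := (0 < p.1)%N /\ 0 <= p.2 <= T.

Lemma noise_increment_Lp i j :
  Lp_bigO P (fun p : nat * R * nat => path_dom p.1 /\ (p.2 < p.1.1)%N)
    (fun p => p.1.1%:R^-1 * Num.sqrt p.1.1%:R^-1)
    (fun p => noise_increment i j p.1 p.2).
Proof.
apply: (@Lp_bigO_weighted_sum _ _ _ P _ _ _ node_dom 1 (fun p => p.1.1) (fun p r => (p.1, p.2, r))
  (fun p _ => p.1.1%:R^-1) _ (fun p => p.1.1.1%:R^-1 * Num.sqrt p.1.1.1%:R^-1)) (noise_term_Lp i j).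
- move=> [[N t] k] [[/= N0 tT] kN].
  by rewrite mulr_gt0 ?sqrt_inv_nat_gt0// invr_gt0 ltr0n.
- by move=> [[N t] k] r [[/= N0 tT] kN] rN; split => //; split => //=; exact: ltnW.
- by move=> p r _ _; rewrite invr_ge0.
- move=> [[N t] k] [[/= N0 tT] kN]; rewrite sumr_const card_ord -[leLHS]mulr_natr.
  by rewrite mulVf// pnatr_eq0 gt_eqF.
Qed.

Lemma noise_increment_measurable_for i j N t k : (0 < N)%N -> 0 <= t <= T -> (k < N)%N ->
  measurable_for (F (tau N t k.+1)) (noise_increment i j (N, t) k).
Proof.
move=> N0 tT kN; have [aY _] := hYN N0.
have /andP[t0 t1] := tau_itv k N0 tT; have /andP[_ t2] := tau_itv k.+1 N0 tT.
apply: measurable_sum => r; apply: measurable_funM => //.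
have H : node_dom (N, t, k, val r) by split; [split|exact: (ltnW (ltn_ord r))].
have /andP[v1 v2] := cell_node_itv H; have v0 := le_trans t0 v1.
apply: measurable_funM => //; apply: measurable_funM.
  apply: (measurable_for_mono hF t0 (tau_le t k N0) t2).
  apply: (adapted_measurable_for aY (@continuous_noise_coef i j)).
  by rewrite t0.
by apply: (bm_increment_measurable_for hF hW) => //; exact: tau_le.
Qed.

Lemma noise_sum_measurable_for i j N t k : (0 < N)%N -> 0 <= t <= T -> (k <= N)%N ->
  measurable_for (F (tau N t k)) (noise_sum i j (N, t) k).
Proof.
move=> N0 tT; elim: k => [_|k IH kN].
  rewrite (_ : noise_sum _ _ _ _ = cst 0); first exact: measurable_cst.
  by apply/funext => w; rewrite /noise_sum big_ord0.
have /andP[t0 t1] := tau_itv k N0 tT; have /andP[_ t2] := tau_itv k.+1 N0 tT.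
rewrite (_ : noise_sum _ _ _ _ = noise_sum i j (N, t) k \+ noise_increment i j (N, t) k); last first.
  by apply/funext => w; rewrite /noise_sum big_ord_recr.
apply: measurable_funD; last exact: noise_increment_measurable_for.
exact: (measurable_for_mono hF t0 (tau_le t k N0) t2 (IH (ltnW kN))).
Qed.

(** Each term is the product of a variable known at the beginning of the cell
    and of a later Brownian increment, hence is orthogonal to all that is known at
    that time, in particular to the powers of the preceding sum. *)
Lemma noise_sum_Lp i j : Lp_bigO P (fun p : nat * R * nat => path_dom p.1 /\ (p.2 <= p.1.1)%N)
  (fun p => p.1.1%:R^-1) (fun p => noise_sum i j p.1 p.2).
Proof.
apply: (@Lp_bigO_martingale _ _ _ P _ path_dom (fun p => p.1) _ (noise_increment i j)).
- by move=> p [].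
- by move=> p w _; rewrite /noise_sum big_ord0.
- by move=> p k w _ _; rewrite /noise_sum big_ord_recr.
- exact: noise_increment_Lp.
move=> [N t] k q [/= N0 tT] kN LS.
have tm (r : 'I_N) : node_dom (N, t, k, val r) by split; [split|exact: (ltnW (ltn_ord r))].
have cd : cell_dom (N, t, k) by split.
have /andP[t0 t1] := tau_itv k N0 tT.
have LSq : all_moments P (fun w => noise_sum i j (N, t) k w ^+ q).
  by apply: (@Lp_bigO_scale _ _ _ _ _ _ 1) (Lp_bigO_expr q LS) => // _ _; rewrite expr1n mulr1.
have La := all_moments_of cd (noise_coef_Lp i j).
pose A w := noise_sum i j (N, t) k w ^+ q * (N%:R^-1 * cell_len N t k *
  noise_coef i j (YN N (tau N t k) w)).
have LA : all_moments P A by apply: Lp_bigOM1 => //; exact: Lp_bigOZ.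
have mA : measurable_for (F (tau N t k)) A.
  have [aY _] := hYN N0.
  apply: measurable_funM.
    by apply: measurable_funX; apply: noise_sum_measurable_for => //; exact: ltnW.
  apply: measurable_funM => //.
  by apply: (adapted_measurable_for aY (@continuous_noise_coef i j)); rewrite t0.
transitivity (\int[P]_w (\sum_(r < N) (A w * (W (cell_node N t k r) w - W (tau N t k) w) j 0%R)%:E))%E.
  apply: eq_integral => w _; rewrite sumEFin mulr_sumr; congr EFin.
  by apply: eq_bigr => r _; rewrite /A /noise_term; ring.
rewrite integral_sum//; last first.
  move=> r; have LT := all_moments_of (tm r) (noise_term_Lp i j).
  have := @Lp_bigO_integrable _ _ _ _ _ _ _ _ tt (Lp_bigOM1 LSq (Lp_bigOZ N%:R^-1 LT)) Logic.I.
  apply: eq_integrable => // w _; rewrite /A/= /noise_term; congr EFin; ring.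
apply: big1 => r _; have /andP[v1 v2] := cell_node_itv (tm r).
apply: (bm_increment_orthogonal hF hW) => //.
by have /andP[] := cell_time_itv (node_time_dom (tm r)).
Qed.

Definition noise_vec (p : nat * R * nat * nat) (w : Omega) : 'cV[R]_d :=
  let: (N, t, k, r) := p in
  'd f (YN N (tau N t k) w) (sigma *m (W (cell_node N t k r) w - W (tau N t k) w)).

(** A left Riemann sum, up to the node [r], for the time integral over the cell of
    [Df(x) sigma (W s - W tau)], where [x] is the value of the scheme at [tau]. *)
Definition mart_part (N : nat) (t : R) (k r : nat) (w : Omega) : 'cV[R]_d :=
  \sum_(r' < r) (cell_len N t k / N%:R) *: noise_vec (N, t, k, val r') w.

Definition mart (N : nat) (t : R) (k : nat) (w : Omega) : 'cV[R]_d :=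
  \sum_(k' < k) mart_part N t k' N w.

Definition subcell := (nat * R * nat * nat * R)%type.

Definition subcell_dom (j : subcell) : Prop :=
  let: (N, t, k, r, s) := j in
  [/\ cell_dom (N, t, k), (r < N)%N & cell_node N t k r <= s <= cell_node N t k r.+1].

(** The piecewise linear interpolation of the martingale, differentiable in
    each subcell with derivative [noise_vec]. *)
Definition subcell_mart (j : subcell) (w : Omega) : 'cV[R]_d :=
  let: (N, t, k, r, s) := j in
  mart N t k w + mart_part N t k r w + (s - cell_node N t k r) *: noise_vec (N, t, k, r) w.

Lemma noise_vec_measurable p i : node_dom p ->
  measurable_fun setT (fun w => noise_vec p w i 0).
Proof.
case: p => [[[N t] k] r] H; have H' := H; case: H => [[/= N0 tT kN] rN].
have [aY _] := hYN N0; have vT := cell_time_itv (node_time_dom H').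
rewrite (_ : (fun w => _) = fun w => \sum_j noise_coef i j (YN N (tau N t k) w) *
    (W (cell_node N t k r) w - W (tau N t k) w) j 0); last first.
  by apply/funext => w; exact: diff_mulmx_coord.
apply: measurable_sum => j; apply: measurable_funM.
  apply: (adapted_measurable hF aY (@continuous_noise_coef i j)); exact: tau_itv.
by apply: (bm_increment_measurable hF hW) => //; exact: tau_itv.
Qed.

Lemma mart_part_measurable N t k r i : cell_dom (N, t, k) -> (r <= N)%N ->
  measurable_fun setT (fun w => mart_part N t k r w i 0).
Proof.
move=> cd rN; rewrite (_ : (fun w => _) = fun w =>
    \sum_(r' < r) (cell_len N t k / N%:R) * noise_vec (N, t, k, val r') w i 0); last first.
  by apply/funext => w; rewrite summxE; apply: eq_bigr => r' _; rewrite mxE.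
apply: measurable_sum => r'; apply: measurable_funM => //.
by apply: noise_vec_measurable; split => //=; rewrite (leq_trans (ltnW (ltn_ord r'))).
Qed.

Lemma mart_measurable N t k i : (0 < N)%N -> 0 <= t <= T -> (k <= N)%N ->
  measurable_fun setT (fun w => mart N t k w i 0).
Proof.
move=> N0 tT kN; rewrite (_ : (fun w => _) = fun w =>
    \sum_(k' < k) mart_part N t k' N w i 0); last first.
  by apply/funext => w; rewrite summxE.
apply: measurable_sum => k'; apply: mart_part_measurable => //.
by split => //=; exact: leq_trans (ltn_ord k') kN.
Qed.

Lemma subcell_mart_measurable j i : subcell_dom j ->
  measurable_fun setT (fun w => subcell_mart j w i 0).
Proof.
case: j => [[[[N t] k] r] s] [cd rN sv]; have [/= N0 tT kN] := cd.
rewrite (_ : (fun w => _) = fun w => mart N t k w i 0 + mart_part N t k r w i 0 +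
    (s - cell_node N t k r) * noise_vec (N, t, k, r) w i 0); last first.
  by apply/funext => w; rewrite /subcell_mart !mxE.
apply: measurable_funD; first apply: measurable_funD.
- by apply: mart_measurable => //; exact: ltnW.
- by apply: mart_part_measurable => //; exact: ltnW.
- apply: measurable_funM => //; apply: noise_vec_measurable; split => //=; exact: ltnW.
Qed.

Lemma mart_coord N t k w i :
  mart N t k w i 0 = \sum_j noise_sum i j (N, t) k w.
Proof.
rewrite /mart summxE /noise_sum exchange_big/=; apply: eq_bigr => k' _.
rewrite /mart_part summxE /noise_increment exchange_big/=; apply: eq_bigr => r _.
rewrite mxE /noise_vec diff_mulmx_coord mulr_sumr; apply: eq_bigr => j _.
by rewrite /noise_term; ring.
Qed.

Lemma mart_Lp : Lp_bigO P (fun p : nat * R * nat => path_dom p.1 /\ (p.2 <= p.1.1)%N)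
  (fun p => p.1.1%:R^-1) (fun p w => enorm (mart p.1.1 p.1.2 p.2 w)).
Proof.
set D := fun p : nat * R * nat => _.
have s0 p : D p -> 0 < p.1.1%:R^-1 :> R by move=> [[N0 _] _]; rewrite invr_gt0 ltr0n.
have L i j := Lp_bigO_abs (noise_sum_Lp i j).
have := Lp_bigO_sum s0 (fun i => Lp_bigO_sum s0 (L i)).
apply: Lp_bigO_le => [[[N t] k] [/= [N0 tT] kN]|[[N t] k] [/= [N0 tT] kN] w].
  by apply: measurable_enorm => i; exact: mart_measurable.
rewrite ger0_norm ?enorm_ge0// (le_trans (enorm_le_sum_coord _))// (le_trans _ (ler_norm _))//.
by apply: ler_sum => i _; rewrite mart_coord ler_norm_sum.
Qed.

Lemma noise_vec_Lp : Lp_bigO P node_dom (fun p => Num.sqrt p.1.1.1%:R^-1)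
  (fun p w => enorm (noise_vec p w)).
Proof.
have D1 (p : nat * R * nat * nat) : node_dom p -> cell_dom p.1 by case.
have D2 (p : nat * R * nat * nat) : node_dom p ->
    cell_time_dom (p.1, cell_node p.1.1.1 p.1.1.2 p.1.2 p.2).
  by case: p => [[[N t] k] r] H; exact: node_time_dom.
have H1 := Lp_bigO_poly_weight n C (Lp_bigO_reindex (E := node_dom) D1 (YN_tau_Lp)).
have H2 := Lp_bigO_reindex (E := node_dom) D2 (noise_cell_Lp).
apply: Lp_bigO_le (Lp_bigOM1 H1 H2) => p Dp.
  by apply: measurable_enorm => i; exact: noise_vec_measurable.
case: p Dp => [[[N t] k] r] Dp w; rewrite ger0_norm ?enorm_ge0// (le_trans _ (ler_norm _))//.
exact: db_diff fB _ _.
Qed.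

Lemma len_noise_vec_Lp : Lp_bigO P node_dom (fun p => p.1.1.1%:R^-1)
  (fun p w => cell_len p.1.1.1 p.1.1.2 p.1.2 * enorm (noise_vec p w)).
Proof.
have D1 (p : nat * R * nat * nat) : node_dom p -> cell_dom p.1 by case.
apply: (@Lp_bigO_scale _ _ _ _ _ _ 1) (Lp_bigOM (cell_len_Lp D1) noise_vec_Lp).
- move=> p [[N0 _ _] _]; rewrite mul1r ler_piMr ?invr_ge0//.
  by rewrite -[leRHS]sqrtr1 ler_wsqrtr// invf_le1 ?ltr0n// ler1n.
- by move=> p [[N0 _ _] _]; rewrite invr_gt0 ltr0n.
Qed.

(** Inside a single cell no cancellation is asked for: its length [1/N] already
    brings the noise below [1/N]. *)
Lemma subcell_mart_Lp : Lp_bigO P subcell_dom (fun j => j.1.1.1.1%:R^-1)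
  (fun j w => enorm (subcell_mart j w)).
Proof.
have s0 j : subcell_dom j -> 0 < j.1.1.1.1%:R^-1 :> R.
  by case: j => [[[[N t] k] r] s] [[/= N0 _ _] _ _]; rewrite invr_gt0 ltr0n.
have H1 : Lp_bigO P subcell_dom (fun j => j.1.1.1.1%:R^-1)
    (fun j w => enorm (mart j.1.1.1.1 j.1.1.1.2 j.1.1.2 w)).
  apply: (Lp_bigO_reindex (g := fun j : subcell => j.1.1) _ mart_Lp).
  case=> [[[[N t] k] r] s] [[/= N0 tT kN] _ _]; split => //=; exact: ltnW.
have H2 : Lp_bigO P subcell_dom (fun j => j.1.1.1.1%:R^-1)
    (fun j w => \sum_(r' < j.1.2.+1) j.1.1.1.1%:R^-1 *
       (cell_len j.1.1.1.1 j.1.1.1.2 j.1.1.2 * enorm (noise_vec (j.1.1, val r') w))).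
  apply: (@Lp_bigO_weighted_sum _ _ _ P _ _ _ node_dom 1 (fun j => j.1.2.+1) (fun j r => (j.1.1, r))
    (fun j _ => j.1.1.1.1%:R^-1) _ (fun p => p.1.1.1%:R^-1)) len_noise_vec_Lp => //.
  - case=> [[[[N t] k] r] s] r' [cd /= rN _] rr'; split => //; split => //=.
    by rewrite (leq_trans (ltnW rr')).
  - case=> [[[[N t] k] r] s] [[/= N0 _ _] rN _]; rewrite sumr_const card_ord -[leLHS]mulr_natr.
    by rewrite mulrC ler_pdivrMr ?ltr0n// mul1r ler_nat.
apply: Lp_bigO_le (Lp_bigOD H1 H2) => j Dj.
  by apply: measurable_enorm => i; exact: subcell_mart_measurable.
move=> w; rewrite ger0_norm ?enorm_ge0// (le_trans _ (ler_norm _))//.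
case: j Dj => [[[[N t] k] r] s] [[/= N0 tT kN] rN /andP[sv sv']].
rewrite -addrA (le_trans (ler_enormD _ _))// lerD2l big_ord_recr/=.
have l0 := cell_len_ge0 t k N0.
rewrite (le_trans (ler_enormD _ _))//; apply: lerD.
  rewrite (le_trans (ler_enorm_sum _ _ _))//; apply: ler_sum => r' _.
  by rewrite enormZ ger0_norm ?divr_ge0// mulrAC mulrC.
rewrite enormZ ger0_norm ?subr_ge0// mulrA ler_wpM2r ?enorm_ge0//.
by rewrite mulrC lerBlDr addrC -cell_nodeS.
Qed.

(** * The remainder *)

Definition rate (N : nat) : R := N%:R `^ (- Num.min alpha 1).

Lemma rate_gt0 N : (0 < N)%N -> 0 < rate N.
Proof. by move=> N0; rewrite powR_gt0// ltr0n. Qed.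

Lemma inv_le_rate N : (0 < N)%N -> N%:R^-1 <= rate N.
Proof.
move=> N0; rewrite -(powR_inv1 (ler0n _ N)); apply: ler_powR; first by rewrite ler1n.
by rewrite lerN2 ge_min lexx orbT.
Qed.

Lemma powRN_le_rate N : (0 < N)%N -> N%:R `^ (- alpha) <= rate N.
Proof.
move=> N0; apply: ler_powR; first by rewrite ler1n.
by rewrite lerN2 ge_min lexx.
Qed.

Definition subcell_remainder (j : subcell) (w : Omega) : R :=
  let: (N, t, k, r, s) := j in
  remainder_bound n C (N%:R `^ (- alpha)) (enorm (YN N s w)) (enorm (subcell_mart j w))
    (enorm (YN N (tau N t k) w)) (enorm (YN N s w - YN N (tau N t k) w)) `|s - tau N t k|
    (enorm (sigma *m (W s w - W (cell_node N t k r) w))).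

Lemma subcell_time_dom j : subcell_dom j -> cell_time_dom (j.1.1, j.2).
Proof.
case: j => [[[[N t] k] r] s] [cd /= rN /andP[vs sv]]; split => //=.
have n1 : node_dom (N, t, k, r) by split => //=; exact: ltnW.
have n2 : node_dom (N, t, k, r.+1) by [].
have /andP[h1 _] := cell_node_itv n1; have /andP[_ h2] := cell_node_itv n2.
by rewrite (le_trans h1)//= (le_trans sv).
Qed.

Lemma Lp_bigO_subcell_scale1 (X : subcell -> Omega -> R) (s : nat -> R) :
  (forall N, (0 < N)%N -> 0 < s N <= 1) ->
  Lp_bigO P subcell_dom (fun j => s j.1.1.1.1) X -> Lp_bigO P subcell_dom (fun=> 1) X.
Proof.
move=> s01; apply: (@Lp_bigO_scale _ _ _ _ _ _ 1) => //.
case=> [[[[N t] k] r] u] [[/= N0 _ _] _ _]; rewrite mulr1.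
by have /andP[] := s01 N N0.
Qed.

(** The martingale and the squared increment of the scheme are [O(1/N)]; so are
    the time elapsed in the cell and the noise since the last node, the nodes being
    at distance at most [T/N^2].  The taming error is [O(N ^ - alpha)]. *)
Lemma subcell_remainder_Lp : Lp_bigO P subcell_dom (fun j => rate j.1.1.1.1) subcell_remainder.
Proof.
have N0 j : subcell_dom j -> (0 < j.1.1.1.1)%N by case: j => [[[[N t] k] r] s] [[]].
have nu0 j : subcell_dom j -> 0 < j.1.1.1.1%:R^-1 :> R by move=> /N0; rewrite invr_gt0 ltr0n.
have r0 j : subcell_dom j -> 0 < rate j.1.1.1.1 by move=> /N0; exact: rate_gt0.
have nu1 (N : nat) : (0 < N)%N -> 0 < (N%:R^-1 : R) <= 1.
  by move=> N1; rewrite invr_gt0 ltr0n N1/= invf_le1 ?ltr0n// ler1n.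
have sq1 (N : nat) : (0 < N)%N -> 0 < (Num.sqrt N%:R^-1 : R) <= 1.
  by move=> N1; rewrite sqrt_inv_nat_gt0//= -[leRHS]sqrtr1 ler_wsqrtr//; case/andP: (nu1 N N1).
have to_rate (X : subcell -> Omega -> R) :
    Lp_bigO P subcell_dom (fun j => j.1.1.1.1%:R^-1) X ->
    Lp_bigO P subcell_dom (fun j => rate j.1.1.1.1) X.
  by apply: (@Lp_bigO_scale _ _ _ _ _ _ 1) => // j /N0 N1; rewrite mul1r inv_le_rate.
have HX := Lp_bigO_reindex (E := subcell_dom) subcell_time_dom
  (YN_time_Lp).
have Hx0 := Lp_bigO_reindex (E := subcell_dom) subcell_time_dom
  (YN_tau_time_Lp).
have HD := Lp_bigO_reindex (E := subcell_dom) subcell_time_dom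
  (YN_increment_Lp).
have HM := subcell_mart_Lp.
have HM1 := Lp_bigO_subcell_scale1 nu1 HM.
have HD1 := Lp_bigO_subcell_scale1 sq1 HD.
have Hw : Lp_bigO P subcell_dom (fun j => j.1.1.1.1%:R^-1) (fun j w =>
    enorm (sigma *m (W j.2 w - W (cell_node j.1.1.1.1 j.1.1.1.2 j.1.1.2 j.1.2) w))).
  apply: (@Lp_bigO_scale _ _ _ _ _ _ (Num.sqrt T) (fun j => Num.sqrt (T * j.1.1.1.1%:R^-1 ^+ 2))) => //.
    by move=> j /nu0 nj; rewrite sqrtrM ?(ltW T0)// sqrtr_sqr gtr0_norm.
  apply: (noise_Lp (s := fun j : subcell => cell_node j.1.1.1.1 j.1.1.1.2 j.1.1.2 j.1.2)
    (t := fun j => j.2) (H := fun j => T * j.1.1.1.1%:R^-1 ^+ 2)) => j Dj.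
  have nj := nu0 j Dj; have /andP[_ sT] := cell_time_itv (subcell_time_dom Dj).
  move: nj sT; case: j Dj => [[[[N t] k] r] s] [cd /= rN /andP[vs sv]] nj sT.
  have n1 : node_dom (N, t, k, r) by split => //=; exact: ltnW.
  have /andP[v0 _] := cell_time_itv (node_time_dom n1).
  split => //; first by rewrite mulr_gt0// exprn_gt0.
  rewrite lerBlDr addrC (le_trans sv)// cell_nodeS lerD2l expr2 mulrA ler_pM2r//.
  by have [/= N1 _ _] := cd; exact: tau_length.
have Hh : Lp_bigO P subcell_dom (fun j => j.1.1.1.1%:R^-1)
    (fun j _ => `|j.2 - tau j.1.1.1.1 j.1.1.1.2 j.1.1.2|).
  apply: (@Lp_bigO_det _ _ _ _ _ _ T) => // j Dj; rewrite normr_id.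
  have [[/= N1 tT kN] /= /andP[ts st]] := subcell_time_dom Dj.
  rewrite ger0_norm ?subr_ge0//; apply: le_trans (tau_length j.1.1.1.2 j.1.1.2 N1).
  by rewrite lerD2r.
have Hdel : Lp_bigO P subcell_dom (fun j => rate j.1.1.1.1) (fun j _ => j.1.1.1.1%:R `^ (- alpha)).
  apply: (@Lp_bigO_det _ _ _ _ _ _ 1) => // j /N0 N1; rewrite mul1r.
  by rewrite ger0_norm ?powR_ge0// powRN_le_rate.
have w1 := Lp_bigO_poly_weight n C (Lp_bigOD (Lp_bigOZ 2 HX) HM1).
have w2 := Lp_bigO_poly_weight n C (Lp_bigOD Hx0 HD1).
have w3 := Lp_bigO_poly_weight n C Hx0.
have HDD : Lp_bigO P subcell_dom (fun j => j.1.1.1.1%:R^-1)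
    (fun j w => enorm (YN j.1.1.1.1 j.2 w - YN j.1.1.1.1 (tau j.1.1.1.1 j.1.1.1.2 j.1.1.2) w) ^+ 2).
  apply: (@Lp_bigO_scale _ _ _ _ _ _ 1) (Lp_bigO_expr 2 HD) => // j /nu0 nj.
  by rewrite /= sqr_sqrtr ?(ltW nj)// mul1r.
have t1 := to_rate _ (Lp_bigOM1 w1 HM).
have t2 := to_rate _ (Lp_bigOM1 w2 HDD).
have t3 := to_rate _ (Lp_bigOM1 w3 (Lp_bigOD (Lp_bigOM1 w3 Hh) Hw)).
have t4 := Lp_bigOM1 w3 Hdel.
apply: Lp_bigO_eq (Lp_bigOD (Lp_bigOD (Lp_bigOD t1 t2) t3) t4) => -[[[[N t] k] r] s] _ w.
by rewrite /subcell_remainder /remainder_bound/= (mulrC `|_|) (mulrC (_ `^ _)).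
Qed.

(** * The corrected error *)

Variable Y : R -> Omega -> 'cV[R]_d.
Hypothesis aY : adapted T F Y.
Hypothesis cY : {ae P, forall w, continuous (fun t => Y t w)}.
Hypothesis cW : {ae P, forall w, continuous (fun t => W t w)}.
Hypothesis eqY : integral_equation P T (fun s w => f (Y s w)) sigma Y0 W Y.

Definition corrected_error (N : nat) (t : R) (w : Omega) : 'cV[R]_d :=
  Y t w - YN N t w - mart N t N w.

Definition riemann_remainder (e : R) (N : nat) (t : R) (k : nat) (w : Omega) (q : nat) : R :=
  \sum_(r < N) riemann_sum (cell_node N t k r) (cell_node N t k r.+1)
    (fun s => subcell_remainder (N, t, k, val r, s) w ^+ 2 + e) q.

Lemma riemann_sum_ge0 (a b : R) (g : R -> R) q : a <= b -> (forall s, 0 <= g s) ->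
  0 <= riemann_sum a b g q.
Proof.
by move=> ab g0; apply: sumr_ge0 => i _; rewrite mulr_ge0// divr_ge0// subr_ge0.
Qed.

Lemma eq_riemann_sum (a b : R) (g g' : R -> R) q : a <= b ->
  (forall s, a <= s <= b -> g s = g' s) -> riemann_sum a b g q = riemann_sum a b g' q.
Proof.
move=> ab gg'; apply: eq_bigr => i _; rewrite gg'//.
by apply: node_itv => //; exact: ltnW.
Qed.

Section FixedPath.
Variables (w : Omega) (N : nat) (t e : R).
Hypotheses (N0 : (0 < N)%N) (tT : 0 <= t <= T) (e0 : 0 < e).
Hypotheses (cYw : continuous (fun t => Y t w)) (cWw : continuous (fun t => W t w)).
Hypothesis eqYw : forall t, 0 <= t <= T -> Y t w = Y0 w
      + \col_i \int[lebesgue_measure]_(s in `[0, t]) (f (Y s w) i 0)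
      + sigma *m (W t w - W 0 w).
Hypothesis stepw : forall k s, (k < N)%N ->
    grid T N k <= s <= grid T N k.+1 -> s <= T ->
    YN N s w = YN N (grid T N k) w +
      (s - grid T N k) *: tamed_drift T f l alpha N (YN N (grid T N k) w) +
      sigma *m (W s w - W (grid T N k) w).
Hypothesis YN0w : YN N 0 w = Y0 w.

Lemma subcell_error k r : (k < N)%N -> (r < N)%N ->
  \forall q \near \oo,
    enorm (Y (cell_node N t k r.+1) w - YN N (cell_node N t k r.+1) w -
      (mart N t k w + mart_part N t k r.+1 w)) ^+ 2 <=
    expR ((C + 1) * (cell_len N t k / N%:R)) *
      (enorm (Y (cell_node N t k r) w - YN N (cell_node N t k r) w -
        (mart N t k w + mart_part N t k r w)) ^+ 2 +
       riemann_sum (cell_node N t k r) (cell_node N t k r.+1)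
         (fun s => subcell_remainder (N, t, k, r, s) w ^+ 2 + e) q).
Proof.
move=> kN rN; have cd : cell_dom (N, t, k) by split.
have n1 : node_dom (N, t, k, r) by split => //=; exact: ltnW.
have n2 : node_dom (N, t, k, r.+1) by [].
have /andP[ta ak] := cell_node_itv n1; have /andP[tb bk] := cell_node_itv n2.
set a := cell_node N t k r; set b := cell_node N t k r.+1.
have l0 := cell_len_ge0 t k N0.
have bE : b = a + cell_len N t k / N%:R by exact: cell_nodeS.
have ab : a <= b by rewrite bE lerDl divr_ge0.
have bma : b - a = cell_len N t k / N%:R by rewrite bE addrC addKr.
have a0 : 0 <= a by have /andP[] := cell_time_itv (node_time_dom n1).
have abT s : a <= s <= b -> 0 <= s <= T.
  move=> /andP[sa sb]; rewrite (le_trans a0)//= (le_trans sb)//.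
  by have /andP[] := cell_time_itv (node_time_dom n2).
pose x0 := YN N (tau N t k) w; pose g0 := tamed_drift T f l alpha N x0.
have C0 := db_pos fB.
have := @interval_error R d m f sigma n C C0 (db_lip fB) (db_diff fB) (db_taylor fB)
  (db_onesided fB) (continuous_drift) (fun s => Y s w) (fun s => W s w) (Y0 w) cYw cWw
  a b (tau N t k) x0 g0 (mart N t k w + mart_part N t k r w) (N%:R `^ (- alpha)) e
  a0 ab ta e0 (powR_ge0 _ _) (fun s sab => eqYw (abT s sab))
  (tamed_drift_growth T l alpha N x0 (db_growth fB)) (db_tame fB x0 N0).
move=> H; apply: filterS H => q.
have YNE s : a <= s <= b -> x0 + (s - tau N t k) *: g0 + sigma *m (W s w - W (tau N t k) w) = YN N s w.
  move=> /andP[sa sb]; apply/esym.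
  apply: (cell_step (x := fun s => YN N s w) (w := fun s => W s w) N0 tT kN stepw).
  by rewrite (le_trans ta)//= (le_trans sb).
rewrite (YNE b) ?ab ?lexx// (YNE a) ?ab ?lexx// subrr scale0r addr0 bma.
have -> : mart N t k w + mart_part N t k r w +
   (cell_len N t k / N%:R) *: 'd f x0 (sigma *m (W a w - W (tau N t k) w)) =
   mart N t k w + mart_part N t k r.+1 w.
  by rewrite /mart_part big_ord_recr/= addrA.
move=> /le_trans; apply; rewrite ler_wpM2l ?expR_ge0// lerD2l.
rewrite le_eqVlt; apply/orP; left; apply/eqP; apply: eq_riemann_sum => // s sab.
by rewrite /subcell_remainder (YNE s sab).
Qed.

Lemma cell_error k : (k < N)%N ->
  \forall q \near \oo,
    enorm (Y (tau N t k.+1) w - YN N (tau N t k.+1) w - mart N t k.+1 w) ^+ 2 <=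
    expR ((C + 1) * cell_len N t k) *
      (enorm (Y (tau N t k) w - YN N (tau N t k) w - mart N t k w) ^+ 2 +
       riemann_remainder e N t k w q).
Proof.
move=> kN; have C0 := db_pos fB.
have l0 := cell_len_ge0 t k N0.
have ab r : cell_node N t k r <= cell_node N t k r.+1.
  by rewrite cell_nodeS lerDl divr_ge0.
have := @gronwall_chain R (fun r => enorm (Y (cell_node N t k r) w - YN N (cell_node N t k r) w -
      (mart N t k w + mart_part N t k r w)) ^+ 2) (fun=> cell_len N t k / N%:R)
  (fun r q => riemann_sum (cell_node N t k r) (cell_node N t k r.+1)
         (fun s => subcell_remainder (N, t, k, r, s) w ^+ 2 + e) q) (C + 1) N.
have -> : \sum_(i < N) cell_len N t k / N%:R = cell_len N t k.
  by rewrite sumr_const card_ord -[LHS]mulr_natr divfK// pnatr_eq0 gt_eqF.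
have -> : cell_node N t k 0 = tau N t k by exact: node0.
have -> : cell_node N t k N = tau N t k.+1 by exact: node_last.
have -> : mart N t k w + mart_part N t k N w = mart N t k.+1 w by rewrite /mart big_ord_recr.
have -> : mart_part N t k 0 w = 0 by rewrite /mart_part big_ord0.
rewrite addr0; apply.
- by rewrite addr_ge0// ltW.
- by move=> _; rewrite divr_ge0.
- move=> r q; apply: riemann_sum_ge0 => // s.
  by rewrite addr_ge0 ?sqr_ge0// ltW.
- by move=> r rN; exact: subcell_error.
Qed.

(** The estimates on the subcells are chained through all the nodes of all the
    cells.  Being finitely many, they hold simultaneously from some rank on. *)
Lemma path_error : \forall q \near \oo,
  enorm (corrected_error N t w) ^+ 2 <= expR ((C + 1) * T) * \sum_(k < N) riemann_remainder e N t k w q.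
Proof.
have C0 := db_pos fB; have /andP[t0 t1] := tT.
have l0 k := cell_len_ge0 t k N0.
have ab k r : cell_node N t k r <= cell_node N t k r.+1.
  by rewrite cell_nodeS lerDl divr_ge0.
have S0 k q : 0 <= riemann_remainder e N t k w q.
  apply: sumr_ge0 => r _; apply: riemann_sum_ge0 => // s.
  by rewrite addr_ge0 ?sqr_ge0// ltW.
have := @gronwall_chain R (fun k => enorm (Y (tau N t k) w - YN N (tau N t k) w - mart N t k w) ^+ 2)
  (cell_len N t) (fun k => riemann_remainder e N t k w) (C + 1) N _ l0 S0 cell_error.
rewrite tauN// tau0// => H.
have {}H : \forall q \near \oo, enorm (corrected_error N t w) ^+ 2 <=
    expR ((C + 1) * \sum_(i < N) cell_len N t i) *
    (enorm (Y 0 w - YN N 0 w - mart N t 0 w) ^+ 2 + \sum_(i < N) riemann_remainder e N t i w q).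
  by apply: H; rewrite addr_ge0// ltW.
apply: filterS H => q /le_trans; apply.
have -> : Y 0 w - YN N 0 w - mart N t 0 w = 0.
  rewrite YN0w /mart big_ord0 subr0.
  rewrite eqYw ?lexx ?(ltW T0)// subrr mulmx0 addr0 set_itv1.
  by apply/colP => i; rewrite !mxE Rintegral_set1 addr0 subrr.
rewrite enorm0 expr0n add0r ler_wpM2r ?sumr_ge0//.
rewrite ler_expR ler_wpM2l ?addr_ge0 ?(ltW C0)//.
have -> M : \sum_(i < M) cell_len N t i = tau N t M - tau N t 0.
  by elim: M => [|M IH]; [rewrite big_ord0 subrr|rewrite big_ord_recr/= IH /cell_len; ring].
by rewrite tauN// tau0// subr0.
Qed.

End FixedPath.

(** Three nested weighted sums, over the cells, the subcells and the nodes of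
    the Riemann sums, of total weights [T], 1 and 1.  The slack [e] of the Riemann
    sums is taken of the order of the squared rate. *)
Lemma riemann_remainder_Lp : Lp_bigO P (fun j : nat * R * nat => path_dom j.1)
  (fun j => rate j.1.1 ^+ 2)
  (fun j w => \sum_(k < j.1.1) riemann_remainder (rate j.1.1 ^+ 2) j.1.1 j.1.2 k w j.2).
Proof.
have X1 : Lp_bigO P subcell_dom (fun j => rate j.1.1.1.1 ^+ 2)
    (fun j w => subcell_remainder j w ^+ 2 + rate j.1.1.1.1 ^+ 2).
  have H := Lp_bigO_expr 2 (subcell_remainder_Lp).
  have [s0 _ _] := H; apply: Lp_bigOD => //.
  by apply: (@Lp_bigO_det _ _ _ _ _ _ 1) => // j _; rewrite mul1r ger0_norm ?sqr_ge0.
have cellP N t k r : cell_dom (N, t, k) -> (r < N)%N ->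
    cell_node N t k r <= cell_node N t k r.+1.
  by move=> [/= N0 _ _] _; rewrite cell_nodeS lerDl divr_ge0// cell_len_ge0.
have X2 : Lp_bigO P (fun j : nat * R * nat * nat * nat => cell_dom j.1.1 /\ (j.1.2 < j.1.1.1.1)%N)
    (fun j => rate j.1.1.1.1 ^+ 2)
    (fun j w => \sum_(i < j.2) j.2%:R^-1 *
       (subcell_remainder (j.1, node (cell_node j.1.1.1.1 j.1.1.1.2 j.1.1.2 j.1.2)
                (cell_node j.1.1.1.1 j.1.1.1.2 j.1.1.2 j.1.2.+1) j.2 i) w ^+ 2 +
        rate j.1.1.1.1 ^+ 2)).
  apply: (@Lp_bigO_weighted_sum _ _ _ P _ _ _ subcell_dom 1 (fun j => j.2)
    (fun j i => (j.1, node (cell_node j.1.1.1.1 j.1.1.1.2 j.1.1.2 j.1.2)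
                (cell_node j.1.1.1.1 j.1.1.1.2 j.1.1.2 j.1.2.+1) j.2 i))
    (fun j _ => j.2%:R^-1) _ (fun j => rate j.1.1.1.1 ^+ 2)) X1.
  - by move=> j [[N0 _ _] _]; rewrite exprn_gt0// rate_gt0.
  - move=> [[[[N t] k] r] q] i [cd /= rN] iq; split => //; split => //.
    by apply: node_itv; [exact: cellP|exact: ltnW].
  - by move=> j i _ _; rewrite invr_ge0.
  - move=> [j q] _ /=; rewrite sumr_const card_ord -[leLHS]mulr_natr.
    by have [->|q0] := eqVneq q 0%N; rewrite ?mulr0// mulVf// pnatr_eq0.
have X3 : Lp_bigO P (fun j : nat * R * nat * nat => cell_dom j.1) (fun j => rate j.1.1.1 ^+ 2)
    (fun j w => \sum_(r < j.1.1.1) j.1.1.1%:R^-1 * \sum_(i < j.2) j.2%:R^-1 *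
       (subcell_remainder (j.1, val r, node (cell_node j.1.1.1 j.1.1.2 j.1.2 r)
                (cell_node j.1.1.1 j.1.1.2 j.1.2 r.+1) j.2 i) w ^+ 2 +
        rate j.1.1.1 ^+ 2)).
  apply: (@Lp_bigO_weighted_sum _ _ _ P _ _ _
    (fun j : nat * R * nat * nat * nat => cell_dom j.1.1 /\ (j.1.2 < j.1.1.1.1)%N)
    1 (fun j => j.1.1.1) (fun j r => (j.1, r, j.2))
    (fun j _ => j.1.1.1%:R^-1) _ (fun j => rate j.1.1.1.1 ^+ 2)) X2.
  - by move=> j [N0 _ _]; rewrite exprn_gt0// rate_gt0.
  - by move=> [[[N t] k] q] r cd rN.
  - by move=> j i _ _; rewrite invr_ge0.
  - move=> [[[N t] k] q] [/= N0 _ _]; rewrite sumr_const card_ord -[leLHS]mulr_natr.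
    by rewrite mulVf// pnatr_eq0 gt_eqF.
have X4 : Lp_bigO P (fun j : nat * R * nat => path_dom j.1) (fun j => rate j.1.1 ^+ 2)
    (fun j w => \sum_(k < j.1.1) cell_len j.1.1 j.1.2 k *
      \sum_(r < j.1.1) j.1.1%:R^-1 * \sum_(i < j.2) j.2%:R^-1 *
       (subcell_remainder (j.1, val k, val r, node (cell_node j.1.1 j.1.2 k r)
                (cell_node j.1.1 j.1.2 k r.+1) j.2 i) w ^+ 2 + rate j.1.1 ^+ 2)).
  apply: (@Lp_bigO_weighted_sum _ _ _ P _ _ _ (fun j : nat * R * nat * nat => cell_dom j.1)
    T (fun j => j.1.1) (fun j k => (j.1, k, j.2))
    (fun j k => cell_len j.1.1 j.1.2 k) _ (fun j => rate j.1.1.1 ^+ 2)) X3.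
  - by move=> j [N0 _]; rewrite exprn_gt0// rate_gt0.
  - by move=> [[N t] q] k [/= N0 tT] kN; split.
  - by move=> j i [N0 _] _; exact: cell_len_ge0.
  - move=> [[N t] q] [/= N0 tT].
    have -> M : \sum_(i < M) cell_len N t i = tau N t M - tau N t 0.
      by elim: M => [|M IH]; [rewrite big_ord0 subrr|rewrite big_ord_recr/= IH /cell_len; ring].
    by have /andP[t0 t1] := tT; rewrite tauN// tau0// subr0.
apply: Lp_bigO_eq X4 => -[[N t] q] _ w /=; apply: eq_bigr => k _.
rewrite /riemann_remainder mulr_sumr; apply: eq_bigr => r _.
rewrite mulrA /riemann_sum mulr_sumr; apply: eq_bigr => i _.
by rewrite cell_nodeS addrC addKr mulrA.
Qed.

Lemma corrected_error_coord_measurable N t i : path_dom (N, t) ->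
  measurable_fun setT (fun w => corrected_error N t w i 0).
Proof.
move=> [/= N0 tT]; have [aYN _] := hYN N0.
rewrite (_ : (fun w => _) = fun w => Y t w i 0 - YN N t w i 0 - mart N t N w i 0); last first.
  by apply/funext => w; rewrite /corrected_error !mxE.
apply: measurable_funB; first by apply: measurable_funB; exact: (adapted_coord hF).
apply: (mart_measurable) => //.
Qed.

(** The Riemann sums bound the square of the corrected error, from a rank that
    depends on the path. *)
Lemma corrected_error_Lp : Lp_bigO P path_dom (fun p => rate p.1) (fun p w => enorm (corrected_error p.1 p.2 w)).
Proof.
have r0 p : path_dom p -> 0 < rate p.1 by move=> [N0 _]; exact: rate_gt0.
have mE p : path_dom p -> measurable_fun setT (fun w => enorm (corrected_error p.1 p.2 w)).
  by case: p => N t pd; apply: measurable_enorm => i; exact: corrected_error_coord_measurable.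
apply: Lp_bigO_sqrt => //.
apply: (@Lp_bigO_fatou _ _ _ P _ _ _ _ (fun j w => expR ((C + 1) * T) *
  \sum_(k < j.1.1) riemann_remainder (rate j.1.1 ^+ 2) j.1.1 j.1.2 k w j.2)).
- by move=> p pd; apply: measurable_funX; exact: mE.
- by apply: Lp_bigOZ; exact: riemann_remainder_Lp.
move=> [N t] pd; have [/= N0 tT] := pd.
have e0 : 0 < rate N ^+ 2 by rewrite exprn_gt0// rate_gt0.
apply: filterS3 (filterI cY cW) eqY (euler_step_ae N0) => w [cYw cWw] eqYw [YN0w stepw].
have [q0 _ H] := path_error N0 tT e0 cYw cWw eqYw stepw YN0w.
exists q0 => q q0q; rewrite ger0_norm ?sqr_ge0// (le_trans _ (ler_norm _))//.
exact: H.
Qed.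

Lemma tamed_euler_error_Lp : Lp_bigO P path_dom (fun p => rate p.1)
  (fun p w => enorm (YN p.1 p.2 w - Y p.2 w)).
Proof.
have HM : Lp_bigO P path_dom (fun p => rate p.1) (fun p w => enorm (mart p.1 p.2 p.1 w)).
  have := Lp_bigO_reindex (g := fun p : nat * R => (p, p.1)) (E := path_dom) (fun p pd => conj pd (leqnn _))
    (mart_Lp).
  apply: (@Lp_bigO_scale _ _ _ _ _ _ 1) => [p [N0 _]|p [N0 _]]; last exact: rate_gt0.
  by rewrite mul1r inv_le_rate.
apply: Lp_bigO_le (Lp_bigOD corrected_error_Lp HM) => [[N t] [/= N0 tT]|[N t] _ w].
  have [aYN _] := hYN N0; apply: measurable_enorm => i.
  rewrite (_ : (fun w => _) = fun w => YN N t w i 0 - Y t w i 0); last first.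
    by apply/funext => w; rewrite !mxE.
  by apply: measurable_funB; exact: (adapted_coord hF).
rewrite ger0_norm ?enorm_ge0// (le_trans _ (ler_norm _))//= -enormN opprB.
by rewrite (le_trans _ (ler_enormD _ _))// /corrected_error subrK.
Qed.

End EulerScheme.

(** * Convergence of the tamed Euler method *)

Section Clamp.
Context {R : realType}.
Variables (T : R) (T0 : 0 < T).

(** Freezing a path outside [0, T] makes it continuous on the whole line
    without changing it on [0, T]. *)
Definition clamp (s : R) : R := Num.max 0 (Num.min s T).

Lemma clamp_itv s : 0 <= clamp s <= T.
Proof. by rewrite /clamp le_max lexx/= ge_max (ltW T0)/= ge_min lexx orbT. Qed.

Lemma clampE s : 0 <= s <= T -> clamp s = s.
Proof. by move=> /andP[s0 sT]; rewrite /clamp min_l// max_r. Qed.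

Lemma continuous_clamp : continuous clamp.
Proof.
move=> s; apply: (@continuous_max _ _ (cst 0) (fun s => Num.min s T)).
  exact: cvg_cst.
by apply: (@continuous_min _ _ id (cst T)); [exact: cvg_id|exact: cvg_cst].
Qed.

Lemma continuous_comp_clamp {d : nat} (g : R -> 'cV[R]_d) :
  {within `[0, T], continuous g} -> continuous (fun s => g (clamp s)).
Proof.
move=> /subspace_continuousP cg s.
have cs : (`[0, T]%classic : set R) (clamp s) by rewrite /= in_itv/= clamp_itv.
apply: cvg_trans (cg _ cs) => U /= HU.
have H : \forall z \near s, clamp z \in `[0, T] -> U (g (clamp z)).
  exact: (@continuous_clamp s _ HU).
change (\forall z \near s, U (g (clamp z))).
by apply: filterS H => z; apply; rewrite in_itv/= clamp_itv.
Qed.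

End Clamp.

Theorem theorem5p2 (R : realType) (T : R) (hT : 0 < T)
  (d m : nat) (hd : (0 < d)%N) (hm : (0 < m)%N)
  (disp : measure_display) (Omega : measurableType disp)
  (P : probability Omega R)
  (F : R -> set_system Omega) (hF : usual_conditions P T F)
  (W : R -> Omega -> 'cV[R]_m) (hW : brownian_motion P T F W)
  (f : 'cV[R]_d -> 'cV[R]_d) (hf : drift_assumption f)
  (sigma : 'M[R]_(d, m))
  (Y0 : Omega -> 'cV[R]_d) (hY0 : measurable_wrt (F 0) Y0)
  (hY0p : forall p : R, 1 <= p ->
     ('E_P[fun w => (enorm (Y0 w) `^ p)%R] < +oo)%E)
  (l : R) (hl : 0 < l) (hfl : poly_lipschitz_exponent f l)
  (Y : R -> Omega -> 'cV[R]_d) (hY : strong_solution P T F f sigma Y0 W Y)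
  (alpha : R) (halpha : 0 < alpha)
  (YN : nat -> R -> Omega -> 'cV[R]_d)
  (hYN : forall N, (1 <= N)%N ->
     tamed_euler P T F f l alpha sigma Y0 W N (YN N)) :
  forall p : R, 0 < p ->
  exists K : R, forall N : nat, (1 <= N)%N ->
    (ereal_sup [set 'E_P[fun w => (enorm (YN N t w - Y t w) `^ p)%R]
               | t in `[0%R, T]%classic]
     <= (K * N%:R `^ (- (Num.min alpha 1 * p)))%:E)%E.
Proof.
move=> p p0.
have T0 := hT; have hFf : filtration T F by case: hF.
have [n [C fB]] := drift_bounds_exist hT hl halpha hf hfl.
have C2f : C2 f by case: hf.
have [aW W0 cW incW] := hW; have [aY cY eqY] := hY.
pose W' s w := W (clamp T s) w; pose Y' s w := Y (clamp T s) w.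
have W'E s : 0 <= s <= T -> W' s = W s by move=> sT; apply/funext => w; rewrite /W' clampE.
have Y'E s : 0 <= s <= T -> Y' s = Y s by move=> sT; apply/funext => w; rewrite /Y' clampE.
have z0 : 0 <= (0 : R) <= T by rewrite lexx ltW.
have cW' : {ae P, forall w, continuous (fun s => W' s w)}.
  by apply: filterS cW => w; exact: continuous_comp_clamp.
have cY' : {ae P, forall w, continuous (fun s => Y' s w)}.
  by apply: filterS cY => w; exact: continuous_comp_clamp.
have hW' : brownian_motion P T F W'.
  split.
  - by move=> t tT; rewrite W'E//; exact: aW.
  - by rewrite W'E.
  - by apply: filterS cW' => w cw; exact: continuous_subspaceT.
  - move=> s t s0 st tT; have := incW s t s0 st tT; rewrite !W'E//.
      by rewrite s0 (le_trans (ltW st)).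
    by rewrite tT (le_trans s0 (ltW st)).
have aY' : adapted T F Y' by move=> t tT; rewrite Y'E//; exact: aY.
have eqY' : integral_equation P T (fun s w => f (Y' s w)) sigma Y0 W' Y'.
  apply: filterS eqY => w Hw t tT; rewrite !W'E// Y'E// (Hw t tT).
  congr (_ + _ + _); apply/colP => i; rewrite !mxE; apply: eq_Rintegral => s.
  rewrite inE/= in_itv/= => /andP[s0 st]; rewrite Y'E// s0.
  by have /andP[_] := tT; exact: le_trans.
have hYN' N : (1 <= N)%N -> tamed_euler P T F f l alpha sigma Y0 W' N (YN N).
  move=> N0; have [aYN eqYN] := hYN N N0; split => //.
  by apply: filterS eqYN => w Hw t tT; rewrite !W'E//; exact: Hw.
have L := tamed_euler_error_Lp hT hFf hW' fB hY0 hY0p hYN' C2f aY' cY' cW' eqY'.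
have [K HK] := Lp_bigO_powR L p0; exists K => N N0.
apply: ge_ereal_sup => _ [t tT <-]; rewrite unlock.
have tT' : 0 <= t <= T by move: tT; rewrite /= in_itv.
have := HK (N, t) (conj N0 tT'); rewrite /rate/= -powRrM mulNr Y'E// => H.
apply: le_trans H; rewrite le_eqVlt; apply/orP; left; apply/eqP.
by apply: eq_integral => w _; rewrite ger0_norm ?enorm_ge0.
Qed.
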